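(* Let $d\ge 1$, let $w$ be a probability measure on $\mathbb{R}^d$ with $\int_{\mathbb{R}^d}x\,w(dx)=0$ and $\sigma^2:=\int_{\mathbb{R}^d}|x|^2w(dx)<\infty$. Let $\beta:[0,\infty)\to[0,\infty)$ be bounded and continuous, and suppose that $\psi(t):=e^{-\int_0^t\beta(s)ds}$ satisfies $\psi(t)=\Psi t^{-\alpha}+O(t^{-\alpha-\delta})$ as $t\to+\infty$, for some constants $\Psi>0$, $\alpha\in(0,1)$ and $\delta\in(0,1-\alpha)$. Let $r^0\in L^1((0,\infty)\times\mathbb{R}^d)$, $r^0\ge 0$, and let $r$ be the solution of $$\partial_t r(t,a,x)+\partial_a r(t,a,x)+\beta(a)r(t,a,x)=0,\qquad t,a>0,\ x\in\mathbb{R}^d,$$ $$\mathbf{r}(t,x):=r(t,0,x)=\int_0^\infty\int_{\mathbb{R}^d}w(x-y)\beta(a)r(t,a,y)\,dy\,da,\qquad r(0,a,x)=r^0(a,x).$$ Set $\rho(t,x):=\int_0^\infty r(t,a,x)\,da$ and $\rho^0(x):=\int_0^\infty r^0(a,x)\,da$. Then: (i) $\int_{\mathbb{R}^d}\rho(t,x)\,dx=\int_{\mathbb{R}^d}\rho^0(x)\,dx$ for all $t\ge 0$; (ii) $\int_{\mathbb{R}^d}x\,\rho(t,x)\,dx=\int_{\mathbb{R}^d}x\,\rho^0(x)\,dx$ for all $t\ge 0$; (iii) if $\int_{\mathbb{R}^d}|x|^2\rho^0(x)\,dx<\infty$, then $$\int_{\mathbb{R}^d}|x|^2\rho(t,x)\,dx\sim\frac{\sin(\pi\alpha)}{\pi\alpha}\,\frac{\sigma^2}{\Psi}\left(\int_{\mathbb{R}^d}\rho^0(x)\,dx\right)t^\alpha\qquad\text{as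 }t\to\infty.$$
   Context: Since $w$ is a measure, the boundary condition is understood as $\mathbf{r}(t,\cdot)=\int_0^\infty\beta(a)\,\big(w*r(t,a,\cdot)\big)\,da$, where $*$ is convolution on $\mathbb{R}^d$ of a measure with an $L^1$ function. Solutions are understood in the mild sense, by integration along characteristics: $$r(t,a,x)=\mathbf{r}(t-a,x)\,\psi(a)\,\mathbf{1}_{t\ge a}+r^0(a-t,x)\,\frac{\psi(a)}{\psi(a-t)}\,\mathbf{1}_{t<a},$$ with $\mathbf{r}$ satisfying this boundary condition. The notation $f(t)\sim c\,g(t)$ means $f(t)/g(t)\to c$. *)

(* Defs.v *)
From HB Require Import structures.
From mathcomp Require Import all_boot all_order all_algebra.
From mathcomp Require Import all_classical all_reals all_analysis.
Set Implicit Arguments.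
Unset Strict Implicit.
Unset Printing Implicit Defensive.
Import Order.TTheory GRing.Theory Num.Theory.
Import numFieldNormedType.Exports.
Local Open Scope classical_set_scope.
Local Open Scope ring_scope.

(* R^d is the type [d.-tuple R] with the library's product sigma-algebra (the
   Borel one, R being second countable).  Since the library has Lebesgue
   measure on R only, it is built here as the d-fold product measure;
   [lebesgue_tuple_box] characterises it. *)
Section tuple_cons.
Context {R : realType} (d : nat).

Definition tuple_cons (p : R * d.-tuple R) : d.+1.-tuple R :=
  [tuple of p.1 :: p.2].

Lemma measurable_tuple_cons : measurable_fun [set: R * d.-tuple R] tuple_cons.
Proof. exact: measurable_cons. Qed.

Variable mu : {sigma_finite_measure set (d.-tuple R) -> \bar R}.

Definition lebesgue_cons : set (d.+1.-tuple R) -> \bar R :=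
  pushforward (@lebesgue_measure R \x mu)%E tuple_cons.

Let lebesgue_cons0 : lebesgue_cons set0 = 0%E.
Proof. by rewrite /lebesgue_cons /pushforward preimage_set0 measure0. Qed.

Let lebesgue_cons_ge0 A : (0 <= lebesgue_cons A)%E.
Proof. exact: (measure_ge0 (@lebesgue_measure R \x mu)%E). Qed.

Let lebesgue_cons_sigma_additive : semi_sigma_additive lebesgue_cons.
Proof.
move=> F mF tF mUF; rewrite /lebesgue_cons /pushforward preimage_bigcup.
apply: measure_semi_sigma_additive.
- move=> n; rewrite -[X in measurable X]setTI.
  exact: measurable_tuple_cons.
- apply/trivIsetP => /= i j _ _ ij; rewrite -preimage_setI.
  by move/trivIsetP : tF => /(_ _ _ _ _ ij) ->//; rewrite preimage_set0.
- rewrite -preimage_bigcup -[X in measurable X]setTI.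
  exact: measurable_tuple_cons.
Qed.

HB.instance Definition _ := isMeasure.Build _ _ _ lebesgue_cons
  lebesgue_cons0 lebesgue_cons_ge0 lebesgue_cons_sigma_additive.

Let lebesgue_cons_sigma_finite : sigma_finite setT lebesgue_cons.
Proof.
have /sigma_finiteP[F [TF ndF Foo]] := sigma_finiteT (@lebesgue_measure R).
have /sigma_finiteP[G [TG ndG Goo]] := sigma_finiteT mu.
pose hd (x : d.+1.-tuple R) := thead x.
pose tl (x : d.+1.-tuple R) := [tuple of behead x].
have mhd : measurable_fun setT hd by exact: (@measurable_tnth _ _ _ ord0).
have mtl : measurable_fun setT tl by exact: measurable_behead.
exists (fun n => hd @^-1` F n `&` tl @^-1` G n).
  apply/esym/seteqP; split => // x _.
  have [n _ Fn] : (\bigcup_n F n) (hd x) by rewrite -TF.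
  have [k _ Gk] : (\bigcup_n G n) (tl x) by rewrite -TG.
  exists (maxn n k) => //; split => /=.
    by move: Fn; exact/subsetPset/ndF/leq_maxl.
  by move: Gk; exact/subsetPset/ndG/leq_maxr.
move=> k; have [mF Fk] := Foo k; have [mG Gk] := Goo k; split.
  apply: measurableI; rewrite -[X in measurable X]setTI; first exact: mhd.
  exact: mtl.
rewrite /lebesgue_cons /pushforward (_ : _ @^-1` _ = F k `*` G k).
  by rewrite product_measure1E// lte_mul_pinfty// ge0_fin_numE.
have tl_cons (p : R * d.-tuple R) : tl (tuple_cons p) = p.2 by exact/val_inj.
by apply/seteqP; split => -[a x] /=; rewrite /hd theadE tl_cons.
Qed.

HB.instance Definition _ := Measure_isSigmaFinite.Build _ _ _ lebesgue_cons
  lebesgue_cons_sigma_finite.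

End tuple_cons.

Fixpoint lebesgue_tuple (R : realType) (d : nat) :
    {sigma_finite_measure set (d.-tuple R) -> \bar R} :=
  match d with
  | 0%N => \d_([tuple] : 0.-tuple R)
  | d'.+1 => lebesgue_cons (lebesgue_tuple R d')
  end.

Lemma lebesgue_tuple_box (R : realType) (d : nat) (A : 'I_d -> set R) :
  (forall i, measurable (A i)) ->
  lebesgue_tuple R d [set x | forall i, A i (tnth x i)]
    = (\prod_(i < d) lebesgue_measure (A i))%E.
Proof.
elim: d A => [|d IH] A mA.
  rewrite big_ord0 /= diracE mem_set// => -[] //.
have mB : measurable [set x : d.-tuple R | forall i, A (lift ord0 i) (tnth x i)].
  rewrite (_ : [set x | _] = \bigcap_(i in [set: 'I_d])
     ((fun x : d.-tuple R => tnth x i) @^-1` A (lift ord0 i))); last first.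
    by apply/seteqP; split => x /= h i; [move=> _; exact: h|exact: h].
  apply: fin_bigcap_measurable; first exact: finite_finset.
  by move=> i _; rewrite -[X in measurable X]setTI; exact: measurable_tnth.
rewrite big_ord_recl -IH// -product_measure1E//=; last exact: mA.
rewrite /lebesgue_cons /pushforward.
congr product_measure1; apply/seteqP; split => -[a x] /=.
  move=> h; split; first by have := h ord0; rewrite tnth0.
  by move=> i; have := h (lift ord0 i); rewrite tnthS.
move=> [h0 h] i; case: (unliftP ord0 i) => [j ->|->].
  by rewrite tnthS.
by rewrite tnth0.
Qed.

Section age_structured_jump.
Context {R : realType} {d : nat}.
Local Notation mu := (@lebesgue_measure R).
Local Notation Rd := (d.-tuple R).

Definition tsub (x y : Rd) : Rd := [tuple tnth x i - tnth y i | i < d].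

Definition sqnorm (x : Rd) : R := \sum_(i < d) tnth x i ^+ 2.

Definition convol (w : probability Rd R) (f : Rd -> R) (x : Rd) : \bar R :=
  (\int[w]_y (f (tsub x y))%:E)%E.

Definition survival (beta : R -> R) (t : R) : R :=
  expR (- \int[mu]_(s in `[0, t]) beta s).

(* The trace [r t 0 x] is the boundary density.  It is taken in the space
   L^1_loc([0, +oo[; L^1(R^d)), where solutions are unique; accordingly the
   boundary condition is an equality in that space, i.e. for almost every
   (t, x), which is also where the convolutions converge absolutely. *)
Record mild_solution (w : probability Rd R) (beta : R -> R) (r0 : R -> Rd -> R)
    (r : R -> R -> Rd -> R) : Prop := MildSolution {
  mild_trace_integrable : forall T : R,
    (mu \x lebesgue_tuple R d)%E.-integrable (`[0, T] `*` [set: Rd])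
      (fun p => (r p.1 0 p.2)%:E) ;
  mild_characteristics : forall (t a : R) (x : Rd), 0 <= t -> 0 <= a ->
    r t a x = if a <= t then r (t - a) 0 x * survival beta a
              else r0 (a - t) x * (survival beta a / survival beta (a - t)) ;
  mild_boundary : {ae (mu \x lebesgue_tuple R d)%E, forall p, 0 <= p.1 ->
    (r p.1 0 p.2)%:E = (\int[mu]_(a in `[0%R, +oo[)
                          ((beta a)%:E * convol w (r p.1 a) p.2))%E}
}.

(* [age_total (r t)] is rho(t, .) and [age_total r0] is rho^0. *)
Definition age_total (u : R -> Rd -> R) (x : Rd) : \bar R :=
  (\int[mu]_(a in `]0%R, +oo[) (u a x)%:E)%E.

End age_structured_jump.

(* Main.v *)
Require Import Defs.
From mathcomp Require Import all_boot all_order all_algebra.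
From mathcomp Require Import all_classical all_reals all_analysis.
From mathcomp Require Import measurable_realfun ring lra.
Set Implicit Arguments.
Unset Strict Implicit.
Unset Printing Implicit Defensive.
Import Order.TTheory GRing.Theory Num.Theory.
Import numFieldNormedType.Exports.
Local Open Scope classical_set_scope.
Local Open Scope ring_scope.

(* Put h(t, x) = r(t, 0, x) for t >= 0 and h(-a, x) = r0(a, x) / psi(a) for
   a > 0, so that r(t, a, x) = psi(a) h(t - a, x) for all ages and the boundary
   condition is the renewal equation h(t) = int f(a) w * h(t - a) da for t >= 0,
   where f = beta psi = - psi'.  Integrating it against phi(x) over [0, T] gives
   an exact balance between the births up to time T, the moments of rho at times
   0 and T, and the same quantities for the averages E[phi(x + z)], z ~ w.  As
   E[phi(x + z)] - phi(x) is 0 for phi = 1 and phi = x_i, and sigma^2 for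
   phi = |x|^2, the first two moments are conserved while the third grows by
   sigma^2 N(T), where N(T) is the mass of the births in [0, T].

   Conservation of mass says that psi * N' tends to the total mass M.  Convolving
   with t^(alpha - 1), and using that t^(alpha - 1) * psi tends to
   c = Psi B(alpha, 1 - alpha) = Psi pi / sin(pi alpha), yields
   c N(t) ~ M t^alpha / alpha.  The value of the Beta integral comes from the
   partial fraction expansion of the cosecant, which is obtained by integrating
   cos(x t) against the Fejer kernel. *)

(** * Lebesgue measure on tuples *)

(** All integrals are extended reals, so the balance is an equality of sums in which nothing may be
    cancelled before it is known to be finite. Finiteness of the moments of the births in [0, T] and
    positivity of the solution, neither of which is assumed, come from one contraction: of the
    particles born in [0, T], at least the fraction psi(T) > 0 has not jumped again at time T. Hence
    I <= (1 - psi(T)) I + b with I finite bounds I. For x_i the weight is split into positive and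
    negative parts, whose averages are not shifted by constants; only the difference of their
    moments is conserved, and infinite values are carried along.

    No regularity of N' is available for the growth of N. The kernel t^(alpha - 1) is chosen because
    its convolution with t^(-alpha) is constant: applied to psi * N' it yields c N, up to a small
    multiple of N and an error due to recent births, and the latter is again bounded by the mass psi
    * N'. What psi * N' misses in the total mass is the initial population that has not jumped yet;
    it fades by dominated convergence. *)

Section lebesgue_change_of_variables.
Context {R : realType}.
Local Notation mu := (@lebesgue_measure R).
Local Open Scope ereal_scope.
Implicit Type f : R -> \bar R.

Lemma lebesgue_measure_shift (b : R) (A : set R) : measurable A ->
  pushforward mu ((fun x => x + b)%R : _ -> measurableTypeR R) A = mu A.
Proof.
have mb : measurable_fun setT ((fun x => x + b)%R : measurableTypeR R -> measurableTypeR R).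
  exact: measurable_funD.
move=> mA; apply/esym/lebesgue_measure_unique => //= _ [[x y]] _ <-.
rewrite /pushforward (_ : _ @^-1` _ = `](x - b)%R, (y - b)%R]%classic).
  rewrite !lebesgue_measure_itv/= !lte_fin ltrD2r; case: ifP => // _.
  by rewrite -!EFinD; congr EFin; ring.
by apply/seteqP; split => z /=; rewrite !in_itv/= ltrBlDr lerBrDr.
Qed.

Lemma lebesgue_measure_scale (c : {posnum R}) (A : set R) : measurable A ->
  pushforward mu (( *%R c%:num) : _ -> measurableTypeR R) A =
    (c%:num^-1)%:E * mu A.
Proof.
have c0 : (0 < c%:num)%R by [].
have mb : measurable_fun setT (( *%R c%:num)
    : measurableTypeR R -> measurableTypeR R).
  exact: measurable_funM.
move=> mA; suff -> : mu A = c%:num%:E * pushforward mu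
    (( *%R c%:num) : measurableTypeR R -> measurableTypeR R) A.
  by rewrite muleA -EFinM mulVf ?gt_eqF// mul1e.
apply: (lebesgue_measure_unique (mu := mscale (NngNum (ltW c0)) (pushforward mu
    (( *%R c%:num) : measurableTypeR R -> measurableTypeR R)))) => //= _ [[x y]] _ <-.
rewrite /mscale/= /pushforward (_ : _ @^-1` _ = `](x / c%:num)%R, (y / c%:num)%R]%classic).
  rewrite !lebesgue_measure_itv/= !lte_fin ltr_pM2r ?invr_gt0//.
  case: ifP => // _; last by rewrite mule0.
  by rewrite -!EFinD -EFinM; congr EFin; field.
by apply/seteqP; split => z /=; rewrite !in_itv/= ltr_pdivrMr// ler_pdivlMr// mulrC.
Qed.

Lemma ge0_integral_shift f (b : R) : measurable_fun setT f ->
  (forall x, 0 <= f x) -> \int[mu]_x f (x + b)%R = \int[mu]_x f x.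
Proof.
move=> mf f0.
have mb : measurable_fun setT ((fun x => x + b)%R : measurableTypeR R -> measurableTypeR R).
  exact: measurable_funD.
rewrite -[LHS](ge0_integral_pushforward mb mu (D := setT))//=.
by apply: eq_measure_integral => A mA _; exact: lebesgue_measure_shift.
Qed.

Lemma ge0_integral_opp f : measurable_fun setT f ->
  (forall x, 0 <= f x) -> \int[mu]_x f (- x)%R = \int[mu]_x f x.
Proof.
move=> mf f0.
have mb : measurable_fun setT (-%R : measurableTypeR R -> measurableTypeR R) by [].
rewrite -[LHS](ge0_integral_pushforward mb mu (D := setT))//=.
by apply: eq_measure_integral => A mA _; exact: lebesgue_measureN.
Qed.

Lemma ge0_integral_reflect f (t : R) : measurable_fun setT f ->
  (forall x, 0 <= f x) -> \int[mu]_x f (t - x)%R = \int[mu]_x f x.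
Proof.
move=> mf f0.
have mft : measurable_fun setT (fun x => f (t + x)%R).
  by apply: measurableT_comp => //; exact: measurable_funD.
rewrite (ge0_integral_opp (f := fun x => f (t + x)%R))//.
by under eq_integral do rewrite addrC; rewrite ge0_integral_shift.
Qed.

Lemma ge0_integral_scale f (c : R) : (0 < c)%R -> measurable_fun setT f ->
  (forall x, 0 <= f x) ->
  \int[mu]_x f (c * x)%R = (c^-1)%:E * \int[mu]_x f x.
Proof.
move=> c0 mf f0.
have mb : measurable_fun setT (( *%R (PosNum c0)%:num)
    : measurableTypeR R -> measurableTypeR R).
  exact: measurable_funM.
have V0 : (0 <= c^-1)%R by rewrite invr_ge0 ltW.
rewrite -[RHS](ge0_integral_mscale _ _ (NngNum V0))//.
rewrite -[LHS](ge0_integral_pushforward mb mu (D := setT))//=.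
apply: eq_measure_integral => A mA _.
exact: (lebesgue_measure_scale (PosNum c0)).
Qed.

End lebesgue_change_of_variables.

(** * Tonelli's theorem for curried functions *)

Section curried_tonelli.
Context d1 d2 (T1 : measurableType d1) (T2 : measurableType d2) (R : realType).
Variables (m1 : {sigma_finite_measure set T1 -> \bar R})
  (m2 : {sigma_finite_measure set T2 -> \bar R}).
Variable f : T1 -> T2 -> \bar R.
Hypothesis mf : measurable_fun setT (fun p : T1 * T2 => f p.1 p.2).
Hypothesis f0 : (forall x y, 0 <= f x y)%E.

Lemma ge0_measurable_integral1 : measurable_fun setT (fun x => \int[m2]_y f x y)%E.
Proof. exact: (measurable_fun_fubini_tonelli_F (m2 := m2) _ mf). Qed.

Lemma ge0_measurable_integral2 : measurable_fun setT (fun y => \int[m1]_x f x y)%E.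
Proof. exact: (measurable_fun_fubini_tonelli_G (m1 := m1) _ mf). Qed.

Lemma ge0_exchange_integral :
  (\int[m1]_x \int[m2]_y f x y = \int[m2]_y \int[m1]_x f x y)%E.
Proof. exact: (fubini_tonelli (m1 := m1) (m2 := m2) _ mf). Qed.

End curried_tonelli.

(** * Translation invariance of Lebesgue measure on R^d *)

Section tuple_translation.
Context {R : realType}.
Local Notation mu := (@lebesgue_measure R).

Definition tadd d (x y : d.-tuple R) : d.-tuple R :=
  [tuple tnth x i + tnth y i | i < d].

Lemma tnth_tadd d (x y : d.-tuple R) i : tnth (tadd x y) i = tnth x i + tnth y i.
Proof. by rewrite tnth_mktuple. Qed.

Lemma tnth_tsub d (x y : d.-tuple R) i : tnth (tsub x y) i = tnth x i - tnth y i.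
Proof. by rewrite tnth_mktuple. Qed.

Lemma taddK d (x y : d.-tuple R) : tsub (tadd x y) y = x.
Proof. by apply: eq_from_tnth => i; rewrite tnth_tsub tnth_tadd addrK. Qed.

Lemma measurable_fun_tuple d dT (T : measurableType dT) (f : T -> d.-tuple R) :
  (forall i, measurable_fun setT (fun x => tnth (f x) i)) -> measurable_fun setT f.
Proof. by move=> mf; apply/measurable_fun_tnthP => i; exact: mf. Qed.

Lemma measurable_tadd d dT (T : measurableType dT) (f g : T -> d.-tuple R) :
  measurable_fun setT f -> measurable_fun setT g ->
  measurable_fun setT (fun x => tadd (f x) (g x)).
Proof.
move=> mf mg; apply: measurable_fun_tuple => i.
under eq_fun do rewrite tnth_tadd.
by apply: measurable_funD; exact: (measurableT_comp (measurable_tnth i)).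
Qed.

Lemma measurable_tsub d dT (T : measurableType dT) (f g : T -> d.-tuple R) :
  measurable_fun setT f -> measurable_fun setT g ->
  measurable_fun setT (fun x => tsub (f x) (g x)).
Proof.
move=> mf mg; apply: measurable_fun_tuple => i.
under eq_fun do rewrite tnth_tsub.
by apply: measurable_funB; exact: (measurableT_comp (measurable_tnth i)).
Qed.

Lemma ge0_integral_lebesgue_cons d (m : {sigma_finite_measure set (d.-tuple R) -> \bar R})
    (f : d.+1.-tuple R -> \bar R) :
  measurable_fun setT f -> (forall x, 0 <= f x)%E ->
  (\int[lebesgue_cons m]_x f x = \int[mu]_a \int[m]_x f (tuple_cons (a, x)))%E.
Proof.
move=> mf f0.
transitivity (\int[mu \x m]_p (f \o @tuple_cons R d) p)%E.
  have mcons : measurable_fun setT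
      (@tuple_cons R d : (measurableTypeR R * d.-tuple R)%type -> _).
    exact: measurable_tuple_cons.
  by rewrite -[RHS](ge0_integral_pushforward mcons (mu \x m)%E (D := setT)).
have mfc : measurable_fun setT (f \o @tuple_cons R d).
  exact: (measurableT_comp mf (@measurable_tuple_cons R d)).
apply: (fubini_tonelli1 (m1 := mu) (m2 := m) (f \o @tuple_cons R d)); last by move=> ?; exact: f0.
exact: mfc.
Qed.

(** By induction on [d]: the first coordinate is split off and translated on the line, and the
    induction hypothesis translates the remaining ones. *)
Lemma ge0_integral_tuple_shift d (f : d.-tuple R -> \bar R) (z : d.-tuple R) :
  measurable_fun setT f -> (forall x, 0 <= f x)%E ->
  (\int[lebesgue_tuple R d]_x f (tadd x z) = \int[lebesgue_tuple R d]_x f x)%E.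
Proof.
elim: d f z => [|d IH] f z mf f0 /=.
  by apply: eq_integral => x _; congr f; apply: eq_from_tnth => -[].
have mfz : measurable_fun setT (fun x => f (tadd x z)).
  by apply: measurableT_comp => //; exact: measurable_tadd.
rewrite !ge0_integral_lebesgue_cons//.
have consE (a : R) (x : d.-tuple R) : tadd (tuple_cons (a, x)) z =
    tuple_cons (a + thead z, tadd x [tuple of behead z])%R.
  apply: eq_from_tnth => i; rewrite tnth_tadd.
  case: (unliftP ord0 i) => [j ->|->]; last by rewrite !tnth0.
  by rewrite !tnthS tnth_tadd tnth_behead; congr (_ + tnth z _); apply: val_inj;
     rewrite /= inordK// ltnS.
have mc : measurable_fun setT (fun p : R * d.-tuple R => f (tuple_cons (p.1, p.2))).
  apply: measurableT_comp => //.
  rewrite [X in measurable_fun _ X](_ : _ = @tuple_cons R d).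
    exact: measurable_tuple_cons.
  by apply/funext => -[].
rewrite -[RHS](@ge0_integral_shift R _ (thead z)); last 2 first.
- exact: (ge0_measurable_integral1 (lebesgue_tuple R d) mc).
- by move=> a; exact: integral_ge0.
apply: eq_integral => a _.
rewrite -[RHS](IH _ [tuple of behead z])//.
  by apply: eq_integral => x _; rewrite consE.
exact: (measurableT_comp mc (pair1_measurable (a + thead z)%R)).
Qed.

End tuple_translation.

(** * Survival probability *)

Section survival_theory.
Context {R : realType} (beta : R -> R).
Local Notation mu := (@lebesgue_measure R).
Hypothesis beta_ge0 : forall a, 0 <= a -> 0 <= beta a.
Hypothesis beta_cont : {within `[0, +oo[, continuous beta}.

Local Notation psi := (survival beta).
(** [beta] is continued to the left of 0 by the constant [beta 0], and [cumhaz] starts at -1. This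
    makes 0 an interior point, where the fundamental theorem of calculus still gives a two-sided
    derivative. *)
Let hazard (x : R) : R := beta (Num.max 0 x).
Let cumhaz (x : R) : R := \int[mu]_(s in `[-1, x]) hazard s.

Let hazard_ge0 (x : R) : 0 <= hazard x.
Proof. by apply: beta_ge0; rewrite le_max lexx. Qed.

Let hazardE (x : R) : 0 <= x -> hazard x = beta x.
Proof. by move=> x0; rewrite /hazard max_r. Qed.

Let continuous_hazard : continuous hazard.
Proof.
move=> x; move/subspace_continuousP : beta_cont => cb.
have m0 (y : R) : `[0, +oo[%classic (Num.max 0 y).
  have /= : 0 <= Num.max (0 : R) y by rewrite le_max lexx.
  by rewrite in_itv/= andbT.
have cbx := cb _ (m0 x).
apply: (cvg_comp _ _ _ cbx).
have cm : Num.max 0 y @[y --> x] --> Num.max 0 x.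
  by apply: (@continuous_max _ _ (fun=> 0) id); [exact: cvg_cst|exact: cvg_id].
move=> A; rewrite /within/= => /cm cA; apply: (@filterS _ (nbhs x) _ _ _ _ cA) => y /=.
by apply; exact: (m0 y).
Qed.

Let measurable_hazard : measurable_fun setT hazard.
Proof. exact: continuous_measurable_fun. Qed.

Let integrable_hazard a b : mu.-integrable `[a, b] (EFin \o hazard).
Proof.
apply: continuous_compact_integrable; first exact: segment_compact.
by apply: continuous_subspaceT => x; exact: continuous_hazard.
Qed.

Let cumhaz_derive (x : R) : -1 < x -> is_derive x 1 cumhaz (hazard x).
Proof.
move=> x1; have xx : x < x + 1 by rewrite ltrDl.
have [] := @continuous_FTC1 _ hazard (BLeft (-1)) _ _ xx _ _ (@continuous_hazard x).
- exact: integrable_hazard.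
- by [].
by move=> d1 d2; apply: DeriveDef; [exact: d1|rewrite -derive1E; exact: d2].
Qed.

Let cumhazB (x y : R) : -1 <= x -> x <= y ->
  \int[mu]_(s in `[x, y]) hazard s = cumhaz y - cumhaz x.
Proof.
move=> x1 xy; rewrite /cumhaz -Rintegral_itv_obnd_cbnd; last first.
  apply: integrableS (integrable_hazard x y) => //; exact: subset_itv_oc_cc.
by apply/esym; apply: (@Rintegral_itvB _ hazard (BLeft (-1)) (BRight y) x);
   rewrite ?bnd_simp.
Qed.

Let survivalE (x : R) : 0 <= x -> psi x = expR (cumhaz 0 - cumhaz x).
Proof.
move=> x0; rewrite /survival; congr expR; rewrite -opprB -cumhazB//.
congr (- _); apply: eq_Rintegral => y; rewrite inE/= in_itv/= => /andP[y0 _].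
by rewrite hazardE.
Qed.

Lemma survival_gt0 (x : R) : 0 < psi x.
Proof. exact: expR_gt0. Qed.

(** The domain of integration is empty for [x < 0]. The value 1 there is relied upon below:
    [psi (- s)] is the fraction present at time 0 when [s < 0], and 1 for a birth at a time
    [s >= 0]. *)
Lemma survival_le0 (x : R) : x <= 0 -> psi x = 1.
Proof.
rewrite le_eqVlt => /predU1P[->|x0]; first by rewrite survivalE// subrr expR0.
rewrite /survival set_itv_ge ?bnd_simp -?ltNge// Rintegral_set0.
by rewrite oppr0 expR0.
Qed.

Lemma survival0 : psi 0 = 1.
Proof. exact: survival_le0. Qed.

Let cumhaz_nd (x y : R) : -1 <= x -> x <= y -> cumhaz x <= cumhaz y.
Proof. by move=> x1 xy; rewrite -subr_ge0 -cumhazB//; exact: Rintegral_ge0. Qed.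

Lemma survival_nonincreasing (y x : R) : y <= x -> psi x <= psi y.
Proof.
move=> yx; have [x0|x0] := leP x 0.
  by rewrite !survival_le0// (le_trans yx).
have [y0|y0] := leP y 0.
  rewrite [psi y]survival_le0// survivalE ?(ltW x0)// -expR0 ler_expR subr_le0.
  by rewrite cumhaz_nd// ltW.
rewrite (survivalE (ltW x0)) (survivalE (ltW y0)) ler_expR lerD2l lerN2 cumhaz_nd//.
by rewrite (le_trans _ (ltW y0))// lerN10.
Qed.

Lemma survival_le1 (x : R) : psi x <= 1.
Proof.
rewrite -survival0; have [x0|x0] := leP x 0.
  by rewrite survival0 survival_le0.
by apply: survival_nonincreasing; exact: ltW.
Qed.

Lemma measurable_survival : measurable_fun setT psi.
Proof. apply: nonincreasing_measurable; [exact: measurableT|by move=> x y; exact: survival_nonincreasing]. Qed.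

(** A jump rate at most [M] leaves at least the fraction [exp (- M t)] in place during a time [t].
    This is what keeps an infinite moment infinite. *)
Lemma survivalD_ge (M a t : R) : (forall x, 0 <= x -> beta x <= M) ->
  0 <= a -> 0 <= t -> expR (- (M * t)) * psi a <= psi (a + t).
Proof.
move=> bM a0 t0; rewrite !survivalE ?addr_ge0// -expRD ler_expR.
suff : cumhaz (a + t) - cumhaz a <= M * t by lra.
have aat : a <= a + t by rewrite lerDl.
rewrite -cumhazB//; last by rewrite (le_trans _ a0)// lerN10.
have -> : M * t = \int[mu]_(s in `[a, a + t]) M.
  rewrite Rintegral_cst//= lebesgue_measure_itv/= lte_fin ltrDl.
  case: ltP => [_|t0'].
    by rewrite -EFinD /= addrAC subrr add0r.
  by rewrite (le_anti (introT andP (conj t0' t0)))/= !mulr0.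
apply: le_Rintegral => //.
- apply: continuous_compact_integrable; first exact: segment_compact.
  by apply: continuous_subspaceT => x; exact: cvg_cst.
- move=> x _; apply: bM.
  by rewrite le_max lexx.
Qed.

(** The extension by zero turns the integral over ages into a convolution on the whole line. *)
Definition renewal_kernel (x : R) : R := if 0 <= x then hazard x * psi x else 0.

Lemma renewal_kernel_ge0 (x : R) : 0 <= renewal_kernel x.
Proof.
by rewrite /renewal_kernel; case: ifP => // _; rewrite mulr_ge0// ltW ?survival_gt0.
Qed.

Lemma renewal_kernelE (x : R) : 0 <= x -> renewal_kernel x = beta x * psi x.
Proof. by move=> x0; rewrite /renewal_kernel x0 hazardE. Qed.

Lemma measurable_renewal_kernel : measurable_fun setT renewal_kernel.
Proof.
apply: measurable_fun_ifT => //; last first.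
  by apply: measurable_funM => //; exact: measurable_survival.
exact: measurable_fun_ler.
Qed.

Lemma integral_renewal_kernel (x y : R) : 0 <= x -> x <= y ->
  (\int[mu]_(a in `[x, y]) (renewal_kernel a)%:E = (psi x - psi y)%:E)%E.
Proof.
move=> x0; rewrite le_eqVlt => /predU1P[->|xy].
  by rewrite subrr set_itv1 integral_set1.
(* On nonnegative arguments [F] is [- psi]. Written with [cumhaz] it is differentiable on both sides
   of the end point, even for [x = 0]. *)
pose F z := - expR (cumhaz 0 - cumhaz z).
pose F' z := hazard z * expR (cumhaz 0 - cumhaz z).
have F_derive (z : R) : -1 < z -> is_derive z 1 F (F' z).
  move=> z1; have ? := cumhaz_derive z1.
  rewrite /F /F'; apply: is_derive_eq.
  by rewrite /GRing.scale/=; ring.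
have cF (z : R) : -1 < z -> {for z, continuous F}.
  move=> z1; apply: differentiable_continuous; apply/derivable1_diffP.
  exact: (@ex_derive _ _ _ _ _ _ _ (F_derive _ z1)).
have x1 : -1 < x by rewrite (lt_le_trans _ x0)// ltrN10.
transitivity (\int[mu]_(z in `[x, y]) (F' z)%:E)%E.
  apply: eq_integral => z; rewrite inE/= in_itv/= => /andP[xz _].
  by rewrite /renewal_kernel (le_trans x0 xz) survivalE// (le_trans x0).
rewrite (@continuous_FTC2 _ F' F)//.
- rewrite /F !survivalE ?(le_trans x0 (ltW xy))// -EFinB; congr EFin.
  by rewrite opprK addrC.
- apply: continuous_in_subspaceT => z; rewrite inE/= in_itv/= => /andP[xz _].
  have z1 : -1 < z by exact: lt_le_trans xz.
  have -> : F' = (fun z => hazard z * (- F z)) by apply/funext => u; rewrite /F opprK.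
  by apply: continuousM; [exact: continuous_hazard|apply: continuousN; exact: cF].
- split.
  + by move=> z; rewrite in_itv/= => /andP[xz _]; have [] := F_derive z (lt_trans x1 xz).
  + by apply: cvg_at_right_filter; exact: cF.
  + by apply: cvg_at_left_filter; apply: cF; exact: lt_trans xy.
- move=> z; rewrite in_itv/= => /andP[xz _].
  by rewrite derive1E; have [] := F_derive z (lt_trans x1 xz).
Qed.

(** The fraction of the births at time [s] whose next jump falls in [[0, T]]. *)
Lemma integral_renewal_kernel_shift (T s : R) : 0 <= T ->
  (\int[mu]_(t in `[0%R, T]) (renewal_kernel (t - s)%R)%:E =
   if (s <= T)%R then (psi (- s)%R - psi (T - s)%R)%:E else 0)%E.
Proof.
move=> T0; case: ifPn => [sT|]; last first.
  rewrite -ltNge => sT; apply: integral0_eq => t /=; rewrite in_itv/= => /andP[_ tT].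
  by rewrite /renewal_kernel subr_ge0 leNgt (le_lt_trans tT sT).
rewrite integral_mkcond.
rewrite -(@ge0_integral_shift R _ s); last 2 first.
- apply/(measurable_restrictT _ _).1 => //.
  apply/measurable_EFinP; apply: measurable_funTS.
  apply: measurableT_comp; first exact: measurable_renewal_kernel.
  exact: measurable_funB.
- by move=> x; rewrite patchE; case: ifP => // _; rewrite lee_fin renewal_kernel_ge0.
(* The ages at which the jump can occur form the interval from [max 0 (- s)] to [T - s]; the value
   of [psi] at its lower end is [psi (- s)] in both cases, as [psi] is 1 on negative numbers. *)
have -> : psi (- s) = psi (Num.max 0 (- s)).
  have [s0|/ltW s0] := leP 0 (- s); first by [].
  by rewrite survival0 (survival_le0 s0).
rewrite -integral_renewal_kernel ?le_max ?lexx//; last first.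
  by rewrite ge_max subr_ge0 sT lerDr.
rewrite [RHS]integral_mkcond; apply: eq_integral => x _.
rewrite !patchE addrK !mem_setE !in_itv/= ge_max.
rewrite /renewal_kernel; case: (leP 0 x) => x0; last by rewrite /= if_same.
by rewrite /= -[0 <= x + s]lerBlDr sub0r lerBrDr.
Qed.

End survival_theory.

(** * Moments of renewal densities *)

Section renewal_moments.
Context {R : realType} (d : nat) (w : probability (d.-tuple R) R).
Context (beta : R -> R).
Local Notation mu := (@lebesgue_measure R).
Local Notation leb := (lebesgue_tuple R d).
Local Notation psi := (survival beta).
Local Notation E := (d.-tuple R).
Hypothesis beta_ge0 : forall a, 0 <= a -> 0 <= beta a.
Hypothesis beta_cont : {within `[0, +oo[, continuous beta}.
Local Notation f := (renewal_kernel beta).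
Local Open Scope ereal_scope.

Definition spread (h : R * E -> R) (s : R) (x : E) : \bar R :=
  \int[w]_z (h (s, tsub x z))%:E.

Definition renewal (h : R * E -> R) (t : R) (x : E) : \bar R :=
  \int[mu]_a ((f a)%:E * spread h (t - a)%R x).

(* The adjoint of convolution by [w]: testing [w * g] against [phi] amounts to
   testing [g] against [smear phi]. *)
Definition smear (phi : E -> \bar R) (y : E) : \bar R := \int[w]_z phi (tadd y z).

Definition pairing (h : R * E -> R) (phi : E -> \bar R) (s : R) : \bar R :=
  \int[leb]_x (phi x * (h (s, x))%:E).

Definition moment h (m : R -> R) phi : \bar R :=
  \int[mu]_s ((m s)%:E * pairing h phi s).

Lemma measurable_smear phi : measurable_fun setT phi -> (forall x, 0 <= phi x) ->
  measurable_fun setT (smear phi).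
Proof.
move=> mphi phi0.
apply: (ge0_measurable_integral1 _ (f := fun y z => phi (tadd y z))) => //.
apply: (measurableT_comp mphi); apply: measurable_tadd.
  exact: measurable_fst.
exact: measurable_snd.
Qed.

Lemma smear_ge0 phi y : (forall x, 0 <= phi x) -> 0 <= smear phi y.
Proof. by move=> phi0; exact: integral_ge0. Qed.

Section pairing.
Variable h : R * E -> R.
Hypotheses (mh : measurable_fun setT h) (h0 : forall p, (0 <= h p)%R).
Variable phi : E -> \bar R.
Hypotheses (mphi : measurable_fun setT phi) (phi0 : forall x, 0 <= phi x).

Lemma pairing_ge0 s : 0 <= pairing h phi s.
Proof. by apply: integral_ge0 => x _; rewrite mule_ge0 ?lee_fin. Qed.

Lemma measurable_pairing : measurable_fun setT (pairing h phi).
Proof.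
apply: (ge0_measurable_integral1 _ (f := fun s x => phi x * (h (s, x))%:E)).
  apply: emeasurable_funM; first exact: measurableT_comp.
  apply/measurable_EFinP; apply: (measurableT_comp mh).
  by apply: measurable_fun_pair.
by move=> *; rewrite mule_ge0 ?lee_fin.
Qed.


End pairing.

Section fixed_density.
Variable h : R * E -> R.
Hypotheses (mh : measurable_fun setT h) (h0 : forall p, (0 <= h p)%R).
Variable phi : E -> \bar R.
Hypotheses (mphi : measurable_fun setT phi) (phi0 : forall x, 0 <= phi x).

Let mhs s : measurable_fun setT (fun x => (h (s, x))%:E).
Proof. by apply/measurable_EFinP; apply: (measurableT_comp mh). Qed.

Lemma spread_ge0 s x : 0 <= spread h s x.
Proof. by apply: integral_ge0 => z _; rewrite lee_fin. Qed.

Lemma measurable_spread : measurable_fun setT (fun p : R * E => spread h p.1 p.2).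
Proof.
apply: (ge0_measurable_integral1 _ (f := fun (p : R * E) z => (h (p.1, tsub p.2 z))%:E));
  last by move=> *; rewrite lee_fin.
apply/measurable_EFinP; apply: (measurableT_comp mh).
apply: measurable_fun_pair; first exact: measurableT_comp.
by apply: measurable_tsub; [exact: measurableT_comp|].
Qed.

Let mf : measurable_fun setT (fun a => (f a)%:E).
Proof. by apply/measurable_EFinP; exact: measurable_renewal_kernel. Qed.

Let f0 a : 0 <= (f a)%:E.
Proof. by rewrite lee_fin renewal_kernel_ge0. Qed.

Lemma renewal_ge0 t x : 0 <= renewal h t x.
Proof. by apply: integral_ge0 => a _; rewrite mule_ge0 ?spread_ge0. Qed.

Let m_renewal_integrand : measurable_fun setT (fun p : (R * E) * R =>
  (f p.2)%:E * spread h (p.1.1 - p.2)%R p.1.2).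
Proof.
apply: emeasurable_funM; first exact: (measurableT_comp mf measurable_snd).
apply: (measurableT_comp measurable_spread (g := fun p : (R * E) * R =>
  ((p.1.1 - p.2)%R, p.1.2))).
apply: measurable_fun_pair; last exact: measurableT_comp.
by apply: measurable_funB => //; exact: measurableT_comp.
Qed.

Lemma measurable_renewal : measurable_fun setT (fun p : R * E => renewal h p.1 p.2).
Proof.
apply: (ge0_measurable_integral1 mu (f := fun (p : R * E) a =>
   (f a)%:E * spread h (p.1 - a)%R p.2)) => //.
by move=> *; rewrite mule_ge0 ?spread_ge0.
Qed.

(** Tonelli's theorem, and then, for each fixed jump [z], the translation by [z] moves the shift
    from [h] to [phi]. *)
Lemma integral_spread s :
  \int[leb]_x (phi x * spread h s x) = pairing h (smear phi) s.
Proof.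
have mhxz : measurable_fun setT (fun p : E * E => (h (s, tsub p.1 p.2))%:E).
  apply/measurable_EFinP; apply: (measurableT_comp mh).
  by apply: measurable_fun_pair => //; exact: measurable_tsub.
transitivity (\int[leb]_x \int[w]_z (phi x * (h (s, tsub x z))%:E)).
  apply: eq_integral => x _; rewrite ge0_integralZl//.
  - apply/measurable_EFinP; apply: (measurableT_comp mh).
    by apply: measurable_fun_pair => //; exact: measurable_tsub.
  - by move=> *; rewrite lee_fin.
rewrite (@ge0_exchange_integral _ _ _ _ _ leb w (fun x z => phi x * (h (s, tsub x z))%:E));
  last 2 first.
- by apply: emeasurable_funM => //; exact: measurableT_comp.
- by move=> *; rewrite mule_ge0 ?lee_fin.
transitivity (\int[w]_z \int[leb]_x (phi (tadd x z) * (h (s, x))%:E)).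
  apply: eq_integral => z _.
  rewrite -[LHS](@ge0_integral_tuple_shift _ _ _ z).
  - by apply: eq_integral => x _; rewrite /= taddK.
  - apply: emeasurable_funM => //.
    apply/measurable_EFinP; apply: (measurableT_comp mh).
    by apply: measurable_fun_pair => //; exact: measurable_tsub.
  - by move=> *; rewrite mule_ge0 ?lee_fin.
have mphixz : measurable_fun setT (fun p : E * E => phi (tadd p.1 p.2)).
  by apply: (measurableT_comp mphi); exact: measurable_tadd.
rewrite -(@ge0_exchange_integral _ _ _ _ _ leb w (fun x z => phi (tadd x z) * (h (s, x))%:E)).
- apply: eq_integral => x _; rewrite ge0_integralZr//; last by rewrite lee_fin.
  by apply: (measurableT_comp mphi); exact: measurable_tadd.
- apply: emeasurable_funM => //.
  exact: (measurableT_comp (mhs s) measurable_fst).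
- by move=> *; rewrite mule_ge0 ?lee_fin.
Qed.

(** Besides Tonelli's theorem, the reflection [a = t - s] replaces the age by the time of the last
    jump. *)
Lemma integral_renewal t :
  \int[leb]_x (phi x * renewal h t x) =
  \int[mu]_s ((f (t - s)%R)%:E * pairing h (smear phi) s).
Proof.
have ms a : measurable_fun setT (spread h a).
  exact: (measurableT_comp measurable_spread (pair1_measurable a)).
transitivity (\int[leb]_x \int[mu]_a (phi x * ((f a)%:E * spread h (t - a)%R x))).
  apply: eq_integral => x _; rewrite ge0_integralZl//.
  - exact: (measurableT_comp m_renewal_integrand (pair1_measurable (t, x))).
  - by move=> *; rewrite mule_ge0 ?spread_ge0.
rewrite (@ge0_exchange_integral _ _ _ _ _ leb mu
  (fun x a => phi x * ((f a)%:E * spread h (t - a)%R x))); last 2 first.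
- apply: emeasurable_funM; first exact: measurableT_comp.
  apply: (measurableT_comp m_renewal_integrand (g := fun p : E * R =>
    ((t, p.1), p.2))).
  by apply: measurable_fun_pair => //; exact: measurable_fun_pair.
- by move=> *; rewrite !mule_ge0 ?spread_ge0.
transitivity (\int[mu]_a ((f a)%:E * pairing h (smear phi) (t - a)%R)).
  apply: eq_integral => a _; rewrite -integral_spread -ge0_integralZl//.
  - by apply: eq_integral => x _; rewrite muleCA.
  - exact: emeasurable_funM.
  - by move=> *; rewrite mule_ge0 ?spread_ge0.
have mp : measurable_fun setT (pairing h (smear phi)).
  by apply: measurable_pairing => // [|x]; [exact: measurable_smear|exact: smear_ge0].
have p0 s : 0 <= pairing h (smear phi) s.
  by apply: pairing_ge0 => // x; exact: smear_ge0.
have mft : measurable_fun setT (fun s : R => (f (t - s)%R)%:E).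
  have mg : measurable_fun setT (fun s : R => t - s)%R by exact: measurable_funB.
  exact: (measurableT_comp mf mg).
rewrite -[RHS](@ge0_integral_reflect R (fun s =>
  (f (t - s)%R)%:E * pairing h (smear phi) s) t).
- by apply: eq_integral => a _; rewrite subKr.
- exact: emeasurable_funM.
- by move=> *; rewrite mule_ge0.
Qed.

Lemma moment_renewal (T : R) : (0 <= T)%R ->
  \int[mu]_(t in `[0%R, T[) \int[leb]_x (phi x * renewal h t x) =
  moment h (fun s => if (s < T)%R then psi (- s)%R - psi (T - s)%R else 0)%R (smear phi).
Proof.
move=> T0.
have mp : measurable_fun setT (pairing h (smear phi)).
  by apply: measurable_pairing => // [|x]; [exact: measurable_smear|exact: smear_ge0].
have p0 s : 0 <= pairing h (smear phi) s.
  by apply: pairing_ge0 => // x; exact: smear_ge0.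
have mfts : measurable_fun setT (fun p : R * R => (f (p.1 - p.2)%R)%:E).
  have mg : measurable_fun setT (fun p : R * R => p.1 - p.2)%R by exact: measurable_funB.
  exact: (measurableT_comp mf mg).
pose ind t := (\1_(`[0%R, T[%classic : set R) t)%:E : \bar R.
have mind : measurable_fun setT ind.
  by apply/measurable_EFinP; exact: measurable_indic.
have ind0 t : 0 <= ind t by rewrite lee_fin.
transitivity (\int[mu]_t \int[mu]_s (ind t * ((f (t - s)%R)%:E * pairing h (smear phi) s))).
  rewrite integral_mkcond; apply: eq_integral => t _.
  rewrite ge0_integralZl//; last 2 first.
  - have mft := measurableT_comp mfts (pair1_measurable t).
    exact: (emeasurable_funM mft mp).
  - by move=> *; rewrite mule_ge0.
  rewrite -integral_renewal patchE /ind indicE.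
  by case: ifPn; rewrite ?mul1e ?mul0e.
rewrite (@ge0_exchange_integral _ _ _ _ _ mu mu (fun t s =>
  ind t * ((f (t - s)%R)%:E * pairing h (smear phi) s))); last 2 first.
- apply: emeasurable_funM; first exact: measurableT_comp.
  by apply: emeasurable_funM => //; exact: measurableT_comp.
- by move=> *; rewrite !mule_ge0.
apply: eq_integral => s _.
have mfs : measurable_fun setT (fun t : R => (f (t - s)%R)%:E).
  exact: (measurableT_comp mfts (pair2_measurable s)).
transitivity (\int[mu]_t (pairing h (smear phi) s * (ind t * (f (t - s)%R)%:E))).
  by apply: eq_integral => t _; rewrite muleA muleC.
rewrite ge0_integralZl//; last 2 first.
- exact: emeasurable_funM.
- by move=> *; rewrite mule_ge0.
rewrite muleC; congr (_ * _).
transitivity (\int[mu]_(t in `[0%R, T[) (f (t - s)%R)%:E).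
  rewrite [RHS]integral_mkcond; apply: eq_integral => t _.
  by rewrite patchE /ind indicE; case: ifPn; rewrite ?mul1e ?mul0e.
rewrite integral_itv_bndo_bndc; last exact: measurable_funTS.
rewrite integral_renewal_kernel_shift//.
(* The closed interval allows [s = T], where the value is [1 - 1 = 0], in agreement with the strict
   inequality in the statement. *)
have [sT|sT|->] := ltgtP s T => //.
have -> : psi (- T)%R = 1%R.
  by apply: survival_le0; [exact: beta_cont|rewrite oppr_le0].
have -> : psi (T - T)%R = 1%R by apply: survival_le0; [exact: beta_cont|rewrite subrr].
by rewrite subrr.
Qed.

End fixed_density.

Section moment_algebra.
Variable h : R * E -> R.
Hypotheses (mh : measurable_fun setT h) (h0 : forall p, (0 <= h p)%R).
Implicit Types (m : R -> R) (phi : E -> \bar R).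

Lemma moment_ge0 m phi : (forall s, 0 <= m s)%R -> (forall x, 0 <= phi x) ->
  0 <= moment h m phi.
Proof.
by move=> m0 phi0; apply: integral_ge0 => s _; rewrite mule_ge0 ?lee_fin ?pairing_ge0.
Qed.

Lemma pairingD phi1 phi2 s : measurable_fun setT phi1 -> (forall x, 0 <= phi1 x) ->
  measurable_fun setT phi2 -> (forall x, 0 <= phi2 x) ->
  pairing h (fun x => phi1 x + phi2 x) s = pairing h phi1 s + pairing h phi2 s.
Proof.
move=> m1 p1 m2 p2.
have mhs : measurable_fun setT (fun x => (h (s, x))%:E).
  by apply/measurable_EFinP; apply: (measurableT_comp mh).
rewrite /pairing -ge0_integralD//.
- by apply: eq_integral => x _; rewrite ge0_muleDl.
- by move=> x _; rewrite mule_ge0 ?lee_fin.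
- exact: emeasurable_funM.
- by move=> x _; rewrite mule_ge0 ?lee_fin.
- exact: emeasurable_funM.
Qed.

Lemma le_pairing phi1 phi2 s : measurable_fun setT phi1 -> (forall x, 0 <= phi1 x) ->
  measurable_fun setT phi2 -> (forall x, phi1 x <= phi2 x) ->
  pairing h phi1 s <= pairing h phi2 s.
Proof.
move=> m1 p1 m2 p12.
have mhs : measurable_fun setT (fun x => (h (s, x))%:E).
  by apply/measurable_EFinP; apply: (measurableT_comp mh).
apply: ge0_le_integral => //.
- by move=> x _; rewrite mule_ge0 ?lee_fin.
- exact: emeasurable_funM.
- exact: emeasurable_funM.
- by move=> x _; rewrite lee_pmul ?lee_fin.
Qed.

Let m_integrand m phi : measurable_fun setT m ->
  measurable_fun setT phi -> (forall x, 0 <= phi x) ->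
  measurable_fun setT (fun s => (m s)%:E * pairing h phi s).
Proof.
move=> mm mphi phi0; apply: emeasurable_funM; first exact/measurable_EFinP.
exact: measurable_pairing.
Qed.

Lemma le_moment m1 m2 phi1 phi2 :
  measurable_fun setT m1 -> (forall s, 0 <= m1 s)%R -> measurable_fun setT m2 ->
  measurable_fun setT phi1 -> (forall x, 0 <= phi1 x) -> measurable_fun setT phi2 ->
  (forall s, m1 s <= m2 s)%R -> (forall x, phi1 x <= phi2 x) ->
  moment h m1 phi1 <= moment h m2 phi2.
Proof.
move=> mm1 m10 mm2 mp1 p10 mp2 m12 p12.
have p20 x : 0 <= phi2 x by rewrite (le_trans (p10 x)).
apply: ge0_le_integral => //.
- by move=> s _; rewrite mule_ge0 ?lee_fin ?pairing_ge0.
- exact: m_integrand.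
- exact: m_integrand.
- by move=> s _; rewrite lee_pmul ?lee_fin ?pairing_ge0// le_pairing.
Qed.

Lemma momentDr m phi1 phi2 : measurable_fun setT m -> (forall s, 0 <= m s)%R ->
  measurable_fun setT phi1 -> (forall x, 0 <= phi1 x) ->
  measurable_fun setT phi2 -> (forall x, 0 <= phi2 x) ->
  moment h m (fun x => phi1 x + phi2 x) = moment h m phi1 + moment h m phi2.
Proof.
move=> mm m0 mp1 p1 mp2 p2; rewrite /moment -ge0_integralD//.
- apply: eq_integral => s _.
  by rewrite pairingD// ge0_muleDr ?pairing_ge0.
- by move=> s _; rewrite mule_ge0 ?lee_fin ?pairing_ge0.
- exact: m_integrand.
- by move=> s _; rewrite mule_ge0 ?lee_fin ?pairing_ge0.
- exact: m_integrand.
Qed.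

Lemma momentDl m1 m2 phi : measurable_fun setT m1 -> (forall s, 0 <= m1 s)%R ->
  measurable_fun setT m2 -> (forall s, 0 <= m2 s)%R ->
  measurable_fun setT phi -> (forall x, 0 <= phi x) ->
  moment h (fun s => m1 s + m2 s)%R phi = moment h m1 phi + moment h m2 phi.
Proof.
move=> mm1 m10 mm2 m20 mp p0; rewrite /moment -ge0_integralD//.
- by apply: eq_integral => s _; rewrite EFinD ge0_muleDl ?lee_fin.
- by move=> s _; rewrite mule_ge0 ?lee_fin ?pairing_ge0.
- exact: m_integrand.
- by move=> s _; rewrite mule_ge0 ?lee_fin ?pairing_ge0.
- exact: m_integrand.
Qed.

Lemma momentZr m phi k : measurable_fun setT m -> (forall s, 0 <= m s)%R ->
  measurable_fun setT phi -> (forall x, 0 <= phi x) -> (0 <= k)%R ->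
  moment h m (fun x => k%:E * phi x) = k%:E * moment h m phi.
Proof.
move=> mm m0 mp p0 k0; rewrite /moment -ge0_integralZl//.
- apply: eq_integral => s _.
  have mhs : measurable_fun setT (fun x => (h (s, x))%:E).
    by apply/measurable_EFinP; apply: (measurableT_comp mh).
  have -> : pairing h (fun x => k%:E * phi x) s = k%:E * pairing h phi s.
    rewrite /pairing -[RHS]ge0_integralZl//.
    + by apply: eq_integral => x _; rewrite muleA.
    + exact: emeasurable_funM.
    + by move=> x _; rewrite mule_ge0 ?lee_fin.
  by rewrite muleCA.
- exact: m_integrand.
- by move=> s _; rewrite mule_ge0 ?lee_fin ?pairing_ge0.
Qed.

Lemma momentZl m phi k : measurable_fun setT m -> (forall s, 0 <= m s)%R ->
  measurable_fun setT phi -> (forall x, 0 <= phi x) -> (0 <= k)%R ->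
  moment h (fun s => k * m s)%R phi = k%:E * moment h m phi.
Proof.
move=> mm m0 mp p0 k0; rewrite /moment -ge0_integralZl//.
- by apply: eq_integral => s _; rewrite EFinM muleA.
- exact: m_integrand.
- by move=> s _; rewrite mule_ge0 ?lee_fin ?pairing_ge0.
Qed.

End moment_algebra.
End renewal_moments.

(** * Balance of moments *)

Lemma eaddI (R : realType) (x y z : \bar R) : x \is a fin_num ->
  (x + y = x + z)%E -> y = z.
Proof. by move: x y z => [x| |] [y| |] [z| |]//= _ [/addrI->]. Qed.

(** [I] and [SI] stand for the moments of [phi] and of its average over the window, [MT], [ST] and
    [M0], [S0] for those of the living particles at times [T] and 0, [W] for the mass of the births
    and [A] for the conserved mass. Only [MT] may be infinite a priori, and the balance excludes it,
    its right-hand side being finite. *)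
Lemma balance_shift (R : realType) (k : R) (I SI W MT ST M0 S0 A : \bar R) :
  (I + ST = SI + S0 -> ST = MT + k%:E * A -> SI = I + k%:E * W ->
   S0 = M0 + k%:E * A ->
   0 <= I < +oo -> 0 <= W < +oo -> 0 <= MT -> 0 <= M0 < +oo -> 0 <= A < +oo ->
   MT = M0 + k%:E * W)%E.
Proof.
move=> e eT eI e0; move: e; rewrite {}eT {}eI {}e0.
move: I W MT M0 A => [I| |] [W| |] [MT| |] [M0| |] [A| |] //=;
  rewrite ?andbF//.
by move=> [] H _ _ _ _ _; rewrite -EFinM -EFinD; congr EFin; lra.
Qed.

(** The letters [I], [M], [N] stand for moments of a weight over the window, at time [T] and at time
    0, and [SI], [S], [U] for those of its average; the digits distinguish two weights. Once all is
    finite this is linear algebra. *)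
Lemma balance_diff (R : realType)
    (I1 SI1 M1 S1 N1 U1 I2 SI2 M2 S2 N2 U2 : \bar R) :
  (I1 + S1 = SI1 + U1 -> I2 + S2 = SI2 + U2 ->
   SI1 + I2 = SI2 + I1 -> S1 + M2 = S2 + M1 -> U1 + N2 = U2 + N1 ->
   I1 \is a fin_num -> SI1 \is a fin_num -> M1 \is a fin_num ->
   S1 \is a fin_num -> N1 \is a fin_num -> U1 \is a fin_num ->
   I2 \is a fin_num -> SI2 \is a fin_num -> M2 \is a fin_num ->
   S2 \is a fin_num -> N2 \is a fin_num -> U2 \is a fin_num ->
   M1 - M2 = N1 - N2)%E.
Proof.
move=> e1 e2 e3 e4 e5.
move=> /fineK f1 /fineK f2 /fineK f3 /fineK f4 /fineK f5 /fineK f6.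
move=> /fineK g1 /fineK g2 /fineK g3 /fineK g4 /fineK g5 /fineK g6.
move: e1 e2 e3 e4 e5; rewrite -f1 -f2 -f3 -f4 -f5 -f6 -g1 -g2 -g3 -g4 -g5 -g6.
move=> [] e1 [] e2 [] e3 [] e4 [] e5.
by rewrite -!EFinB; congr EFin; lra.
Qed.

Section slices.
Context {R : realType} d' (T : measurableType d')
  (m : {sigma_finite_measure set T -> \bar R}).
Local Notation mu := (@lebesgue_measure R).

Lemma ge0_integral_slice (A : set R) (F : R * T -> \bar R) : measurable A ->
  measurable_fun setT F -> (forall p, 0 <= F p)%E ->
  (\int[mu]_(t in A) \int[m]_x F (t, x) =
   \int[mu \x m]_(p in A `*` setT) F p)%E.
Proof.
move=> mA mF F0.
have mAT : measurable (A `*` [set: T]) by exact: measurableX.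
rewrite [LHS]integral_mkcond [RHS]integral_mkcond.
rewrite [RHS](fubini_tonelli1 (m1 := mu) (m2 := m)).
- apply: eq_integral => t _; rewrite patchE; case: ifPn => tA.
    apply: eq_integral => x _; rewrite patchE ifT//.
    by rewrite inE; split => //; rewrite inE in tA.
  rewrite [RHS]integral0_eq// => x _; rewrite patchE ifF//.
  by apply/negbTE; apply: contra tA; rewrite !inE => -[].
- by apply/(measurable_restrictT _ mAT); exact: measurable_funTS.
- by move=> p; rewrite patchE; case: ifP.
Qed.

End slices.

Lemma ge0_lty_fin_num (R : realDomainType) (x : \bar R) :
  (0 <= x -> x < +oo -> x \is a fin_num)%E.
Proof. by move=> x0 xoo; rewrite ge0_fin_numE. Qed.

Section balance.
Local Opaque survival renewal_kernel.
Context {R : realType} (d : nat) (w : probability (d.-tuple R) R).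
Context (beta : R -> R).
Local Notation mu := (@lebesgue_measure R).
Local Notation leb := (lebesgue_tuple R d).
Local Notation psi := (survival beta).
Local Notation E := (d.-tuple R).
Hypothesis beta_ge0 : forall a, 0 <= a -> 0 <= beta a.
Hypothesis beta_cont : {within `[0, +oo[, continuous beta}.
Local Notation f := (renewal_kernel beta).
Local Open Scope ereal_scope.

(** Selects the births in [[0, T[]: its moment against 1 is [N(T)]. *)
Definition window (T : R) : R -> R := \1_(`[0%R, T[%classic : set R).

(* The weight at time [t] of a particle whose last jump took place at time [s];
   [s < 0] encodes an initial age [- s]. *)
Definition alive (t s : R) : R := if (s < t)%R then psi (t - s)%R else 0%R.

(** The fraction of the births at time [s] whose next jump falls in [[0, T[]. *)
Definition elapsed (T s : R) : R :=
  if (s < T)%R then (psi (- s) - psi (T - s))%R else 0%R.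

Lemma windowE T s : window T s = ((0 <= s < T)%R)%:R.
Proof. by rewrite /window indicE mem_setE in_itv. Qed.

Lemma window_ge0 T s : (0 <= window T s)%R.
Proof. by rewrite windowE. Qed.

Lemma measurable_window T : measurable_fun setT (window T).
Proof. exact: measurable_indic. Qed.

Lemma alive_ge0 t s : (0 <= alive t s)%R.
Proof. by rewrite /alive; case: ifP => // _; exact/ltW/survival_gt0. Qed.

Lemma measurable_alive t : measurable_fun setT (alive t).
Proof.
apply: measurable_fun_ifT; last exact: measurable_cst.
  exact: measurable_fun_ltr.
have mg : measurable_fun setT (fun s : R => t - s)%R by exact: measurable_funB.
exact: (measurableT_comp (measurable_survival beta_ge0 beta_cont) mg).
Qed.

Lemma elapsed_ge0 T s : (0 <= T)%R -> (0 <= elapsed T s)%R.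
Proof.
move=> T0; rewrite /elapsed; case: ifP => // _; rewrite subr_ge0.
by apply: survival_nonincreasing => //; rewrite -[leLHS]add0r lerD2r.
Qed.

Lemma measurable_elapsed T : measurable_fun setT (elapsed T).
Proof.
apply: measurable_fun_ifT; last exact: measurable_cst.
  exact: measurable_fun_ltr.
have mp := measurable_survival beta_ge0 beta_cont.
have mg : measurable_fun setT (fun s : R => T - s)%R by exact: measurable_funB.
have mn : measurable_fun setT (fun s : R => - s)%R by exact: oppr_measurable.
exact: (measurable_funB (measurableT_comp mp mn) (measurableT_comp mp mg)).
Qed.

(** The balance at the level of a single birth time: what is present at time 0 or enters during [[0,
    T[] either jumps again before [T] or is still in place at [T]. *)
Lemma elapsed_alive T s : (0 <= T)%R ->
  (elapsed T s + alive T s = window T s + alive 0 s)%R.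
Proof.
move=> T0; rewrite /elapsed /alive windowE sub0r.
have [s0|s0] := ltP s 0%R.
  by rewrite (lt_le_trans s0 T0) subrK add0r.
have -> : psi (- s)%R = 1%R by apply: survival_le0; rewrite ?oppr_le0.
by case: ifP => _; rewrite ?subrK !addr0.
Qed.

(** A birth in the window has a time at most [T] to jump again, so at least the fraction [psi T]
    does not. The factor [1 - psi T < 1] drives the finiteness of moments and the positivity of
    solutions. *)
Lemma elapsed_le_window T s : (0 <= T)%R -> (0 <= s)%R ->
  (elapsed T s <= (1 - psi T) * window T s)%R.
Proof.
move=> T0 s0; rewrite /elapsed windowE s0/=; case: ifP => _; last by rewrite mulr0.
rewrite mulr1; have -> : psi (- s)%R = 1%R by apply: survival_le0; rewrite ?oppr_le0.
by rewrite lerD2l lerN2; apply: survival_nonincreasing => //; rewrite gerBl.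
Qed.

Lemma elapsed_le T s : (0 <= T)%R ->
  (elapsed T s <= (1 - psi T) * window T s + alive 0 s)%R.
Proof.
move=> T0; have [s0|s0] := ltP s 0%R; last first.
  by rewrite (le_trans (elapsed_le_window T0 s0))// lerDl alive_ge0.
rewrite windowE (leNgt 0%R s) s0 mulr0 add0r /elapsed /alive s0 sub0r.
by rewrite (lt_le_trans s0)// gerBl ltW// survival_gt0.
Qed.

Section renewal_solution.
Variable h : R * E -> R.
Hypotheses (mh : measurable_fun setT h) (h0 : forall p, (0 <= h p)%R).
Hypothesis hE : {ae (mu \x leb), forall p, (0 <= p.1)%R ->
  (h p)%:E = renewal w beta h p.1 p.2}.

Lemma moment_window_slice T (phi : E -> \bar R) : measurable_fun setT phi ->
  (forall x, 0 <= phi x) ->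
  moment h (window T) phi =
  \int[mu]_(t in `[0%R, T[) \int[leb]_x (phi x * (h (t, x))%:E).
Proof.
move=> mphi phi0; rewrite /moment [RHS]integral_mkcond.
apply: eq_integral => s _; rewrite patchE /window indicE.
by case: ifPn => _; rewrite ?mul1e ?mul0e.
Qed.

(** The renewal equation is known almost everywhere for the product measure only, so it has to be
    used under a product integral. *)
Lemma moment_window_prod T (phi : E -> \bar R) : measurable_fun setT phi ->
  (forall x, 0 <= phi x) ->
  moment h (window T) phi =
  \int[mu \x leb]_(p in `[0%R, T[ `*` setT) (phi p.2 * (h p)%:E).
Proof.
move=> mphi phi0; rewrite (moment_window_slice T mphi phi0).
have mphi2 : measurable_fun setT (fun p : R * E => phi p.2).
  exact: (measurableT_comp mphi measurable_snd).
have mA : measurable (`[0%R, T[%classic : set R) by [].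
apply: (@ge0_integral_slice _ _ _ leb _ (fun p => phi p.2 * (h p)%:E) mA).
- by apply: emeasurable_funM => //; exact/measurable_EFinP.
- by move=> p; rewrite mule_ge0 ?lee_fin.
Qed.

Lemma moment_window_renewal T (phi : E -> \bar R) : (0 <= T)%R ->
  measurable_fun setT phi -> (forall x, 0 <= phi x) ->
  moment h (window T) phi = moment h (elapsed T) (smear w phi).
Proof.
move=> T0 mphi phi0; rewrite (moment_window_prod T mphi phi0).
rewrite -(moment_renewal w beta_ge0 beta_cont mh h0 mphi phi0 T0).
have mphi2 : measurable_fun setT (fun p : R * E => phi p.2).
  exact: (measurableT_comp mphi measurable_snd).
have mA : measurable (`[0%R, T[%classic : set R) by [].
rewrite (@ge0_integral_slice _ _ _ leb _ (fun p => phi p.2 * renewal w beta h p.1 p.2))//; last 2 first.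
- by apply: emeasurable_funM => //; exact: measurable_renewal.
- by move=> p; rewrite mule_ge0 ?renewal_ge0.
apply: ge0_ae_eq_integral.
- exact: measurableX.
- by apply: measurable_funTS; apply: emeasurable_funM => //; exact/measurable_EFinP.
- by apply: measurable_funTS; apply: emeasurable_funM => //; exact: measurable_renewal.
- by move=> p _; rewrite mule_ge0 ?lee_fin.
- by move=> p _; rewrite mule_ge0 ?renewal_ge0.
apply: (@filterS _ _ (ae_filter_ringOfSetsType _) _ _ _ hE) => p hp [/=]; rewrite in_itv/= => /andP[p0 _] _.
by rewrite hp.
Qed.

(** An equality of sums rather than of differences, since every term may still be infinite. *)
Lemma moment_balance T (phi : E -> \bar R) : (0 <= T)%R ->
  measurable_fun setT phi -> (forall x, 0 <= phi x) ->
  moment h (window T) phi + moment h (alive T) (smear w phi) =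
  moment h (window T) (smear w phi) + moment h (alive 0) (smear w phi).
Proof.
move=> T0 mphi phi0; rewrite (moment_window_renewal T0 mphi phi0).
have ms := measurable_smear w mphi phi0.
have s0 x := smear_ge0 w x phi0.
transitivity (moment h (fun s => window T s + alive 0 s)%R (smear w phi)).
  rewrite -momentDl; [| exact: mh| exact: h0|exact: measurable_elapsed
    |by move=> s; exact: elapsed_ge0| exact: measurable_alive
    |exact: alive_ge0|exact: ms|exact: s0].
  by apply: eq_integral => s _; rewrite (elapsed_alive _ T0).
by apply: momentDl; [exact: mh| exact: h0|exact: measurable_window
    |exact: window_ge0| exact: measurable_alive
    |exact: alive_ge0|exact: ms|exact: s0].
Qed.


(** With a bounded jump rate a fixed fraction of the initial population stays in place until time
    [T] and retains an infinite moment. *)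
Lemma moment_alive_oo (phi : E -> \bar R) (M T : R) : measurable_fun setT phi ->
  (forall x, 0 <= phi x) -> (0 <= T)%R -> (forall x, 0 <= x -> beta x <= M)%R ->
  moment h (alive 0) phi = +oo -> moment h (alive T) phi = +oo.
Proof.
move=> mphi phi0 T0 bM phioo; apply/eqP; rewrite eq_le leey/=.
have e0 : (0 <= expR (- (M * T)))%R by exact: expR_ge0.
have -> : +oo = moment h (fun s => expR (- (M * T)) * alive 0 s)%R phi.
  rewrite (momentZl mh h0 (measurable_alive 0) (alive_ge0 0) mphi phi0 e0) phioo.
  by rewrite gt0_muley// lte_fin expR_gt0.
apply: (le_moment mh h0 _ _ (measurable_alive T) mphi phi0 mphi) => //.
- by apply: measurable_funM; [exact: measurable_cst|exact: measurable_alive].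
- by move=> s; rewrite mulr_ge0// alive_ge0.
move=> s; rewrite /alive; case: ltP => s0; last first.
  by rewrite mulr0; case: ifP => // _; exact/ltW/survival_gt0.
rewrite (lt_le_trans s0 T0) sub0r addrC survivalD_ge//.
by rewrite oppr_ge0 ltW.
Qed.

Local Opaque moment window alive elapsed.

Hypothesis window_lty : forall T, (0 <= T)%R -> moment h (window T) (cst 1) < +oo.
Hypothesis alive_lty : moment h (alive 0) (cst 1) < +oo.

Let m1 : measurable_fun setT (cst 1 : E -> \bar R).
Proof. exact: measurable_cst. Qed.

Lemma moment_window_ge0 T (phi : E -> \bar R) : (forall x, 0 <= phi x) ->
  0 <= moment h (window T) phi.
Proof. by move=> phi0; apply: moment_ge0 => //; exact: window_ge0. Qed.

Lemma moment_alive_ge0 t (phi : E -> \bar R) : (forall x, 0 <= phi x) ->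
  0 <= moment h (alive t) phi.
Proof. by move=> phi0; apply: moment_ge0 => //; exact: alive_ge0. Qed.

Lemma smear_cst (k : R) : smear w (cst k%:E) = cst k%:E.
Proof.
by apply/funext => y; rewrite /smear integral_cst//= probability_setT mule1.
Qed.

Lemma moment_alive1 T : (0 <= T)%R ->
  moment h (alive T) (cst 1) = moment h (alive 0) (cst 1).
Proof.
move=> T0; have := moment_balance T0 m1 (fun=> lee01).
rewrite smear_cst => /eaddI; apply; rewrite ge0_fin_numE ?window_lty//.
by apply: moment_ge0 => //; exact: window_ge0.
Qed.

Section window_finite.
Variables (phi : E -> R) (kappa : R).
Hypotheses (mphi : measurable_fun setT phi) (phi0 : forall x, (0 <= phi x)%R).
Hypothesis kappa0 : (0 <= kappa)%R.
Hypothesis smear_phi : forall y, smear w (EFin \o phi) y <= (phi y + kappa)%:E.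
Hypothesis phi_lty : moment h (alive 0) (EFin \o phi) < +oo.
Variable T : R.
Hypothesis T0 : (0 <= T)%R.

(** The contraction can be absorbed only into a finite quantity. Truncating the weight at [K] makes
    its window moment finite, because the mass of the births is. *)
Let trunc (K : nat) x := Num.min (phi x) K%:R.

Let mtrunc K : measurable_fun setT (EFin \o trunc K).
Proof. by apply/measurable_EFinP; apply: measurable_minr. Qed.

Let trunc0 K x : 0 <= (EFin \o trunc K) x.
Proof. by rewrite lee_fin le_min phi0 ler0n. Qed.

Let mphiE : measurable_fun setT (EFin \o phi).
Proof. exact/measurable_EFinP. Qed.

Let phi0E x : 0 <= (EFin \o phi) x.
Proof. by rewrite lee_fin. Qed.

(** Averaging a truncation stays below both the average of [phi] and [K], so truncation preserves
    the bound with the same [kappa]. *)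
Let smear_trunc K y : smear w (EFin \o trunc K) y <= (trunc K y + kappa)%:E.
Proof.
have mtr : measurable_fun setT (fun z => (EFin \o trunc K) (tadd y z)).
  by apply: (measurableT_comp (mtrunc K)); exact: measurable_tadd.
have mph : measurable_fun setT (fun z => (EFin \o phi) (tadd y z)).
  by apply: (measurableT_comp mphiE); exact: measurable_tadd.
have s1 : smear w (EFin \o trunc K) y <= (phi y + kappa)%:E.
  apply: le_trans (smear_phi y); apply: ge0_le_integral => //.
  by move=> z _; rewrite lee_fin ge_min lexx.
have s2 : smear w (EFin \o trunc K) y <= K%:R%:E.
  rewrite -[leRHS]/(cst K%:R%:E y) -smear_cst; apply: ge0_le_integral => //.
  by move=> z _; rewrite lee_fin ge_min lexx orbT.
have -> : (trunc K y + kappa = Num.min (phi y) K%:R + kappa)%R by [].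
case: (leP (phi y) K%:R) => _ //; apply: (le_trans s2).
by rewrite lee_fin lerDl.
Qed.

(** The part of [trunc_bound] that does not depend on [K]. *)
Let bound := kappa%:E * moment h (window T) (cst 1)
  + (moment h (alive 0) (EFin \o phi) + kappa%:E * moment h (alive 0) (cst 1)).

Let bound0 : 0 <= bound.
Proof.
apply: adde_ge0; [|apply: adde_ge0].
- by apply: mule_ge0; [rewrite lee_fin|exact: moment_window_ge0].
- exact: moment_alive_ge0.
- by apply: mule_ge0; [rewrite lee_fin|exact: moment_alive_ge0].
Qed.

Let window_trunc_lty K : moment h (window T) (EFin \o trunc K) < +oo.
Proof.
apply: (@le_lt_trans _ _ (K%:R%:E * moment h (window T) (cst 1))).
  rewrite -(momentZr mh h0 (measurable_window T) (window_ge0 T) m1 (fun=> lee01) (ler0n R K)).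
  apply: (le_moment mh h0 (measurable_window T) (window_ge0 T) (measurable_window T)
    (mtrunc K) (trunc0 K)) => // x.
  by rewrite mule1 lee_fin ge_min lexx orbT.
apply: lte_mul_pinfty; [by rewrite lee_fin|by []|exact: window_lty].
Qed.

(** The births are replaced by their parents through the renewal equation. Parents born in the
    window contribute at most [1 - psi T] of their moment, those present initially at most all of
    it, and each average costs [kappa]. *)
Let trunc_bound K : moment h (window T) (EFin \o trunc K) <=
  (1 - psi T)%:E * moment h (window T) (EFin \o trunc K) + bound.
Proof.
have mw := measurable_window T; have w0 := window_ge0 T.
have ma := measurable_alive 0; have a0 := alive_ge0 0.
have p1 : (0 <= 1 - psi T)%R by rewrite subr_ge0 survival_le1.
have mK : measurable_fun setT (fun x => (EFin \o trunc K) x + cst kappa%:E x).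
  by apply: emeasurable_funD => //; exact: measurable_cst.
have K0 x : 0 <= (EFin \o trunc K) x + cst kappa%:E x.
  by rewrite adde_ge0// lee_fin.
have mpw : measurable_fun setT (fun s => (1 - psi T) * window T s)%R.
  by apply: measurable_funM => //; exact: measurable_cst.
have pw0 s : (0 <= (1 - psi T) * window T s)%R by rewrite mulr_ge0.
rewrite [leLHS](moment_window_renewal T0 (mtrunc K) (trunc0 K)).
apply: (@le_trans _ _ (moment h (fun s => (1 - psi T) * window T s + alive 0 s)%R
    (fun x => (EFin \o trunc K) x + cst kappa%:E x))).
  have e0 s : (0 <= elapsed T s)%R by exact: elapsed_ge0.
  have mtot : measurable_fun setT (fun s => (1 - psi T) * window T s + alive 0 s)%R.
    exact: measurable_funD.
  have msm := measurable_smear w (mtrunc K) (trunc0 K).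
  apply: (le_moment mh h0 (measurable_elapsed T) e0 mtot msm) => //.
  - by move=> x; exact: smear_ge0.
  - by move=> s; exact: elapsed_le.
rewrite [leLHS](momentDl mh h0 mpw pw0 ma a0 mK K0).
rewrite [X in X + _ <= _](momentZl mh h0 mw w0 mK K0 p1).
have mc : measurable_fun setT (cst kappa%:E : E -> _) by exact: measurable_cst.
have c0 (x : E) : 0 <= cst kappa%:E x by rewrite lee_fin.
have kE (m : R -> R) : measurable_fun setT m -> (forall s, 0 <= m s)%R ->
    moment h m (cst kappa%:E) = kappa%:E * moment h m (cst 1).
  move=> mm m0; rewrite -(momentZr mh h0 mm m0 m1 (fun=> lee01) kappa0).
  congr (moment h m _).
  by apply/funext => x /=; rewrite mule1.
rewrite (momentDr mh h0 mw w0 (mtrunc K) (trunc0 K) mc c0).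
rewrite (momentDr mh h0 ma a0 (mtrunc K) (trunc0 K) mc c0).
rewrite (kE _ mw w0) (kE _ ma a0).
rewrite ge0_muleDr; [|exact: moment_window_ge0
  |by apply: mule_ge0; [rewrite lee_fin|exact: moment_window_ge0]].
rewrite -addeA; apply: leeD2l; apply: leeD.
  apply: gee_pMl; first by [].
  - by apply: mule_ge0; [rewrite lee_fin|exact: moment_window_ge0].
  - by rewrite lee_fin gerBl ltW ?survival_gt0.
apply: leeD2r; apply: (le_moment mh h0 ma a0 ma (mtrunc K) (trunc0 K)) => // x.
by rewrite lee_fin ge_min lexx.
Qed.

(** The estimate [trunc_bound] is solved for the truncated moment, which gives a bound uniform in
    [K]; monotone convergence then removes the truncation. *)
Lemma moment_window_lty : moment h (window T) (EFin \o phi) < +oo.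
Proof.
have boundy : bound < +oo.
  apply: lte_add_pinfty.
    by apply: lte_mul_pinfty; [rewrite lee_fin|by []|exact: window_lty].
  apply: lte_add_pinfty; first exact: phi_lty.
  by apply: lte_mul_pinfty; [rewrite lee_fin|by []|exact: alive_lty].
have psi0 := survival_gt0 beta T.
(* As the truncated moment [I] is finite, [trunc_bound] yields [psi T * I <= bound]. *)
have trunc_le K : moment h (window T) (EFin \o trunc K) <= (fine bound / psi T)%:E.
  have := trunc_bound K; have := window_trunc_lty K.
  have := moment_window_ge0 T (trunc0 K).
  have <- : (fine bound)%:E = bound by rewrite fineK// ge0_fin_numE.
  case: (moment _ _ _) => // I _ _; rewrite -EFinM -EFinD !lee_fin => Ib.
  by rewrite ler_pdivlMr//; lra.
have mp2 (g : E -> \bar R) : measurable_fun setT g ->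
    measurable_fun setT (fun p : R * E => g p.2).
  by move=> mg; exact: (measurableT_comp mg measurable_snd).
have mA : measurable (`[0%R, T[ `*` [set: E]) by exact: measurableX.
have mhE : measurable_fun setT (EFin \o h) by exact/measurable_EFinP.
have cvgI : (\int[mu \x leb]_(p in `[0%R, T[ `*` [set: E])
      ((EFin \o trunc n) p.2 * (h p)%:E))%E @[n --> \oo] -->
    \int[mu \x leb]_(p in `[0%R, T[ `*` [set: E])
      limn (fun n => (EFin \o trunc n) p.2 * (h p)%:E).
  apply: cvg_monotone_convergence => //.
  - move=> n; apply: measurable_funTS; apply: emeasurable_funM => //.
    exact: mp2 (mtrunc n).
  - by move=> n p _; rewrite mule_ge0 ?lee_fin// le_min phi0 ler0n.
  - move=> p _ m n mn; apply: lee_pmul; rewrite ?lee_fin ?le_min ?phi0 ?ler0n//.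
    by rewrite !ge_min lexx/= ler_nat mn orbT.
apply: (@le_lt_trans _ _ (fine bound / psi T)%:E); last exact: ltry.
rewrite (moment_window_prod T mphiE phi0E).
have -> : \int[mu \x leb]_(p in `[0%R, T[ `*` [set: E]) ((EFin \o phi) p.2 * (h p)%:E) =
    \int[mu \x leb]_(p in `[0%R, T[ `*` [set: E])
      limn (fun n => (EFin \o trunc n) p.2 * (h p)%:E).
  (* At each point the truncations are eventually equal to [phi]. *)
  apply: eq_integral => p _; apply/esym/lim_near_cst => //.
  near=> n; congr (_ * _); congr EFin; rewrite /trunc min_l//.
  near: n; exact: nbhs_infty_ger.
apply: (cvge_to_le cvgI); apply: nearW => n.
by rewrite -(moment_window_prod T (mtrunc n) (trunc0 n)).
Unshelve. all: by end_near. Qed.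

End window_finite.

Local Opaque smear.

Lemma momentDcst (m : R -> R) (phi : E -> \bar R) (k : R) : measurable_fun setT m ->
  (forall s, 0 <= m s)%R -> measurable_fun setT phi -> (forall x, 0 <= phi x) ->
  (0 <= k)%R ->
  moment h m (fun x => phi x + k%:E) = moment h m phi + k%:E * moment h m (cst 1).
Proof.
move=> mm m0 mphi phi0 k0.
have mc : measurable_fun setT (fun x : E => k%:E * cst 1 x).
  by under eq_fun do rewrite mule1; exact: measurable_cst.
rewrite -(momentZr mh h0 mm m0 m1 (fun=> lee01) k0).
rewrite -(momentDr mh h0 mm m0 mphi phi0 mc).
  by congr (moment h m _); apply/funext => x; rewrite mule1.
by move=> x; rewrite mule1 lee_fin.
Qed.

(** Serves for the squared norm, with [k] the variance of a jump. *)
Lemma moment_alive_shift (phi : E -> R) (k T : R) : measurable_fun setT phi ->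
  (forall x, 0 <= phi x)%R -> (0 <= k)%R -> (0 <= T)%R ->
  (forall y, smear w (EFin \o phi) y = (phi y + k)%:E) ->
  moment h (alive 0) (EFin \o phi) < +oo ->
  moment h (alive T) (EFin \o phi) =
  moment h (alive 0) (EFin \o phi) + k%:E * moment h (window T) (cst 1).
Proof.
move=> mphi phi0 k0 T0 phik phi_lty.
have mphiE : measurable_fun setT (EFin \o phi) by exact/measurable_EFinP.
have phi0E x : 0 <= (EFin \o phi) x by rewrite lee_fin.
have phik_le y : smear w (EFin \o phi) y <= (phi y + k)%:E by rewrite phik.
have Ifin := moment_window_lty mphi phi0 k0 phik_le phi_lty T0.
have bal := moment_balance T0 mphiE phi0E.
have sE : smear w (EFin \o phi) = fun y => (EFin \o phi) y + k%:E.
  by apply/funext => y; rewrite phik.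
rewrite sE in bal.
apply: (balance_shift bal
  (momentDcst (measurable_alive T) (alive_ge0 T) mphiE phi0E k0)
  (momentDcst (measurable_window T) (window_ge0 T) mphiE phi0E k0)).
(* Conservation of mass lets the same mass stand for times 0 and [T]. *)
- exact: (etrans (momentDcst (measurable_alive 0) (alive_ge0 0) mphiE phi0E k0)
    (congr1 (fun a => moment h (alive 0) (EFin \o phi) + k%:E * a)
      (esym (moment_alive1 T0)))).
- by apply/andP; split; [exact: moment_window_ge0|exact: Ifin].
- by apply/andP; split; [exact: moment_window_ge0|exact: window_lty].
- exact: moment_alive_ge0.
- by apply/andP; split; [exact: moment_alive_ge0|exact: phi_lty].
- by rewrite (moment_alive1 T0); apply/andP; split; [exact: moment_alive_ge0|exact: alive_lty].
Qed.

Lemma moment_smear_lty (phi : E -> R) (k : R) (m : R -> R) : measurable_fun setT phi ->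
  (forall x, 0 <= phi x)%R -> (0 <= k)%R ->
  (forall y, (phi y)%:E <= smear w (EFin \o phi) y <= (phi y + k)%:E) ->
  measurable_fun setT m -> (forall s, 0 <= m s)%R ->
  moment h m (EFin \o phi) < +oo -> moment h m (cst 1) < +oo ->
  moment h m (smear w (EFin \o phi)) < +oo.
Proof.
move=> mphi phi0 k0 phik mm m0 mphioo m1oo.
have mphiE : measurable_fun setT (EFin \o phi) by exact/measurable_EFinP.
have phi0E x : 0 <= (EFin \o phi) x by rewrite lee_fin.
have msm := measurable_smear w mphiE phi0E.
have mk : measurable_fun setT (fun x => (EFin \o phi) x + k%:E).
  by apply: emeasurable_funD => //; exact: measurable_cst.
have : moment h m (smear w (EFin \o phi)) <= moment h m (fun x => (EFin \o phi) x + k%:E).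
  apply: (le_moment mh h0 mm m0 mm msm) => //.
  - by move=> x; exact: smear_ge0.
  - by move=> x; case/andP : (phik x).
move=> /le_lt_trans; apply.
apply: (eq_ind_r (fun a => a < +oo) _ (momentDcst mm m0 mphiE phi0E k0)).
apply: lte_add_pinfty; first exact: mphioo.
by apply: lte_mul_pinfty; rewrite ?lee_fin.
Qed.

(** The right-hand side of [moment_balance] is finite, so each term on the left is. *)
Lemma moment_alive_lty (phi : E -> R) (k T : R) : measurable_fun setT phi ->
  (forall x, 0 <= phi x)%R -> (0 <= k)%R -> (0 <= T)%R ->
  (forall y, (phi y)%:E <= smear w (EFin \o phi) y <= (phi y + k)%:E) ->
  moment h (alive 0) (EFin \o phi) < +oo ->
  moment h (alive T) (smear w (EFin \o phi)) < +oo.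
Proof.
move=> mphi phi0 k0 T0 phik phi_lty.
have mphiE : measurable_fun setT (EFin \o phi) by exact/measurable_EFinP.
have phi0E x : 0 <= (EFin \o phi) x by rewrite lee_fin.
have phik_le y : smear w (EFin \o phi) y <= (phi y + k)%:E by case/andP : (phik y).
have Ifin := moment_window_lty mphi phi0 k0 phik_le phi_lty T0.
have sI := moment_smear_lty mphi phi0 k0 phik (measurable_window T) (window_ge0 T) Ifin
  (window_lty T0).
have s0 := moment_smear_lty mphi phi0 k0 phik (measurable_alive 0) (alive_ge0 0) phi_lty
  alive_lty.
apply: (@le_lt_trans _ _ (moment h (window T) (EFin \o phi) +
    moment h (alive T) (smear w (EFin \o phi)))).
  by apply: leeDr; exact: moment_window_ge0.
by rewrite (moment_balance T0 mphiE phi0E); apply: lte_add_pinfty.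
Qed.

(** Meant for the positive and negative parts of a coordinate. Averaging does not shift either of
    them by a constant, but it preserves their difference. The two-sided bounds make every term
    finite, so that the two balances may be subtracted. *)
Lemma moment_alive_diff (phi1 phi2 : E -> R) (k T : R) :
  measurable_fun setT phi1 -> (forall x, 0 <= phi1 x)%R ->
  measurable_fun setT phi2 -> (forall x, 0 <= phi2 x)%R -> (0 <= k)%R -> (0 <= T)%R ->
  (forall y, (phi1 y)%:E <= smear w (EFin \o phi1) y <= (phi1 y + k)%:E) ->
  (forall y, (phi2 y)%:E <= smear w (EFin \o phi2) y <= (phi2 y + k)%:E) ->
  (forall y, smear w (EFin \o phi1) y + (phi2 y)%:E =
             smear w (EFin \o phi2) y + (phi1 y)%:E) ->
  moment h (alive 0) (EFin \o phi1) < +oo ->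
  moment h (alive 0) (EFin \o phi2) < +oo ->
  moment h (alive T) (EFin \o phi1) - moment h (alive T) (EFin \o phi2) =
  moment h (alive 0) (EFin \o phi1) - moment h (alive 0) (EFin \o phi2).
Proof.
move=> mphi1 phi10 mphi2 phi20 k0 T0 s1 s2 s12 fin1 fin2.
have mE (phi : E -> R) : measurable_fun setT phi -> measurable_fun setT (EFin \o phi).
  by move=> ?; exact/measurable_EFinP.
have E0 (phi : E -> R) : (forall x, 0 <= phi x)%R -> forall x, 0 <= (EFin \o phi) x.
  by move=> phi0 x; rewrite lee_fin.
have b1 := moment_balance T0 (mE _ mphi1) (E0 _ phi10).
have b2 := moment_balance T0 (mE _ mphi2) (E0 _ phi20).
have sT1 := moment_alive_lty mphi1 phi10 k0 T0 s1 fin1.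
have sT2 := moment_alive_lty mphi2 phi20 k0 T0 s2 fin2.
have s01 := moment_alive_lty mphi1 phi10 k0 (lexx 0%R) s1 fin1.
have s02 := moment_alive_lty mphi2 phi20 k0 (lexx 0%R) s2 fin2.
have ms1 := measurable_smear w (mE _ mphi1) (E0 _ phi10).
have ms2 := measurable_smear w (mE _ mphi2) (E0 _ phi20).
have sm10 x := smear_ge0 w x (E0 _ phi10).
have sm20 x := smear_ge0 w x (E0 _ phi20).
have i1 : moment h (window T) (EFin \o phi1) < +oo.
  by apply: (moment_window_lty mphi1 phi10 k0 _ fin1 T0) => y; case/andP : (s1 y).
have i2 : moment h (window T) (EFin \o phi2) < +oo.
  by apply: (moment_window_lty mphi2 phi20 k0 _ fin2 T0) => y; case/andP : (s2 y).
have add (m : R -> R) (mm : measurable_fun setT m) (m0 : forall s : R, (0 <= m s)%R) :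
    moment h m (smear w (EFin \o phi1)) + moment h m (EFin \o phi2) =
    moment h m (smear w (EFin \o phi2)) + moment h m (EFin \o phi1).
  have eq12 := congr1 (moment h m) (funext s12).
  exact: (etrans (esym (momentDr mh h0 mm m0 ms1 sm10 (mE _ mphi2) (E0 _ phi20)))
    (etrans eq12 (momentDr mh h0 mm m0 ms2 sm20 (mE _ mphi1) (E0 _ phi10)))).
have le (phi : E -> R) : measurable_fun setT phi -> (forall x, 0 <= phi x)%R ->
    (forall y, (phi y)%:E <= smear w (EFin \o phi) y <= (phi y + k)%:E) ->
    moment h (alive T) (smear w (EFin \o phi)) < +oo ->
    moment h (alive T) (EFin \o phi) < +oo.
  move=> mphi phi0 sphi; apply: le_lt_trans.
  have sphi1 x : (EFin \o phi) x <= smear w (EFin \o phi) x by case/andP : (sphi x).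
  exact: (le_moment mh h0 (measurable_alive T) (alive_ge0 T) (measurable_alive T)
    (mE _ mphi) (E0 _ phi0) (measurable_smear w (mE _ mphi) (E0 _ phi0))
    (fun s => lexx (alive T s)) sphi1).
have fin (m : R -> R) (phi : E -> \bar R) : (forall s : R, 0 <= m s)%R -> (forall x, 0 <= phi x) ->
    moment h m phi < +oo -> moment h m phi \is a fin_num.
  move=> m0 p0 moo; exact: (ge0_lty_fin_num (moment_ge0 h0 m0 p0) moo).
have sI (phi : E -> R) : measurable_fun setT phi -> (forall x, 0 <= phi x)%R ->
    (forall y, (phi y)%:E <= smear w (EFin \o phi) y <= (phi y + k)%:E) ->
    moment h (window T) (EFin \o phi) < +oo ->
    moment h (window T) (smear w (EFin \o phi)) < +oo.
  move=> mphi phi0 sphi Ioo.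
  exact: (moment_smear_lty mphi phi0 k0 sphi (measurable_window T) (window_ge0 T) Ioo
     (window_lty T0)).
apply: (balance_diff b1 b2 (add _ (measurable_window T) (window_ge0 T))
  (add _ (measurable_alive T) (alive_ge0 T)) (add _ (measurable_alive 0) (alive_ge0 0))).
- exact: (fin _ _ (window_ge0 T) (E0 _ phi10) i1).
- exact: (fin _ _ (window_ge0 T) sm10 (sI _ mphi1 phi10 s1 i1)).
- exact: (fin _ _ (alive_ge0 T) (E0 _ phi10) (le _ mphi1 phi10 s1 sT1)).
- exact: (fin _ _ (alive_ge0 T) sm10 sT1).
- exact: (fin _ _ (alive_ge0 0) (E0 _ phi10) fin1).
- exact: (fin _ _ (alive_ge0 0) sm10 s01).
- exact: (fin _ _ (window_ge0 T) (E0 _ phi20) i2).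
- exact: (fin _ _ (window_ge0 T) sm20 (sI _ mphi2 phi20 s2 i2)).
- exact: (fin _ _ (alive_ge0 T) (E0 _ phi20) (le _ mphi2 phi20 s2 sT2)).
- exact: (fin _ _ (alive_ge0 T) sm20 sT2).
- exact: (fin _ _ (alive_ge0 0) (E0 _ phi20) fin2).
- exact: (fin _ _ (alive_ge0 0) sm20 s02).
Qed.

End renewal_solution.
End balance.

(** * The renewal density of a mild solution *)

Section integral_of_difference.
Context d (T : measurableType d) (R : realType) (m : {measure set T -> \bar R}).
Variables F G : T -> \bar R.
Hypotheses (mF : measurable_fun setT F) (F0 : forall x, (0 <= F x)%E).
Hypotheses (mG : measurable_fun setT G) (G0 : forall x, (0 <= G x)%E).
Local Open Scope ereal_scope.

(** Valid even when both integrals are infinite: the negative part of [F - G] is at most [G], also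
    under the convention [+oo - +oo = -oo]. *)
Lemma integral_sub_ge : - (\int[m]_x G x) <= \int[m]_x (F x - G x).
Proof.
have mFG : measurable_fun setT (fun x => F x - G x) by exact: emeasurable_funB.
rewrite [leRHS]integralE.
have le_neg : \int[m]_x (fun x => F x - G x)^\- x <= \int[m]_x G x.
  apply: ge0_le_integral => //; first exact: measurable_funeneg.
  move=> x _; rewrite funenegE ge_max G0 andbT.
  by move: (F0 x) (G0 x); case: (F x) => [a| |]//; case: (G x) => [b| |]//=;
    rewrite ?leey ?leNye// !lee_fin; lra.
apply: (@le_trans _ _ (- (\int[m]_x (fun x => F x - G x)^\- x))).
  by rewrite leeN2.
by rewrite -[leLHS]add0e leeD2r// integral_ge0// => x _; exact: funepos_ge0.
Qed.

Lemma integral_sub_null : \int[m]_x G x = 0 ->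
  \int[m]_x (F x - G x) = \int[m]_x F x.
Proof.
move=> G_null; apply: ae_eq_integral => //; first exact: emeasurable_funB.
have : \int[m]_x `|G x| = 0.
  by rewrite -G_null; apply: eq_integral => x _; rewrite gee0_abs.
move=> /ae_eq_integral_abs => /(_ measurableT mG).
apply: (@filterS _ _ (ae_filter_ringOfSetsType _)) => x /(_ Logic.I) /= Gx _.
by rewrite Gx sube0.
Qed.

End integral_of_difference.

(** For [x = y = +oo] both sides are [-oo] if [k] is positive and 0 if [k] is 0. *)
Lemma ge0_muleBr (R : realDomainType) (k : R) (x y : \bar R) :
  (0 <= k)%R -> (0 <= x -> 0 <= y -> k%:E * (x - y) = k%:E * x - k%:E * y)%E.
Proof.
rewrite le_eqVlt => /predU1P[<-|k0]; first by rewrite !mul0e sube0.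
move: x y => [x| |] [y| |]//= _ _; rewrite ?gt0_muley ?gt0_muleNy ?lte_fin//.
by rewrite -!EFinM -!EFinB mulrBr.
Qed.

Section age_structured_solution.
Context {R : realType} (d : nat) (w : probability (d.-tuple R) R).
Context (beta : R -> R).
Local Notation mu := (@lebesgue_measure R).
Local Notation leb := (lebesgue_tuple R d).
Local Notation psi := (survival beta).
Local Notation E := (d.-tuple R).
Hypothesis beta_ge0 : forall a, 0 <= a -> 0 <= beta a.
Hypothesis beta_cont : {within `[0, +oo[, continuous beta}.
Local Notation f := (renewal_kernel beta).
Variables (r0 : R -> E -> R) (r : R -> R -> E -> R).
Hypothesis r0_L1 : (mu \x leb)%E.-integrable (`]0, +oo[ `*` [set: E])
  (fun p => (r0 p.1 p.2)%:E).
Hypothesis r0_ge0 : forall a x, 0 < a -> 0 <= r0 a x.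
Hypothesis r_sol : mild_solution w beta r0 r.
Local Open Scope ereal_scope.

(* Following characteristics back to [a = 0] also for [t < a], the solution is
   [r t a x = psi a * characteristic (t - a, x)] in both regimes. *)
Definition characteristic (p : R * E) : R :=
  if (0 <= p.1)%R then r p.1 0%R p.2 else (r0 (- p.1) p.2 / psi (- p.1))%R.
Local Notation c := characteristic.

(* A solution is nonnegative almost everywhere only, see [moment_cn0]; its
   positive part is so everywhere. *)
Definition renewal_density (p : R * E) : R := Num.max (c p) 0%R.
Local Notation cp := renewal_density.
Let cn (p : R * E) : R := Num.max (- c p)%R 0%R.

Lemma characteristicE t a x : (0 <= t)%R -> (0 <= a)%R ->
  (r t a x = psi a * c ((t - a)%R, x))%R.
Proof.
move=> t0 a0; rewrite (mild_characteristics r_sol)// /characteristic/= subr_ge0.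
by case: ifP => _; rewrite ?opprB; ring.
Qed.

(** Measurability comes in pieces: for the trace it is contained in its integrability on each
    [[0, n]], and on negative times it comes from that of [r0] and the monotonicity of [psi]. *)
Lemma measurable_characteristic : measurable_fun setT c.
Proof.
have -> : [set: R * E] = (`[0%R, +oo[ `*` [set: E]) `|` (`]-oo, 0%R[ `*` [set: E]).
  apply/esym/seteqP; split => // -[s x] _ /=; rewrite !in_itv/= andbT.
  by case: (leP 0%R s) => _; [left|right].
apply/measurable_funU; [exact: measurableX|exact: measurableX|split].
- have -> : `[0%R, +oo[ `*` [set: E] =
      \bigcup_n ((`[0%R, n%:R%R]%classic : set R) `*` [set: E]).
    rewrite eqEsubset; split => [[s x] [/=]|[s x] [n _] [/=]]; rewrite in_itv/= ?andbT.
      move=> s0 _; exists (Num.bound s) => //; split => //=.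
      by rewrite in_itv/= s0 ltW// archi_boundP.
    by rewrite !in_itv/= andbT => /andP[].
  apply/measurable_fun_bigcup; first by move=> n; exact: measurableX.
  move=> n; have /integrableP[/measurable_EFinP mr _] := mild_trace_integrable r_sol n%:R.
  apply: eq_measurable_fun mr => -[s x]; rewrite inE => -[/=].
  by rewrite in_itv/= /characteristic => /andP[-> _] _.
- have /integrableP[/measurable_EFinP mr _] := r0_L1.
  pose opp1 (p : R * E) := ((- p.1)%R, p.2).
  have mopp : measurable_fun setT opp1.
    apply: measurable_fun_pair => //.
    exact: (measurableT_comp (@oppr_measurable R setT) measurable_fst).
  have mpsi : measurable_fun setT (fun p : R * E => (psi (- p.1)%R)^-1%R).
    have mpi : measurable_fun setT (fun x => (psi x)^-1%R).
      apply: nondecreasing_measurable; first exact: measurableT.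
      move=> x y xy.
      rewrite lef_pV2; [|by rewrite posrE survival_gt0|by rewrite posrE survival_gt0].
      exact: survival_nonincreasing.
    exact: (measurableT_comp mpi (measurableT_comp (@oppr_measurable R setT) measurable_fst)).
  apply: (@eq_measurable_fun _ _ _ _ _ (fun p => (r0 (opp1 p).1 (opp1 p).2 * (psi (- p.1))^-1)%R)).
    move=> [s x]; rewrite inE => -[/=]; rewrite in_itv/= /characteristic/= => s0 _.
    by rewrite leNgt s0.
  apply: measurable_funM; last exact: measurable_funTS.
  apply: (measurable_comp (F := (`]0%R, +oo[%classic : set R) `*` [set: E])
    (f := fun p => r0 p.1 p.2) (g := opp1) _ _ mr).
  + exact: measurableX.
  + move=> q [[s x]] [/=]; rewrite in_itv/= => s0 _ <-; split => //=.
    by rewrite in_itv/= oppr_gt0 s0.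
  + exact: measurable_funTS.
Qed.


Lemma measurable_renewal_density : measurable_fun setT cp.
Proof. by apply: measurable_maxr => //; exact: measurable_characteristic. Qed.

Let mcp := measurable_renewal_density.

Let mcn : measurable_fun setT cn.
Proof.
apply: measurable_maxr => //; apply: measurable_funN.
exact: measurable_characteristic.
Qed.

Lemma renewal_density_ge0 p : (0 <= cp p)%R.
Proof. by rewrite le_max lexx orbT. Qed.
Let cp0 := renewal_density_ge0.
Let cn0 p : (0 <= cn p)%R. Proof. by rewrite le_max lexx orbT. Qed.

Let c_lt0 s x : (s < 0 -> 0 <= c (s, x))%R.
Proof.
move=> s0; rewrite /characteristic/= (leNgt 0%R s) s0/=.
by rewrite divr_ge0 ?r0_ge0 ?oppr_gt0// ltW// survival_gt0.
Qed.

Let cn_lt0 s x : (s < 0 -> cn (s, x) = 0)%R.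
Proof. by move=> s0; rewrite /cn max_r// oppr_le0 c_lt0. Qed.

Let integral_characteristic_spread k s x : (0 <= k)%R ->
  \int[w]_z (k * c (s, tsub x z))%:E =
  k%:E * spread w cp s x - k%:E * spread w cn s x.
Proof.
move=> k0.
have mxz (g : R * E -> R) : measurable_fun setT g ->
    measurable_fun setT (fun z => (g (s, tsub x z))%:E).
  move=> mg; apply/measurable_EFinP; apply: (measurableT_comp mg).
  by apply: measurable_fun_pair => //; exact: measurable_tsub.
rewrite integralE /spread -!ge0_integralZl_EFin//.
- congr (_ - _); apply: eq_integral => z _.
    by rewrite funeposE -EFin_max -EFinM /cp maxr_pMr// mulr0.
  by rewrite funenegE -EFinN -EFin_max -EFinM /cn maxr_pMr// mulr0 mulrN.
- by move=> z _; rewrite lee_fin.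
- exact: mxz.
- by move=> z _; rewrite lee_fin.
- exact: mxz.
Qed.

Let FP t x a := (f a)%:E * spread w cp (t - a)%R x.
Let FN t x a := (f a)%:E * spread w cn (t - a)%R x.

Let FP0 t x a : 0 <= FP t x a.
Proof. by rewrite mule_ge0 ?spread_ge0// lee_fin renewal_kernel_ge0. Qed.
Let FN0 t x a : 0 <= FN t x a.
Proof. by rewrite mule_ge0 ?spread_ge0// lee_fin renewal_kernel_ge0. Qed.

Let m_renewal_slice (g : R * E -> R) t x : measurable_fun setT g -> (forall p, 0 <= g p)%R ->
  measurable_fun setT (fun a => (f a)%:E * spread w g (t - a)%R x).
Proof.
move=> mg g0; apply: emeasurable_funM.
  by apply/measurable_EFinP; exact: measurable_renewal_kernel.
have mta : measurable_fun setT (fun a : R => ((t - a)%R, x)).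
  by apply: measurable_fun_pair => //; exact: measurable_funB.
exact: (measurableT_comp (measurable_spread w mg g0) mta).
Qed.

(** The difference remains under the integral sign: until the negative part is known to vanish, both
    parts could have an infinite integral. *)
Lemma boundary_characteristic : {ae (mu \x leb), forall p, (0 <= p.1)%R ->
  (c p)%:E = \int[mu]_a (FP p.1 p.2 a - FN p.1 p.2 a)}.
Proof.
apply: (@filterS _ _ (ae_filter_ringOfSetsType _) _ _ _ (mild_boundary r_sol)).
move=> [t x] /= + t0 => /(_ t0); rewrite {1}/characteristic/= t0 => ->.
rewrite integral_mkcond; apply: eq_integral => a _; rewrite patchE mem_setE in_itv/= andbT.
case: ifPn => [a0|a0]; last first.
  by rewrite /FP /FN /renewal_kernel (negbTE a0) !mul0e sube0.
rewrite /convol; under eq_integral do rewrite characteristicE//.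
rewrite integral_characteristic_spread ?(ltW (survival_gt0 _ _))//.
have psi0 := ltW (survival_gt0 beta a).
rewrite ge0_muleBr ?beta_ge0 ?mule_ge0 ?spread_ge0//.
by rewrite !muleA -EFinM -renewal_kernelE.
Qed.

Let trace_lty T : (0 <= T)%R ->
  \int[mu \x leb]_(p in `[0%R, T[ `*` setT) `|c p|%:E < +oo.
Proof.
move=> T0; have /integrableP[mr roo] := mild_trace_integrable r_sol T.
apply: le_lt_trans roo.
have -> : \int[mu \x leb]_(p in `[0%R, T[ `*` setT) `|c p|%:E =
    \int[mu \x leb]_(p in `[0%R, T[ `*` setT) `|(r p.1 0%R p.2)%:E|.
  apply: eq_integral => -[s x]; rewrite inE => -[/=]; rewrite in_itv/= /characteristic/= => /andP[-> _] _.
  by [].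
apply: ge0_subset_integral => //.
- exact: measurableX.
- exact: measurableX.
- exact: measurableT_comp.
- by move=> [s x] [/=]; rewrite !in_itv/= => /andP[-> /ltW ->].
Qed.

Let moment_window_part_lty (g : R * E -> R) T : measurable_fun setT g ->
  (forall p, 0 <= g p)%R -> (forall p, g p <= `|c p|)%R -> (0 <= T)%R ->
  moment g (window T) (cst 1) < +oo.
Proof.
move=> mg g0 gc T0; apply: le_lt_trans (trace_lty T0).
rewrite (moment_window_prod mg g0 T (measurable_cst _) (fun=> lee01)).
have mA : measurable (`[0%R, T[ `*` [set: E]) by exact: measurableX.
apply: ge0_le_integral => //.
- by move=> p _; rewrite mul1e lee_fin.
- apply: measurable_funTS; under eq_fun do rewrite mul1e.
  exact/measurable_EFinP.
- apply: measurable_funTS; apply/measurable_EFinP; apply: measurableT_comp => //.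
  exact: measurable_characteristic.
- by move=> p _; rewrite mul1e lee_fin.
Qed.

Let cp_le p : (cp p <= `|c p|)%R.
Proof. by rewrite ge_max normr_ge0 ler_norm. Qed.

Let cn_le p : (cn p <= `|c p|)%R.
Proof. by rewrite ge_max normr_ge0 ler_normr lexx orbT. Qed.

(** The negative part is a subsolution of the renewal equation. *)
Let cn_le_renewal : {ae (mu \x leb), forall p, (0 <= p.1)%R ->
  (cn p)%:E <= renewal w beta cn p.1 p.2}.
Proof.
apply: (@filterS _ _ (ae_filter_ringOfSetsType _) _ _ _ boundary_characteristic).
move=> [t x] /= + t0 => /(_ t0) cE.
rewrite EFin_max ge_max; apply/andP; split; last first.
  exact: (renewal_ge0 w beta_ge0 cn0).
rewrite EFinN cE leeNl; apply: integral_sub_ge.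
- exact: m_renewal_slice.
- by move=> a; exact: FP0.
- exact: m_renewal_slice.
- by move=> a; exact: FN0.
Qed.

Let pairing_cn_lt0 phi s : (s < 0)%R -> pairing cn phi s = 0.
Proof. by move=> s0; apply: integral0_eq => x _; rewrite cn_lt0// mule0. Qed.

(** Only [0 <= s] has to be compared: nonnegativity of [r0] makes [cn] vanish at negative times. *)
Let le_moment_cn (m1 m2 : R -> R) : measurable_fun setT m1 -> (forall s, 0 <= m1 s)%R ->
  measurable_fun setT m2 -> (forall s, 0 <= s -> m1 s <= m2 s)%R ->
  moment cn m1 (cst 1) <= moment cn m2 (cst 1).
Proof.
move=> mm1 m10 mm2 m12.
have p0 s : 0 <= pairing cn (cst 1) s by apply: pairing_ge0.
have mp : measurable_fun setT (pairing cn (cst 1)).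
  exact: (measurable_pairing mcn cn0 (measurable_cst _) (fun=> lee01)).
apply: ge0_le_integral => //.
- by move=> s _; rewrite mule_ge0 ?lee_fin.
- by apply: emeasurable_funM => //; exact/measurable_EFinP.
- by apply: emeasurable_funM => //; exact/measurable_EFinP.
- move=> s _; have [s0|s0] := ltP s 0%R; first by rewrite pairing_cn_lt0// !mule0.
  by apply: lee_wpmul2r => //; rewrite lee_fin m12.
Qed.

Let smear1 : smear w (cst 1) = cst 1 :> (E -> \bar R).
Proof. exact: smear_cst. Qed.

Let integral_renewal_cn T : (0 <= T)%R ->
  \int[mu \x leb]_(p in `[0%R, T[ `*` setT) renewal w beta cn p.1 p.2 =
  moment cn (elapsed beta T) (cst 1).
Proof.
move=> T0.
have := moment_renewal w beta_ge0 beta_cont mcn cn0 (measurable_cst (1 : \bar R))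
  (fun=> lee01) T0.
rewrite smear1 => <-.
have mA : measurable (`[0%R, T[%classic : set R) by [].
rewrite -(@ge0_integral_slice _ _ _ leb _ (fun p => renewal w beta cn p.1 p.2) mA).
- by apply: eq_integral => t _; apply: eq_integral => x _; rewrite mul1e.
- exact: (measurable_renewal w beta_ge0 beta_cont mcn cn0).
- by move=> p; exact: (renewal_ge0 w beta_ge0 cn0).
Qed.

(* The mass of the negative part in [0, T[ is at most the fraction
   [1 - psi T < 1] of itself. *)
Let moment_cn0 T : (0 <= T)%R -> moment cn (window T) (cst 1) = 0.
Proof.
move=> T0.
have Ige0 : 0 <= moment cn (window T) (cst 1).
  exact: (moment_ge0 cn0 (window_ge0 T) (fun=> lee01)).
have Ioo := moment_window_part_lty mcn cn0 cn_le T0.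
have mA : measurable (`[0%R, T[ `*` [set: E]) by exact: measurableX.
have le1 : moment cn (window T) (cst 1) <= moment cn (elapsed beta T) (cst 1).
  rewrite -(integral_renewal_cn T0).
  rewrite (moment_window_prod mcn cn0 T (measurable_cst _) (fun=> lee01)).
  apply: ae_ge0_le_integral => //.
  - by move=> p _; rewrite mul1e lee_fin.
  - apply: measurable_funTS; under eq_fun do rewrite mul1e.
    exact/measurable_EFinP.
  - by move=> p _; exact: (renewal_ge0 w beta_ge0 cn0).
  - by apply: measurable_funTS; exact: (measurable_renewal w beta_ge0 beta_cont mcn cn0).
  - apply: (@filterS _ _ (ae_filter_ringOfSetsType _) _ _ _ cn_le_renewal).
    by move=> p pr [/=]; rewrite in_itv/= => /andP[p0 _] _; rewrite mul1e pr.
have mpw : measurable_fun setT (fun s => (1 - psi T) * window T s)%R.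
  by apply: measurable_funM; [exact: measurable_cst|exact: measurable_window].
have le2 : moment cn (elapsed beta T) (cst 1) <=
    moment cn (fun s => (1 - psi T) * window T s)%R (cst 1).
  apply: (le_moment_cn (measurable_elapsed beta_ge0 beta_cont T) _ mpw).
  - by move=> s; exact: elapsed_ge0.
  - by move=> s s0; exact: elapsed_le_window.
have p1 : (0 <= 1 - psi T)%R by rewrite subr_ge0 survival_le1.
have := le_trans le1 le2.
rewrite (momentZl mcn cn0 (measurable_window T) (window_ge0 T) (measurable_cst _)
  (fun=> lee01) p1).
have := survival_gt0 beta T; move: Ige0 Ioo.
case: (moment cn (window T) (cst 1)) => // I; rewrite !lee_fin => I0 _ psi0 Ib.
by congr EFin; nra.
Qed.

(** Over [[0, n[] the renewal term of [cn] has the integral [moment cn (elapsed n)], at most the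
    vanishing mass of [cn] in that window. Countably many windows cover all times. *)
Let renewal_cn0 : {ae (mu \x leb), forall p, (0 <= p.1)%R ->
  renewal w beta cn p.1 p.2 = 0}.
Proof.
have mr := measurable_renewal w beta_ge0 beta_cont mcn cn0.
have r_ge0 p := renewal_ge0 w beta_ge0 cn0 p.1 p.2.
suff H n : {ae (mu \x leb), forall p : R * E, ((`[0%R, n%:R%R[%classic : set R) `*` [set: E]) p ->
    renewal w beta cn p.1 p.2 = 0}.
  have := ae_foralln H; apply: (@filterS _ _ (ae_filter_ringOfSetsType _)).
  move=> [t x] /= tx t0; apply: (tx (Num.bound t)); split => //=.
  by rewrite in_itv/= t0 archi_boundP.
have mA : measurable ((`[0%R, n%:R%R[%classic : set R) `*` [set: E]) by exact: measurableX.
have e0 : moment cn (elapsed beta n%:R) (cst 1) = 0.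
  apply/eqP; rewrite eq_le; apply/andP; split; last first.
    apply: (moment_ge0 cn0) => // s; exact: elapsed_ge0.
  rewrite -(moment_cn0 (ler0n R n)).
  apply: le_moment_cn.
  - exact: measurable_elapsed.
  - by move=> s; exact: elapsed_ge0.
  - exact: measurable_window.
  - move=> s s0; apply: le_trans (elapsed_le_window beta_ge0 beta_cont (ler0n R n) s0) _.
    by rewrite ler_piMl ?window_ge0// gerBl ltW// survival_gt0.
have : \int[mu \x leb]_(p in (`[0%R, n%:R%R[%classic : set R) `*` setT) `|renewal w beta cn p.1 p.2| = 0.
  rewrite -e0 -(integral_renewal_cn (ler0n R n)).
  by apply: eq_integral => p _; rewrite gee0_abs.
by move/ae_eq_integral_abs => /(_ mA (measurable_funTS mr)).
Qed.

Lemma renewal_density_boundary : {ae (mu \x leb), forall p, (0 <= p.1)%R ->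
  (cp p)%:E = renewal w beta cp p.1 p.2}.
Proof.
apply: (@filterS2 _ _ (ae_filter_ringOfSetsType _) _ _ _ _
  boundary_characteristic renewal_cn0).
move=> [t x] /= + + t0 => /(_ t0) cE /(_ t0) n0.
have cpE : (c (t, x))%:E = renewal w beta cp t x.
  rewrite cE; apply: (integral_sub_null _ _ _ n0).
  - exact: m_renewal_slice.
  - exact: m_renewal_slice.
  - by move=> a; exact: FN0.
have c0 : (0 <= c (t, x))%R.
  by rewrite -lee_fin cpE; exact: (renewal_ge0 w beta_ge0 cp0).
exact: (etrans (congr1 EFin (max_l c0)) cpE).
Qed.

Lemma renewal_density_window_lty T : (0 <= T)%R -> moment cp (window T) (cst 1) < +oo.
Proof. by apply: moment_window_part_lty => // p; exact: cp_le. Qed.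

(** The density [rho(t, x)], written over the times [s = t - a] of the last jump. *)
Definition alive_total (g : R * E -> R) (t : R) (x : E) : \bar R :=
  \int[mu]_s (alive beta t s * g (s, x))%:E.

Let m_alive (g : R * E -> R) t : measurable_fun setT g ->
  measurable_fun setT (fun p : R * E => (alive beta t p.1 * g p)%:E).
Proof.
move=> mg; apply/measurable_EFinP; apply: measurable_funM => //.
exact: (measurableT_comp (measurable_alive beta_ge0 beta_cont t) measurable_fst).
Qed.

Let m_alive_slice (g : R * E -> R) t x : measurable_fun setT g ->
  measurable_fun setT (fun s : R => (alive beta t s * g (s, x))%:E).
Proof. by move=> mg; exact: (measurableT_comp (m_alive t mg) (pair2_measurable x)). Qed.

Let alive_g0 (g : R * E -> R) (t : R) (p : R * E) : (forall p, 0 <= g p)%R ->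
  0 <= (alive beta t p.1 * g p)%:E.
Proof. by move=> g0; rewrite lee_fin mulr_ge0 ?alive_ge0. Qed.

Lemma alive_total_ge0 (g : R * E -> R) t x : (forall p, 0 <= g p)%R -> 0 <= alive_total g t x.
Proof. by move=> g0; apply: integral_ge0 => s _; exact: (alive_g0 t (s, x)). Qed.

Lemma measurable_alive_total (g : R * E -> R) t : measurable_fun setT g -> (forall p, 0 <= g p)%R ->
  measurable_fun setT (alive_total g t).
Proof.
move=> mg g0.
apply: (ge0_measurable_integral2 mu (f := fun s x => (alive beta t s * g (s, x))%:E)).
  rewrite [X in measurable_fun _ X](_ : _ = (fun p => (alive beta t p.1 * g p)%:E)).
    exact: m_alive.
  by apply/funext => -[].
by move=> s x; exact: (alive_g0 t (s, x)).
Qed.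

Lemma moment_alive_total (g : R * E -> R) t (phi : E -> \bar R) : measurable_fun setT g ->
  (forall p, 0 <= g p)%R -> measurable_fun setT phi -> (forall x, 0 <= phi x) ->
  moment g (alive beta t) phi = \int[leb]_x (phi x * alive_total g t x).
Proof.
move=> mg g0 mphi phi0.
transitivity (\int[mu]_s \int[leb]_x (phi x * (alive beta t s * g (s, x))%:E)).
  apply: eq_integral => s _; rewrite /pairing -ge0_integralZl//.
  - by apply: eq_integral => x _; rewrite EFinM muleCA.
  - apply: emeasurable_funM => //; apply/measurable_EFinP.
    exact: (measurableT_comp mg (pair1_measurable s)).
  - by move=> x _; rewrite mule_ge0 ?lee_fin.
  - by rewrite lee_fin alive_ge0.
rewrite (@ge0_exchange_integral _ _ _ _ _ mu leb
  (fun s x => phi x * (alive beta t s * g (s, x))%:E)).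
- apply: eq_integral => x _; rewrite ge0_integralZl//.
  + exact: m_alive_slice.
  + by move=> s _; exact: (alive_g0 t (s, x)).
- apply: emeasurable_funM; first exact: (measurableT_comp mphi measurable_snd).
  rewrite [X in measurable_fun _ X](_ : _ = (fun p => (alive beta t p.1 * g p)%:E)).
    exact: m_alive.
  by apply/funext => -[].
- by move=> s x; apply: mule_ge0 => //; exact: (alive_g0 t (s, x)).
Qed.

Lemma age_totalE t x : (0 <= t)%R ->
  age_total (r t) x = alive_total cp t x - alive_total cn t x.
Proof.
move=> t0.
have refl (g : R * E -> R) : measurable_fun setT g -> (forall p, 0 <= g p)%R ->
    alive_total g t x = \int[mu]_(a in `]0%R, +oo[) (psi a * g ((t - a)%R, x))%:E.
  move=> mg g0.
  rewrite /alive_total -(@ge0_integral_reflect R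
    (fun s => (alive beta t s * g (s, x))%:E) t).
  - rewrite [RHS]integral_mkcond; apply: eq_integral => a _.
    rewrite patchE mem_setE in_itv/= andbT /alive subKr.
    by rewrite gtrBl; case: ifP => // _; rewrite mul0r.
  - exact: m_alive_slice.
  - by move=> s; exact: (alive_g0 t (s, x)).
rewrite (refl _ mcp cp0) (refl _ mcn cn0) /age_total integralE.
have rE a : a \in `]0%R, +oo[%classic -> r t a x = (psi a * c ((t - a)%R, x))%R.
  by rewrite inE/= in_itv/= andbT => a0; rewrite characteristicE// ltW.
congr (_ - _); apply: eq_integral => a a0.
  rewrite funeposE -EFin_max rE// /renewal_density maxr_pMr ?mulr0//.
  exact/ltW/survival_gt0.
rewrite funenegE -EFinN -EFin_max rE// /cn maxr_pMr ?mulr0 ?mulrN//.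
exact/ltW/survival_gt0.
Qed.

Lemma measurable_age_total t : (0 <= t)%R -> measurable_fun setT (age_total (r t)).
Proof.
move=> t0; rewrite (_ : age_total (r t) = fun x => alive_total cp t x - alive_total cn t x).
  by apply: emeasurable_funB; exact: measurable_alive_total.
by apply/funext => x; rewrite age_totalE.
Qed.

Lemma age_total_ae t : (0 <= t)%R ->
  {ae leb, forall x, age_total (r t) x = alive_total cp t x}.
Proof.
move=> t0.
have mn := measurable_alive_total t mcn cn0.
have n0 x := alive_total_ge0 t x cn0.
have I0 : \int[leb]_x `|alive_total cn t x| = 0.
  transitivity (moment cn (alive beta t) (cst 1)).
    rewrite (moment_alive_total t mcn cn0 (measurable_cst _) (fun=> lee01)).
    by apply: eq_integral => x _; rewrite mul1e gee0_abs.
  apply/eqP; rewrite eq_le; apply/andP; split; last first.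
    exact: (moment_ge0 cn0 (alive_ge0 beta t) (fun=> lee01)).
  rewrite -(moment_cn0 t0); apply: le_moment_cn.
  - exact: measurable_alive.
  - exact: alive_ge0.
  - exact: measurable_window.
  - move=> s s0; rewrite /alive windowE s0/=; case: ifP => // _.
    exact: survival_le1.
move/ae_eq_integral_abs : I0 => /(_ measurableT mn).
apply: (@filterS _ _ (ae_filter_ringOfSetsType _)) => x /(_ Logic.I) nx.
by rewrite (age_totalE x t0) nx sube0.
Qed.

Lemma integral_ge0_age_total t (phi : E -> \bar R) : (0 <= t)%R ->
  measurable_fun setT phi -> (forall x, 0 <= phi x) ->
  \int[leb]_x (phi x * age_total (r t) x) = moment cp (alive beta t) phi.
Proof.
move=> t0 mphi phi0; rewrite (moment_alive_total t mcp cp0 mphi phi0).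
apply: ae_eq_integral => //.
- by apply: emeasurable_funM => //; exact: measurable_age_total.
- by apply: emeasurable_funM => //; exact: measurable_alive_total.
- apply: (@filterS _ _ (ae_filter_ringOfSetsType _) _ _ _ (age_total_ae t0)).
  by move=> x /= -> _.
Qed.

Lemma integral_abs_age_total t (phi : E -> R) : (0 <= t)%R ->
  measurable_fun setT phi ->
  \int[leb]_x `|(phi x)%:E * age_total (r t) x| =
  moment cp (alive beta t) (fun x => `|phi x|%:E).
Proof.
move=> t0 mphi.
have ma : measurable_fun setT (fun x => `|phi x|%:E).
  by apply/measurable_EFinP; exact: measurableT_comp.
rewrite (moment_alive_total t mcp cp0 ma) ?lee_fin//.
apply: ae_eq_integral => //.
- apply: measurableT_comp => //; apply: emeasurable_funM; first exact/measurable_EFinP.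
  exact: measurable_age_total.
- by apply: emeasurable_funM => //; exact: measurable_alive_total.
- apply: (@filterS _ _ (ae_filter_ringOfSetsType _) _ _ _ (age_total_ae t0)).
  by move=> x /= -> _; rewrite abseM [X in _ * X]gee0_abs// alive_total_ge0.
Qed.

Lemma integral_age_total t (phi : E -> R) : (0 <= t)%R -> measurable_fun setT phi ->
  \int[leb]_x ((phi x)%:E * age_total (r t) x) =
  moment cp (alive beta t) (fun x => (Num.max (phi x) 0%R)%:E) -
  moment cp (alive beta t) (fun x => (Num.max (- phi x)%R 0%R)%:E).
Proof.
move=> t0 mphi.
have mphiE : measurable_fun setT (fun x => (phi x)%:E) by exact/measurable_EFinP.
have mpos : measurable_fun setT (fun x => (Num.max (phi x) 0%R)%:E).
  by apply/measurable_EFinP; exact: measurable_maxr.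
have mneg : measurable_fun setT (fun x => (Num.max (- phi x)%R 0%R)%:E).
  by apply/measurable_EFinP; apply: measurable_maxr => //; exact: measurable_funN.
transitivity (\int[leb]_x ((phi x)%:E * alive_total cp t x)).
  apply: ae_eq_integral => //.
  - by apply: emeasurable_funM => //; exact: measurable_age_total.
  - by apply: emeasurable_funM => //; exact: measurable_alive_total.
  - apply: (@filterS _ _ (ae_filter_ringOfSetsType _) _ _ _ (age_total_ae t0)).
    by move=> x /= -> _.
rewrite (moment_alive_total t mcp cp0 mpos); last first.
  by move=> x; rewrite lee_fin le_max lexx orbT.
rewrite (moment_alive_total t mcp cp0 mneg); last first.
  by move=> x; rewrite lee_fin le_max lexx orbT.
have max_mul (a : R) (b : \bar R) : 0 <= b -> maxe (a%:E * b) 0 = (Num.max a 0%R)%:E * b.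
  move=> b0; case: (leP a 0%R) => a0.
    by rewrite max_r ?mul0e// mule_le0_ge0.
  by rewrite max_l// mule_ge0 ?lee_fin// ltW.
rewrite integralE; congr (_ - _); apply: eq_integral => x _.
  by rewrite funeposE max_mul// alive_total_ge0.
by rewrite funenegE -mulNe -EFinN max_mul// alive_total_ge0.
Qed.

Lemma age_total_initial : age_total r0 = age_total (r 0%R).
Proof.
apply/funext => x; apply: eq_integral => a; rewrite inE/= in_itv/= andbT => a0.
rewrite (mild_characteristics r_sol x (lexx 0%R) (ltW a0)) (leNgt a 0%R) a0/= subr0.
by rewrite divff ?mulr1// gt_eqF// survival_gt0.
Qed.

Lemma renewal_density_alive_lty : moment cp (alive beta 0%R) (cst 1) < +oo.
Proof.
rewrite -(integral_ge0_age_total (lexx 0%R) (measurable_cst _) (fun=> lee01)).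
rewrite -age_total_initial; have /integrableP[mr roo] := r0_L1.
pose D := (`]0%R, +oo[%classic : set R) `*` [set: E].
have mD : measurable D by exact: measurableX.
suff -> : \int[leb]_x (cst 1 x * age_total r0 x) =
    \int[mu \x leb]_(p in D) `|(r0 p.1 p.2)%:E| by [].
have mrD : measurable_fun setT ((fun p : R * E => `|(r0 p.1 p.2)%:E|) \_ D).
  by apply/(measurable_restrictT _ mD); exact: measurableT_comp.
have rD0 p : 0 <= ((fun p : R * E => `|(r0 p.1 p.2)%:E|) \_ D) p.
  by rewrite patchE; case: ifP.
rewrite [RHS]integral_mkcond (fubini_tonelli2 (m1 := mu) (m2 := leb) _ mrD rD0).
apply: eq_integral => x _; rewrite mul1e /age_total integral_mkcond.
apply: eq_integral => a _; rewrite !patchE mem_setE in_itv/= andbT.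
have -> : ((a, x) \in D) = (0 < a)%R.
  apply/idP/idP; rewrite inE /D /=.
    by rewrite in_itv/= andbT => -[].
  by move=> a0; split => //=; rewrite in_itv/= a0.
by case: ifP => // a0 /=; rewrite ger0_norm// r0_ge0.
Qed.

End age_structured_solution.

(** * Partial fractions of the cosecant *)

Section cosecant_series.
Context {R : realType}.
Implicit Types (x t : R) (n : nat).

(** The classical Dirichlet kernel, [1 + 2 cos t + ... + 2 cos (n t)]. *)
Fixpoint dirichlet_kernel n t : R :=
  if n is k.+1 then dirichlet_kernel k t + 2 * cos (k.+1%:R * t) else 1.

(** A sum and not a mean: [n] times the usual Fejer kernel. *)
Fixpoint fejer_kernel n t : R :=
  if n is k.+1 then fejer_kernel k t + dirichlet_kernel k t else 0.

Lemma sin_dirichlet_kernel n t :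
  sin (t / 2) * dirichlet_kernel n t = sin (n%:R * t + t / 2).
Proof.
elim: n => [|n IH]; first by rewrite /= mulr1 mul0r add0r.
rewrite [LHS]/= mulrDr IH.
have -> : n%:R * t + t / 2 = n.+1%:R * t - t / 2 by rewrite -natr1; field.
by move: (n.+1%:R * t) => u; rewrite sinB sinD; ring.
Qed.

Lemma sin_fejer_kernel n t :
  2 * sin (t / 2) ^+ 2 * fejer_kernel n t = 1 - cos (n%:R * t).
Proof.
elim: n => [|n IH]; first by rewrite /= mulr0 mul0r cos0 subrr.
rewrite [LHS]/= mulrDr IH.
have -> : 2 * sin (t / 2) ^+ 2 * dirichlet_kernel n t =
    2 * sin (t / 2) * sin (n%:R * t + t / 2) by rewrite -sin_dirichlet_kernel; ring.
have -> : n.+1%:R * t = (n%:R * t + t / 2) + t / 2 by rewrite -natr1; field.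
have -> : cos (n%:R * t) = cos ((n%:R * t + t / 2) - t / 2) by congr cos; ring.
by move: (n%:R * t + t / 2) => u; rewrite cosB cosD; ring.
Qed.

(* The partial sums of the Mittag-Leffler expansion of [pi / sin (pi * x)]. *)
Fixpoint cosecant_sum x n : R :=
  if n is k.+1 then cosecant_sum x k +
    (-1) ^+ k.+1 * ((x + k.+1%:R)^-1 + (x - k.+1%:R)^-1) else x^-1.

(** A primitive of [1 - cos (x t)] times the Dirichlet kernel, obtained from the product formula for
    cosines. The 1 is there to make the factor vanish at [t = 0], where the kernels concentrate. *)
Fixpoint dirichlet_primitive x n t : R :=
  if n is k.+1 then dirichlet_primitive x k t +
    2 * (sin (k.+1%:R * t) / k.+1%:R) -
    (sin ((x + k.+1%:R) * t) / (x + k.+1%:R) + sin ((x - k.+1%:R) * t) / (x - k.+1%:R))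
  else t - sin (x * t) / x.

Fixpoint fejer_primitive x n t : R :=
  if n is k.+1 then fejer_primitive x k t + dirichlet_primitive x k t else 0.

Lemma is_derive_sin_scale (a : R) t : a != 0 ->
  is_derive t 1 (fun t => sin (a * t) / a) (cos (a * t)).
Proof.
move=> a0; apply: is_derive_eq.
by rewrite /GRing.scale/=; field.
Qed.

Lemma is_derive_dirichlet_primitive x n t : 0 < x < 1 ->
  is_derive t 1 (dirichlet_primitive x n) ((1 - cos (x * t)) * dirichlet_kernel n t).
Proof.
move=> /andP[x0 x1]; elim: n => [|n IH].
  have ? := is_derive_sin_scale t (lt0r_neq0 x0).
  by apply: is_derive_eq; rewrite /= mulr1.
have n0 : n.+1%:R != 0 :> R by rewrite pnatr_eq0.
have n1 : 1 <= n.+1%:R :> R by rewrite ler1n.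
have p0 : x + n.+1%:R != 0 by apply: lt0r_neq0; lra.
have m0 : x - n.+1%:R != 0 by apply: ltr0_neq0; lra.
have ? := is_derive_sin_scale t n0.
have ? := is_derive_sin_scale t p0.
have ? := is_derive_sin_scale t m0.
apply: is_derive_eq => /=.
have eD : cos ((x + n.+1%:R) * t) =
    cos (x * t) * cos (n.+1%:R * t) - sin (x * t) * sin (n.+1%:R * t).
  by rewrite mulrDl cosD.
have eB : cos ((x - n.+1%:R) * t) =
    cos (x * t) * cos (n.+1%:R * t) + sin (x * t) * sin (n.+1%:R * t).
  by rewrite mulrBl cosB.
by rewrite /GRing.scale/= eD eB; ring.
Qed.

Lemma is_derive_fejer_primitive x n t : 0 < x < 1 ->
  is_derive t 1 (fejer_primitive x n) ((1 - cos (x * t)) * fejer_kernel n t).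
Proof.
move=> x01; elim: n => [|n IH].
  by rewrite /= mulr0; exact: is_derive_cst.
have ? := is_derive_dirichlet_primitive n t x01.
by apply: is_derive_eq; rewrite /= mulrDr.
Qed.

Lemma sinDnpi (a : R) n : sin (a + n%:R * pi) = (-1) ^+ n * sin a.
Proof.
elim: n => [|n IH]; first by rewrite mul0r addr0 expr0 mul1r.
by rewrite -natr1 mulrDl mul1r addrA sinDpi IH exprS; ring.
Qed.

Lemma sinBnpi (a : R) n : sin (a - n%:R * pi) = (-1) ^+ n * sin a.
Proof.
rewrite -[in RHS](subrK (n%:R * pi) a) sinDnpi mulrA -expr2 -exprM mulnC exprM.
by rewrite sqrrN expr1n expr1n mul1r.
Qed.

(** At [pi] the terms [sin (k t)] vanish, and [sin ((x + k) pi)] and [sin ((x - k) pi)] both equal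
    [sin (pi x)] up to the sign [(-1)^k]. *)
Lemma dirichlet_primitive_pi x n :
  dirichlet_primitive x n pi = pi - sin (pi * x) * cosecant_sum x n.
Proof.
elim: n => [|n IH] /=; first by rewrite [x * pi]mulrC.
have s0 : sin (n.+1%:R * pi) = 0 :> R.
  by rewrite -[n.+1%:R * pi]add0r sinDnpi sin0 mulr0.
have sD : sin ((x + n.+1%:R) * pi) = (-1) ^+ n.+1 * sin (pi * x).
  by rewrite mulrDl sinDnpi mulrC [x * pi]mulrC mulrC.
have sB : sin ((x - n.+1%:R) * pi) = (-1) ^+ n.+1 * sin (pi * x).
  by rewrite mulrBl sinBnpi [x * pi]mulrC.
by rewrite IH s0 sD sB; ring.
Qed.

Lemma dirichlet_primitive0 x n : dirichlet_primitive x n 0 = 0.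
Proof.
elim: n => [|n IH] /=; first by rewrite mulr0 sin0 mul0r subrr.
by rewrite IH !mulr0 sin0 !mul0r mulr0 !addr0 subrr.
Qed.

Lemma fejer_primitive_pi x n : fejer_primitive x n pi =
  n%:R * pi - sin (pi * x) * \sum_(j < n) cosecant_sum x j.
Proof.
elim: n => [|n IH]; first by rewrite /= big_ord0 mul0r mulr0 subrr.
by rewrite big_ord_recr/= IH dirichlet_primitive_pi -natr1; ring.
Qed.

Lemma fejer_primitive0 x n : fejer_primitive x n 0 = 0.
Proof. by elim: n => [//|n IH] /=; rewrite IH dirichlet_primitive0 addr0. Qed.

(* [1 - cos (x t) <= 2 sin^2 (t / 2)], which cancels the singularity of the
   Fejer kernel. *)
Lemma fejer_kernel_bound x n t : 0 < x < 1 -> 0 < t < pi ->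
  `|(1 - cos (x * t)) * fejer_kernel n t| <= 2.
Proof.
move=> /andP[x0 x1] /andP[t0 tpi].
have -> : 1 - cos (x * t) = 2 * sin (x * t / 2) ^+ 2.
  rewrite {1}(_ : x * t = x * t / 2 + x * t / 2); last by field.
  by rewrite cosD -!expr2 cos2sin2; ring.
have xt : x * t < t by rewrite gtr_pMl.
have xt0 : 0 < x * t by rewrite mulr_gt0.
have s0 : 0 <= sin (x * t / 2) by apply: sin_ge0_pi; lra.
have s1 : sin (x * t / 2) <= sin (t / 2).
  by apply: ltW; rewrite ltr_sin ?in_itv/=; lra.
have st : 0 < sin (t / 2) by apply: sin_gt0_pi; lra.
have := sin_fejer_kernel n t; set F := fejer_kernel n t => FE.
have cb : 0 <= 1 - cos (n%:R * t) <= 2.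
  by rewrite subr_ge0 cos_le1/=; have := cos_geN1 (n%:R * t); lra.
have F0 : 0 <= F.
  have : 0 <= 2 * sin (t / 2) ^+ 2 * F by rewrite FE; case/andP : cb.
  by rewrite pmulr_rge0// mulr_gt0// exprn_gt0.
rewrite ger0_norm; last by rewrite !mulr_ge0// exprn_ge0.
apply: (@le_trans _ _ (2 * sin (t / 2) ^+ 2 * F)); last by rewrite FE; case/andP : cb.
rewrite ler_wpM2r// ler_wpM2l// ler_sqr// nnegrE// ltW//.
Qed.

(** The mean value theorem on [[0, pi]] with the bound 2 on the derivative. Uniformity in [n] makes
    the error vanish after division by [n]. *)
Lemma cosecant_sum_mean x n : 0 < x < 1 ->
  `|n%:R * pi - sin (pi * x) * \sum_(j < n) cosecant_sum x j| <= 2 * pi.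
Proof.
move=> x01; rewrite -fejer_primitive_pi -[X in `|X|]subr0 -(fejer_primitive0 x n).
have [||c] := @MVT R (fejer_primitive x n)
  (fun t => (1 - cos (x * t)) * fejer_kernel n t) 0 pi (pi_gt0 R).
- by move=> t _; exact: is_derive_fejer_primitive.
- apply: continuous_subspaceT => t.
  apply: differentiable_continuous; apply/derivable1_diffP.
  by have [] := is_derive_fejer_primitive n t x01.
rewrite in_itv/= => c0 ->; rewrite subr0 normrM (gtr0_norm (pi_gt0 R)).
by rewrite ler_wpM2r ?pi_ge0// fejer_kernel_bound.
Qed.

(** A convergent sequence has the same limit as its Cesaro means, and those are known by
    [cosecant_sum_mean]. Convergence itself will come from the Beta integral. *)
Lemma cosecant_sum_cvg x l : 0 < x < 1 ->
  cosecant_sum x n @[n --> \oo] --> l -> sin (pi * x) * l = pi.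
Proof.
move=> x01 /cesaro cl.
have : sin (pi * x) * arithmetic_mean (cosecant_sum x) n @[n --> \oo] --> sin (pi * x) * l.
  by apply: cvgMr.
have : sin (pi * x) * arithmetic_mean (cosecant_sum x) n @[n --> \oo] --> pi.
  apply/cvgrPdist_le => e e0; near=> n.
  have := cosecant_sum_mean n.+1 x01.
  rewrite /arithmetic_mean/= seriesEord/= => H.
  have n0 : 0 < n.+1%:R :> R by rewrite ltr0n.
  rewrite -(ler_pM2l n0) -{1}(gtr0_norm n0) -normrM.
  have -> : n.+1%:R * (pi - sin (pi * x) * (n.+1%:R^-1 * \sum_(k < n.+1) cosecant_sum x k)) =
    n.+1%:R * pi - sin (pi * x) * \sum_(k < n.+1) cosecant_sum x k.
    by rewrite mulrBr [_ * (sin _ * _)]mulrCA mulVKf// pnatr_eq0.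
  apply: (le_trans H).
  rewrite -ler_pdivrMr//; apply: (le_trans (ltW (archi_boundP _))).
    by rewrite divr_ge0 ?mulr_ge0 ?pi_ge0// ltW.
  rewrite ler_nat; apply: leqW; near: n; exact: nbhs_infty_ge.
move=> h1 h2; apply/esym; exact: (cvg_unique _ h1 h2).
Unshelve. all: by end_near. Qed.

End cosecant_series.

(** * Euler's Beta integral *)

Section improper_integrals.
Context {R : realType}.
Local Notation mu := (@lebesgue_measure R).

Lemma ge0_integral_FTC_oc (f F : R -> R) (a b l : R) : a < b ->
  (forall x, a < x <= b -> 0 <= f x) ->
  (forall x, a < x <= b -> {for x, continuous f}) ->
  (forall x, a < x <= b -> is_derive x 1 F (f x)) ->
  F x @[x --> a^'+] --> l ->
  (\int[mu]_(x in `]a, b]) (f x)%:E = (F b - l)%:E)%E.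
Proof.
move=> ab f0 cf dF Fl.
(* Starting at the midpoint keeps every [u n] inside the interval while it decreases to [a]. *)
pose u n := a + (b - a) / 2 * harmonic n.
have ba0 : 0 < (b - a) / 2 by rewrite divr_gt0// subr_gt0.
have u_gt n : a < u n by rewrite ltrDl mulr_gt0// harmonic_gt0.
have u_lt n : u n < b.
  have : harmonic n <= 1 :> R by rewrite /= invf_le1// ler1n.
  have := harmonic_gt0 n; rewrite /u; set h : R := harmonic n => h0 h1.
  have : (b - a) / 2 * h <= (b - a) / 2 by rewrite ler_piMr// ltW.
  by lra.
have u_dec m n : (m <= n)%N -> u n <= u m.
  move=> mn; rewrite lerD2l ler_wpM2l ?(ltW ba0)//.
  by rewrite /= lef_pV2 ?posrE// ler_nat ltnS.
have cvu : u n @[n --> \oo] --> a.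
  rewrite -[X in _ --> X]addr0; apply: cvgD; first exact: cvg_cst.
  rewrite -[X in _ --> X](mulr0 ((b - a) / 2)); apply: cvgMr.
  exact: cvg_harmonic.
have Fu : F (u n) @[n --> \oo] --> l by move/cvg_at_rightP : Fl; apply.
have in_itv' n x : x \in `[u n, b] -> a < x <= b.
  by rewrite in_itv/= => /andP[ux ->]; rewrite (lt_le_trans (u_gt n)).
have cF x : a < x <= b -> {for x, continuous F}.
  move=> /dF dFx; apply: differentiable_continuous; apply/derivable1_diffP.
  by have [] := dFx.
have In n : (\int[mu]_(x in `[u n, b]) (f x)%:E = (F b - F (u n))%:E)%E.
  rewrite (@continuous_FTC2 _ f F)//.
  - apply: continuous_in_subspaceT => x; rewrite inE/= => /in_itv' xab.
    exact: cf.
  - split.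
    + move=> x xub; have /dF[] // : a < x <= b.
      by apply: (in_itv' n); move: xub; apply: subset_itv_oo_cc.
    + apply: cvg_at_right_filter; apply: cF.
      by rewrite u_gt ltW.
    + by apply: cvg_at_left_filter; apply: cF; rewrite ab lexx.
  - move=> x xub; rewrite derive1E; have /dF[] // : a < x <= b.
    by apply: (in_itv' n); move: xub; apply: subset_itv_oo_cc.
have UE : `]a, b]%classic = \bigcup_n `[u n, b]%classic.
  rewrite eqEsubset; split => x.
    rewrite /= in_itv/= => /andP[ax xb].
    have /cvgrPdist_lt/(_ (x - a)) := cvu; rewrite subr_gt0 => /(_ ax)[n _ /(_ n)].
    rewrite /= leqnn => /(_ isT); rewrite ltr0_norm; last by rewrite subr_lt0.
    by rewrite opprB ltrD2r => /ltW un; exists n => //=; rewrite in_itv/= un xb.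
  by move=> [n _] /= /in_itv'; rewrite in_itv.
have mf n : measurable_fun `[u n, b] (EFin \o f).
  apply/measurable_EFinP; apply: subspace_continuous_measurable_fun => //.
  apply: continuous_in_subspaceT => x; rewrite inE/= => /in_itv' xab.
  exact: cf.
have H : (\int[mu]_(x in `[u n, b]) (EFin \o f) x)%E @[n --> \oo] -->
    (\int[mu]_(x in `]a, b]) (EFin \o f) x)%E.
  rewrite UE; apply: ge0_nondecreasing_set_cvg_integral.
  - move=> m n mn; rewrite subsetEset; apply: subset_itvr.
    by rewrite bnd_simp u_dec.
  - by [].
  - exact: mf.
  - by move=> n x /= /in_itv' xab; rewrite lee_fin f0.
have e : (fun n => \int[mu]_(x in `[u n, b]) (EFin \o f) x)%E =
    fun n => (F b - F (u n))%:E by apply/funext => n; exact: In.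
rewrite e in H.
have H' : (F b - F (u n))%:E @[n --> \oo] --> (F b - l)%:E.
  by apply: cvg_EFin; [exact: nearW|apply: cvgB; [exact: cvg_cst|exact: Fu]].
exact: (cvg_unique _ H H').
Qed.

Lemma integral_powR (c t : R) : 0 < c -> 0 < t ->
  (\int[mu]_(x in `]0%R, t]) (x `^ (c - 1))%:E = (t `^ c / c)%:E)%E.
Proof.
move=> c0 t0.
rewrite -[t `^ c / c]subr0.
apply: (ge0_integral_FTC_oc (f := fun x => x `^ (c - 1)) (F := fun x => x `^ c / c)) => //.
- by move=> x _; exact: powR_ge0.
- move=> x /andP[x0 _]; apply: differentiable_continuous; apply/derivable1_diffP.
  by apply: derivable_powR; rewrite in_itv/= x0.
- move=> x /andP[x0 _].
  have ? := is_derive1_powR c x0.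
  apply: is_derive_eq; rewrite /GRing.scale/=; field.
  exact: lt0r_neq0.
- rewrite -[X in _ --> X](mul0r c^-1); apply: cvgMl; exact: powR_cvg0.
Qed.

End improper_integrals.

Section euler_beta.
Context {R : realType}.
Local Notation mu := (@lebesgue_measure R).
Implicit Types (a b c t v x : R) (n : nat).

Definition beta_integrand a b t v : R :=
  if 0 < v < t then v `^ (a - 1) * (t - v) `^ (b - 1) else 0.

Definition euler_beta a b : \bar R := (\int[mu]_v (beta_integrand a b 1 v)%:E)%E.

Lemma beta_integrand_ge0 a b t v : 0 <= beta_integrand a b t v.
Proof. by rewrite /beta_integrand; case: ifP => // _; rewrite mulr_ge0 ?powR_ge0. Qed.

Lemma measurable_beta_integrand a b t : measurable_fun setT (beta_integrand a b t).
Proof.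
apply: measurable_fun_ifT; last exact: measurable_cst.
  by apply: measurable_and; exact: measurable_fun_ltr.
apply: measurable_funM; first exact: measurable_powR.
have mt : measurable_fun setT (fun v : R => t - v) by exact: measurable_funB.
exact: (measurableT_comp (measurable_powR (b - 1)) mt).
Qed.

(** For [a + b = 1] the power of [t] disappears: the convolution of [t^(a - 1)] with [t^(- a)] is
    constant. *)
Lemma euler_beta_scale a b t : 0 < t ->
  (\int[mu]_v (beta_integrand a b t v)%:E = (t `^ (a + b - 1))%:E * euler_beta a b)%E.
Proof.
move=> t0.
have mE c : measurable_fun setT (fun v => (beta_integrand a b c v)%:E).
  by apply/measurable_EFinP; exact: measurable_beta_integrand.
have := @ge0_integral_scale R (fun v => (beta_integrand a b t v)%:E) t t0 (mE t).
move=> /(_ (fun v => _)) H.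
have scaleE v : beta_integrand a b t (t * v) =
    t `^ (a - 1) * t `^ (b - 1) * beta_integrand a b 1 v.
  rewrite /beta_integrand pmulr_rgt0// gtr_pMr//.
  case: ifP => [/andP[v0 v1]|]; last by rewrite mulr0.
  rewrite powRM ?(ltW t0) ?(ltW v0)// -[X in X - t * v]mulr1 -mulrBr.
  by rewrite powRM ?(ltW t0) ?subr_ge0 ?(ltW v1)//; ring.
have e2 : (\int[mu]_v (beta_integrand a b t (t * v)%R)%:E =
    (t^-1)%:E * \int[mu]_v (beta_integrand a b t v)%:E)%E.
  by apply: H => v; rewrite lee_fin beta_integrand_ge0.
pose k := t `^ (a - 1) * t `^ (b - 1).
have e1 : (\int[mu]_v (beta_integrand a b t (t * v)%R)%:E = k%:E * euler_beta a b)%E.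
  rewrite /euler_beta -[RHS](ge0_integralZl mu measurableT (mE 1)).
  - by apply: eq_integral => v _; rewrite scaleE EFinM.
  - by move=> v _; rewrite lee_fin beta_integrand_ge0.
  - by rewrite lee_fin mulr_ge0 ?powR_ge0.
have -> : t `^ (a + b - 1) = t * k.
  have powD r s : t `^ (r + s) = t `^ r * t `^ s by rewrite powRD// (lt0r_neq0 t0) implybT.
  by rewrite -[X in X * k](powRr1 (ltW t0)) /k -!powD; congr (_ `^ _); ring.
rewrite EFinM -muleA; apply: (etrans _ (congr1 (fun y => t%:E * y)%E (etrans (esym e2) e1))).
by rewrite muleA -EFinM divff ?mul1e// gt_eqF.
Qed.

Definition half_beta a : \bar R :=
  (\int[mu]_(u in `]0%R, (1 / 2)%R]) (u `^ (- a) * (1 - u) `^ (a - 1))%R%:E)%E.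

(* With v = u / (1 - u) the integrand of [half_beta a] is
   v^(-a) / (1 + v) dv, and 1 / (1 + v) is expanded geometrically:
   [odds_rest a n] is the remainder v^(n - a) / (1 + v) dv. *)
Definition odds_rest a n : \bar R :=
  (\int[mu]_(u in `]0%R, (1 / 2)%R]) ((u / (1 - u)) `^ (n%:R - a) / (1 - u))%R%:E)%E.

Let odds_itv (u : R) : u \in `]0, 1/2]%classic -> 0 < u /\ u <= 1/2.
Proof. by rewrite inE/= in_itv/= => /andP[]. Qed.

Lemma odds_rest0 a : odds_rest a 0 = half_beta a.
Proof.
apply: eq_integral => u /odds_itv[u0 u1]; congr EFin.
have u2 : 0 < 1 - u by lra.
rewrite sub0r powRM ?(ltW u0) ?invr_ge0 ?(ltW u2)//.
rewrite -[(1 - u)^-1]powR_inv1 ?(ltW u2)// -powRrM mulN1r opprK -mulrA.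
by rewrite -powRD// (lt0r_neq0 u2) implybT.
Qed.

Let is_derive_continuous (f : R -> R) x (D : R) : is_derive x 1 f D ->
  {for x, continuous f}.
Proof.
by move=> [df _]; apply: differentiable_continuous; apply/derivable1_diffP.
Qed.

Let is_derive_odds (u : R) : u < 1 ->
  is_derive u 1 (fun u => u / (1 - u)) ((1 - u) ^- 2).
Proof.
move=> u1; have u0 : 1 - u != 0 by rewrite subr_eq0 gt_eqF.
have ? := @is_deriveV _ (fun u => 1 - u) u 1 _ u0 _.
apply: is_derive_eq; rewrite /GRing.scale/=.
by field.
Qed.

Let is_derive_odds_powR (c u : R) : 0 < u < 1 -> c != 0 ->
  is_derive u 1 (fun u => (u / (1 - u)) `^ c / c)
    ((u / (1 - u)) `^ (c - 1) * (1 - u) ^- 2).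
Proof.
move=> /andP[u0 u1] c0.
have v0 : 0 < u / (1 - u) by rewrite divr_gt0// subr_gt0.
have d1 := is_derive_odds u1.
have d2 := is_derive1_powR c v0.
have d3 := @is_derive1_comp _ (fun v : R => v `^ c) (fun u => u / (1 - u)) _ _ _ d2 d1.
have d4 := @is_deriveM _ _ _ _ _ _ _ _ d3 (is_derive_cst c^-1 u 1).
apply: (is_derive_eq d4); rewrite /GRing.scale/= mulr0 add0r; field.
by rewrite c0 subr_eq0 gt_eqF.
Qed.

Let continuous_odds_powR (c u : R) : 0 < u < 1 -> {for u, continuous (fun u : R => (u / (1 - u)) `^ c)}.
Proof.
move=> u01; have [->|c0] := eqVneq c 0.
  rewrite (_ : (fun u : R => (u / (1 - u)) `^ 0) = cst (1 : R)); first exact: cvg_cst.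
  by apply: funext => v; rewrite powRr0.
have /is_derive_continuous cu := is_derive_odds_powR u01 c0.
have -> : (fun u : R => (u / (1 - u)) `^ c) =
    (fun u : R => c * ((u / (1 - u)) `^ c / c)).
  by apply: funext => v; rewrite [RHS]mulrC divfK.
by apply: continuousM; [exact: cvg_cst|exact: cu].
Qed.

Let continuous_odds_term (c u : R) n : 0 < u < 1 ->
  {for u, continuous (fun u : R => (u / (1 - u)) `^ c * (1 - u) ^- n)}.
Proof.
move=> u01; apply: continuousM; first exact: continuous_odds_powR.
apply: continuousV; first by rewrite expf_neq0// subr_eq0 gt_eqF//; case/andP : u01.
have c1 : {for u, continuous (fun v : R => 1 - v)}.
  by apply: continuousB; [exact: cvg_cst|exact: cvg_id].
elim: n => [|n IH]; first exact: cvg_cst.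
have -> : (fun v : R => (1 - v) ^+ n.+1) = (fun v => (1 - v) * (1 - v) ^+ n).
  by apply: funext => v; rewrite exprS.
by apply: continuousM; [exact: c1|exact: IH].
Qed.

Let measurable_odds_term c n : measurable_fun (`]0%R, (1 / 2)%R]%classic : set R)
  (fun u : R => ((u / (1 - u)) `^ c * (1 - u) ^- n)%:E).
Proof.
apply/measurable_EFinP; apply: subspace_continuous_measurable_fun => //.
apply: continuous_in_subspaceT => x /odds_itv[x0 x1].
by apply: continuous_odds_term; lra.
Qed.

Lemma odds_rest_ge0 a n : (0 <= odds_rest a n)%E.
Proof.
apply: integral_ge0 => u /=; rewrite in_itv/= => /andP[u0 u1].
by rewrite lee_fin divr_ge0 ?powR_ge0//; lra.
Qed.

(** In the variable [v = u / (1 - u)] the two integrands add up to [v^(n - a)], to be integrated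
    over [0 < v <= 1], since [u = 1 / 2] corresponds to [v = 1]. *)
Lemma odds_restS a n : 0 < a < 1 ->
  (odds_rest a n + odds_rest a n.+1 = ((n.+1%:R - a)^-1)%:E)%E.
Proof.
move=> /andP[a0 a1].
pose c := n.+1%:R - a.
have n0 : 0 <= n%:R :> R by [].
have c0 : 0 < c by rewrite /c -natr1; lra.
rewrite -ge0_integralD//; last 4 first.
- move=> u /=; rewrite in_itv/= => /andP[u0 u1].
  by rewrite lee_fin divr_ge0 ?powR_ge0//; lra.
- exact: (measurable_odds_term (n%:R - a) 1).
- move=> u /=; rewrite in_itv/= => /andP[u0 u1].
  by rewrite lee_fin divr_ge0 ?powR_ge0//; lra.
- exact: (measurable_odds_term (n.+1%:R - a) 1).
transitivity (\int[mu]_(u in `]0%R, (1 / 2)%R])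
    ((u / (1 - u)) `^ (c - 1) * (1 - u) ^- 2)%:E)%E.
  apply: eq_integral => u /odds_itv[u0 u1]; rewrite -EFinD; congr EFin.
  have v0 : 0 < u / (1 - u) by rewrite divr_gt0//; lra.
  have -> : n.+1%:R - a = (c - 1) + 1 by rewrite /c; ring.
  have -> : n%:R - a = c - 1 by rewrite /c -natr1; ring.
  rewrite [_ `^ (c - 1 + 1)]powRD ?(lt0r_neq0 v0) ?implybT// powRr1 ?(ltW v0)//.
  by field; rewrite subr_eq0 gt_eqF//; lra.
have -> : (n.+1%:R - a)^-1 = (1 / 2 / (1 - 1 / 2)) `^ c / c - 0.
  have -> : 1 / 2 / (1 - 1 / 2) = 1 :> R by field.
  by rewrite powR1 subr0 mul1r.
apply: (ge0_integral_FTC_oc (f := fun u => (u / (1 - u)) `^ (c - 1) * (1 - u) ^- 2)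
  (F := fun u => (u / (1 - u)) `^ c / c)).
- by lra.
- by move=> x /andP[x0 x1]; rewrite mulr_ge0 ?powR_ge0// invr_ge0 exprn_ge0//; lra.
- by move=> x /andP[x0 x1]; apply: continuous_odds_term; lra.
- by move=> x /andP[x0 x1]; apply: is_derive_odds_powR; [lra|exact: lt0r_neq0].
(* The limit at 0, from [u / (1 - u) <= 2 u] for [u < 1 / 2]. *)
- apply: (@squeeze_cvgr _ _ _ _ (fun=> 0) (fun u => 2 `^ c * u `^ c / c)).
  + near=> u; have u0 : 0 < u by [].
    have u1 : u < 1 / 2 by near: u; apply: nbhs_right_lt; lra.
    have v0 : 0 < u / (1 - u) by rewrite divr_gt0//; lra.
    rewrite divr_ge0 ?powR_ge0 ?(ltW c0)//= ler_pM2r ?invr_gt0//.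
    rewrite -powRM ?(ltW u0)//; apply: ge0_ler_powR; rewrite ?nnegrE ?(ltW c0) ?(ltW v0)//.
      by rewrite mulr_ge0// ltW.
    by rewrite ler_pdivrMr; nra.
  + exact: cvg_cst.
  + rewrite -[X in _ --> X](mul0r c^-1); apply: cvgMl.
    rewrite -[X in _ --> X](mulr0 (2 `^ c)); apply: cvgMr; exact: powR_cvg0.
Unshelve. all: by end_near. Qed.

Lemma odds_rest_fin a n : 0 < a < 1 -> odds_rest a n \is a fin_num.
Proof.
move=> /(odds_restS n); have := odds_rest_ge0 a n; have := odds_rest_ge0 a n.+1.
by case: (odds_rest a n) => // ; case: (odds_rest a n.+1).
Qed.

(** Iterating [odds_restS] leaves the signed remainder [odds_rest a n], which is at most its sum
    with the next, nonnegative, remainder. *)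
Lemma half_beta_series a n : 0 < a < 1 ->
  `|fine (half_beta a) - \sum_(k < n) (-1) ^+ k / (k.+1%:R - a)| <= (n.+1%:R - a)^-1.
Proof.
move=> a01; pose I n := fine (odds_rest a n).
have IS k : I k = (k.+1%:R - a)^-1 - I k.+1.
  have := odds_restS k a01.
  rewrite -(fineK (odds_rest_fin k a01)) -(fineK (odds_rest_fin k.+1 a01)) => -[e].
  by rewrite -e addrK.
have I0 k : 0 <= I k by exact: fine_ge0 (odds_rest_ge0 a k).
have -> : fine (half_beta a) - \sum_(k < n) (-1) ^+ k / (k.+1%:R - a) = (-1) ^+ n * I n.
  rewrite -odds_rest0 -/(I 0%N); elim: n => [|n IH]; first by rewrite big_ord0 subr0 mul1r.
  by rewrite big_ord_recr/= opprD addrA IH IS exprS; ring.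
rewrite normrM normrX normrN1 expr1n mul1r ger0_norm//.
by rewrite IS gerBl.
Qed.

Let powR_half_le (b x : R) : 0 < b -> b < 1 -> 1 / 2 <= x < 1 -> x `^ (b - 1) <= 2.
Proof.
move=> b0 b1 /andP[x0 x1]; rewrite -opprB powRN.
have xx : x <= x `^ (1 - b) by apply: ger1_powR; lra.
rewrite -[leRHS]invrK lef_pV2 ?posrE//; lra.
Qed.

Let integral_powR_itv c : 0 < c ->
  (\int[mu]_v (if (0 < v <= 1)%R then v `^ (c - 1) else 0)%:E = (c^-1)%:E)%E.
Proof.
move=> c0; have -> : c^-1 = 1 `^ c / c by rewrite powR1 mul1r.
rewrite -(integral_powR c0 ltr01).
rewrite [RHS]integral_mkcond; apply: eq_integral => v _.
by rewrite patchE mem_setE in_itv/=; case: ifP.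
Qed.

(** On each half of []0, 1[] the factor whose singularity lies at the far end is at most 2, and the
    other one is an integrable power. *)
Lemma euler_beta_lty a b : 0 < a < 1 -> 0 < b < 1 -> (euler_beta a b < +oo)%E.
Proof.
move=> /andP[a0 a1] /andP[b0 b1].
pose g c v : R := if 0 < v <= 1 then v `^ (c - 1) else 0.
have g0 c v : 0 <= g c v by rewrite /g; case: ifP => // _; exact: powR_ge0.
have mg c : measurable_fun setT (g c).
  apply: measurable_fun_ifT; last exact: measurable_cst.
    by apply: measurable_and; [exact: measurable_fun_ltr|exact: measurable_fun_ler].
  exact: measurable_powR.
have mg1 c : measurable_fun setT (fun v : R => g c (1 - v)).
  have mr : measurable_fun setT (fun v : R => 1 - v) by exact: measurable_funB.
  exact: (measurableT_comp (mg c) mr).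
have mgE c : measurable_fun setT (fun v : R => 2%:E * (g c v)%:E)%E.
  apply: emeasurable_funM; first exact: measurable_cst.
  by apply/measurable_EFinP; exact: mg.
have mgE1 c : measurable_fun setT (fun v : R => 2%:E * (g c (1 - v)%R)%:E)%E.
  apply: emeasurable_funM; first exact: measurable_cst.
  by apply/measurable_EFinP; exact: mg1.
have bound v : beta_integrand a b 1 v <= 2 * g a v + 2 * g b (1 - v).
  rewrite /beta_integrand; case: ifPn => [/andP[v0 v1]|_].
    have -> : g a v = v `^ (a - 1) by rewrite /g v0 ltW.
    have -> : g b (1 - v) = (1 - v) `^ (b - 1).
      by rewrite /g subr_gt0 v1/= gerBl ltW.
    have := powR_ge0 v (a - 1); have := powR_ge0 (1 - v) (b - 1).
    have [vh|vh] := leP v (1 / 2).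
      have : (1 - v) `^ (b - 1) <= 2 by apply: powR_half_le => //; lra.
      by nra.
    have : v `^ (a - 1) <= 2 by apply: powR_half_le => //; lra.
    by nra.
  by rewrite addr_ge0// mulr_ge0.
apply: (@le_lt_trans _ _ (\int[mu]_v (2%:E * (g a v)%:E + 2%:E * (g b (1 - v)%R)%:E))%E).
  apply: ge0_le_integral => //.
  - by move=> v _; rewrite lee_fin beta_integrand_ge0.
  - by apply/measurable_EFinP; exact: measurable_beta_integrand.
  - by apply: emeasurable_funD; [exact: mgE|exact: mgE1].
  - by move=> v _; rewrite -!EFinM -EFinD lee_fin.
rewrite ge0_integralD//; last 4 first.
- by move=> v _; rewrite -EFinM lee_fin mulr_ge0.
- exact: mgE.
- by move=> v _; rewrite -EFinM lee_fin mulr_ge0.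
- exact: mgE1.
have gE c : (forall v, 0 <= (g c v)%:E)%E by move=> v; rewrite lee_fin.
rewrite ge0_integralZl//; last by apply/measurable_EFinP; exact: mg.
rewrite ge0_integralZl//; last by apply/measurable_EFinP; exact: mg1.
have e1 : (\int[mu]_v (g b (1 - v)%R)%:E = \int[mu]_v (g b v)%:E)%E.
  apply: (@ge0_integral_reflect R (fun v => (g b v)%:E) 1) => //.
  by apply/measurable_EFinP; exact: mg.
by rewrite e1 (integral_powR_itv a0) (integral_powR_itv b0) -!EFinM -EFinD ltry.
Qed.

(** The integral is cut at 1/2 and its right half reflected, which exchanges the two exponents. *)
Lemma euler_beta_half a : euler_beta a (1 - a) = (half_beta (1 - a) + half_beta a)%E.
Proof.
pose f := beta_integrand a (1 - a) 1.
have mf := measurable_beta_integrand a (1 - a) 1.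
pose f1 (v : R) := if v <= 1 / 2 then f v else 0.
pose f2 (v : R) := if v <= 1 / 2 then 0 else f v.
have mf1 : measurable_fun setT f1.
  by apply: measurable_fun_ifT => //; exact: measurable_fun_ler.
have mf2 : measurable_fun setT f2.
  by apply: measurable_fun_ifT => //; exact: measurable_fun_ler.
have f10 v : 0 <= f1 v by rewrite /f1; case: ifP => // _; exact: beta_integrand_ge0.
have f20 v : 0 <= f2 v by rewrite /f2; case: ifP => // _; exact: beta_integrand_ge0.
transitivity (\int[mu]_v ((f1 v)%:E + (f2 v)%:E))%E.
  apply: eq_integral => v _; rewrite -EFinD /f1 /f2; congr EFin.
  by case: ifP => _; rewrite ?addr0 ?add0r.
rewrite ge0_integralD//; last 4 first.
- by move=> v _; rewrite lee_fin.
- by apply/measurable_EFinP.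
- by move=> v _; rewrite lee_fin.
- by apply/measurable_EFinP.
congr (_ + _)%E.
  rewrite /half_beta [RHS]integral_mkcond; apply: eq_integral => v _.
  rewrite patchE mem_setE in_itv/= /f1 /f /beta_integrand.
  have [v0|v0] := ltP 0 v; last by rewrite /= if_same.
  have [vh|//] := leP v (1 / 2); rewrite ifT; last by lra.
  by rewrite opprB.
rewrite -(@ge0_integral_reflect R (fun v => (f2 v)%:E) 1)//; last exact/measurable_EFinP.
(* The cut gives the point 1/2 to the left half, so the reflected right half lives on an interval
   open at 1/2. *)
rewrite /half_beta -integral_itv_bndo_bndc; last first.
  apply/measurable_EFinP; apply: measurable_funTS.
  have mr : measurable_fun setT (fun v : R => 1 - v) by exact: measurable_funB.
  by apply: measurable_funM; [exact: measurable_powR|exact: (measurableT_comp (measurable_powR _) mr)].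
rewrite [RHS]integral_mkcond; apply: eq_integral => v _.
rewrite patchE mem_setE in_itv/= /f2 /f /beta_integrand subr_gt0 gtrBl.
rewrite lerBlDr.
have -> : (1 <= 1 / 2 + v) = ~~ (v < 1 / 2) by rewrite -leNgt; apply/idP/idP; lra.
have [vh|vh] := ltP v (1 / 2); rewrite ?andbF//= andbT.
have -> : v < 1 by lra.
rewrite /=; case: ifP => // _; congr EFin.
by rewrite mulrC subKr; congr (_ `^ _ * _); ring.
Qed.

Lemma half_beta_fin a : 0 < a < 1 -> half_beta a \is a fin_num.
Proof. by rewrite -odds_rest0; exact: odds_rest_fin. Qed.

(** The poles at the positive integers form the first sum, those at 0 and at the negative integers
    the second, whence its additional term. *)
Lemma cosecant_sumE a n : cosecant_sum a n =
  \sum_(k < n) (-1) ^+ k / (k.+1%:R - a) + \sum_(k < n.+1) (-1) ^+ k / (k.+1%:R - (1 - a)).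
Proof.
elim: n => [|n IH].
  by rewrite big_ord0 big_ord_recr big_ord0/= !add0r mul1r opprB addrC subrK.
rewrite big_ord_recr [in X in _ + X]big_ord_recr /= IH.
have -> : (n.+2%:R - (1 - a)) = a + n.+1%:R by rewrite -[n.+2%:R]natr1; ring.
have -> : (n.+1%:R - a)^-1 = - (a - n.+1%:R)^-1 by rewrite -invrN opprB.
by rewrite exprS; ring.
Qed.

(** The alternating series show that the partial fractions converge to the Beta integral; the Fejer
    argument gives the value of that limit. *)
Lemma euler_beta_cosec a : 0 < a < 1 -> euler_beta a (1 - a) = (pi / sin (pi * a))%:E.
Proof.
move=> a01; have a01' : 0 < 1 - a < 1 by lra.
have sumB_le (x y p q u v : R) : `|x - p| <= u -> `|y - q| <= v ->
    `|x + y - (q + p)| <= u + v.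
  move=> h1 h2; have -> : x + y - (q + p) = (x - p) + (y - q) by ring.
  by apply: (le_trans (ler_normD _ _)); exact: lerD.
rewrite euler_beta_half -(fineK (half_beta_fin a01)) -(fineK (half_beta_fin a01')) -EFinD.
have sa : 0 < sin (pi * a).
  by apply: sin_gt0_pi; have := pi_gt0 R; case/andP : a01; nra.
congr EFin; apply: (canRL (mulfK (lt0r_neq0 sa))); rewrite mulrC.
apply: (cosecant_sum_cvg a01); apply/cvgrPdist_le => e e0; near=> n.
rewrite cosecant_sumE.
have := half_beta_series n a01; have := half_beta_series n.+1 a01'.
move=> h1 h2; apply: (le_trans (sumB_le _ _ _ _ _ _ h1 h2)).
have ne : 2 / e <= n%:R.
  apply: (le_trans (ltW (archi_boundP _))); first by rewrite divr_ge0// ltW.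
  by rewrite ler_nat; near: n; exact: nbhs_infty_ge.
have n1 : 1 <= n%:R :> R by rewrite ler1n; near: n; exact: nbhs_infty_gt.
have le1 x : n%:R <= x -> x^-1 <= e / 2.
  move=> nx; have x0 : 0 < x by lra.
  by rewrite -[leRHS]invrK lef_pV2 ?posrE ?invr_gt0 ?divr_gt0// invf_div; lra.
have e2 : n.+2%:R = n%:R + 2 :> R by rewrite -[n.+2]addn2 natrD.
have l1 : (n.+2%:R - (1 - a))^-1 <= e / 2 by apply: le1; rewrite e2; lra.
have l2 : (n.+1%:R - a)^-1 <= e / 2 by apply: le1; rewrite -natr1; lra.
by rewrite [leRHS]splitr lerD.
Unshelve. all: by end_near. Qed.

End euler_beta.

(** * Growth of the number of births *)

Section convolution_tauberian.
Context {R : realType}.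
Local Notation mu := (@lebesgue_measure R).
Variables (psi : R -> R) (m : R -> \bar R) (alpha delta Psi M0 : R).
Hypotheses (psi_gt0 : forall t, 0 < psi t) (psi_le1 : forall t, psi t <= 1).
Hypothesis psi_ni : forall s t, s <= t -> psi t <= psi s.
Hypotheses (alpha_gt0 : 0 < alpha) (alpha_lt1 : alpha < 1).
Hypotheses (delta_gt0 : 0 < delta) (delta_lt : delta < 1 - alpha).
Hypothesis Psi_gt0 : 0 < Psi.
Hypothesis psi_asymp : exists C : R, \forall t \near +oo,
  `|psi t - Psi * t `^ (- alpha)| <= C * t `^ (- alpha - delta).
Hypotheses (mm : measurable_fun setT m) (m0 : forall s, (0 <= m s)%E).

(** [hv], [pv] and [kv] are 1, [psi] and the power [alpha - 1] cut off to a half-line, so that all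
    convolutions run over the whole line. *)
Let hv (s : R) : R := if 0 <= s then 1 else 0.
Let pv (u : R) : R := if 0 < u then psi u else 0.
Let kv (v : R) : R := if 0 < v then v `^ (alpha - 1) else 0.

(** The convolution [psi * N'] with [m] in the role of [N']: the mass at time [t] of the particles
    that have jumped since time 0. *)
Definition memory_mass (t : R) : \bar R :=
  (\int[mu]_s ((hv s * pv (t - s))%:E * m s))%E.

Definition cumulated_mass (t : R) : \bar R :=
  (\int[mu]_s ((window t s)%:E * m s))%E.

Hypothesis cumulated_lty : forall t, 0 <= t -> (cumulated_mass t < +oo)%E.
Hypothesis memory_le : forall t, 0 <= t -> (memory_mass t <= M0%:E)%E.
Hypothesis memory_cvg : forall e, 0 < e ->
  exists A, forall t, A <= t -> ((M0 - e)%:E <= memory_mass t)%E.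

Definition kernel_conv (t : R) : \bar R := (\int[mu]_v (kv v * pv (t - v))%:E)%E.

Let measurable_psi : measurable_fun setT psi.
Proof.
apply: nonincreasing_measurable; first exact: measurableT.
by move=> x y; exact: psi_ni.
Qed.

Let hv0 s : 0 <= hv s. Proof. by rewrite /hv; case: ifP. Qed.
Let pv0 s : 0 <= pv s. Proof. by rewrite /pv; case: ifP => // _; exact/ltW. Qed.
Let kv0 s : 0 <= kv s. Proof. by rewrite /kv; case: ifP => // _; exact: powR_ge0. Qed.

Let mhv : measurable_fun setT hv.
Proof. by apply: measurable_fun_ifT => //; exact: measurable_fun_ler. Qed.

Let mpv : measurable_fun setT pv.
Proof. by apply: measurable_fun_ifT => //; exact: measurable_fun_ltr. Qed.

Let mkv : measurable_fun setT kv.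
Proof. by apply: measurable_fun_ifT => //; exact: measurable_fun_ltr. Qed.

Let mpvB (t : R) : measurable_fun setT (fun s : R => pv (t - s)).
Proof.
have mt : measurable_fun setT (fun v : R => t - v) by exact: measurable_funB.
exact: (measurableT_comp mpv mt).
Qed.

Let kernel_integrand0 t v : (0 <= (kv v * pv (t - v))%:E)%E.
Proof. by rewrite lee_fin mulr_ge0. Qed.

Let mkernel_integrand t : measurable_fun setT (fun v : R => (kv v * pv (t - v))%:E).
Proof. by apply/measurable_EFinP; exact: measurable_funM. Qed.

Let memory_integrand0 t s : (0 <= (hv s * pv (t - s))%:E * m s)%E.
Proof. by rewrite mule_ge0// lee_fin mulr_ge0. Qed.

Let mmemory_integrand t : measurable_fun setT (fun s : R => (hv s * pv (t - s))%:E * m s)%E.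
Proof.
by apply: emeasurable_funM => //; apply/measurable_EFinP; exact: measurable_funM.
Qed.

Lemma kernel_conv_ge0 t : (0 <= kernel_conv t)%E.
Proof. by apply: integral_ge0 => v _; exact: kernel_integrand0. Qed.

Lemma memory_mass_ge0 t : (0 <= memory_mass t)%E.
Proof. by apply: integral_ge0 => v _; exact: memory_integrand0. Qed.

Let mpv3 t : measurable_fun setT (fun p : R * R => pv (t - p.1 - p.2)).
Proof.
have mt : measurable_fun setT (fun p : R * R => t - p.1 - p.2).
  by do 2 apply: measurable_funB => //.
exact: (measurableT_comp mpv mt).
Qed.

Lemma measurable_kernel_conv : measurable_fun setT kernel_conv.
Proof.
apply: (ge0_measurable_integral1 mu (f := fun t v : R => (kv v * pv (t - v))%:E));
  last by move=> t v; exact: kernel_integrand0.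
apply/measurable_EFinP; apply: measurable_funM.
  exact: (measurableT_comp mkv measurable_snd).
have mt : measurable_fun setT (fun p : R * R => p.1 - p.2) by exact: measurable_funB.
exact: (measurableT_comp mpv mt).
Qed.

Let mkernel_shift t : measurable_fun setT (fun s : R => kernel_conv (t - s)).
Proof.
have mt : measurable_fun setT (fun v : R => t - v) by exact: measurable_funB.
exact: (measurableT_comp measurable_kernel_conv mt).
Qed.

(** Associativity of convolution: the kernel may be applied to [psi] first or to [psi * N'] first.
    The left side is close to [c N], the right side is governed by conservation of mass. *)
Lemma kernel_conv_memory t :
  (\int[mu]_s ((hv s)%:E * m s * kernel_conv (t - s)%R) =
   \int[mu]_v ((kv v)%:E * memory_mass (t - v)%R))%E.
Proof.
pose F s v := ((hv s)%:E * m s * (kv v * pv (t - s - v))%:E)%E.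
transitivity (\int[mu]_s \int[mu]_v F s v)%E.
  apply: eq_integral => s _; rewrite /F (ge0_integralZl mu measurableT (mkernel_integrand (t - s))).
  - by [].
  - by move=> v _; exact: kernel_integrand0.
  - by rewrite mule_ge0// lee_fin.
rewrite (@ge0_exchange_integral _ _ _ _ _ mu mu F).
- apply: eq_integral => v _.
  rewrite -(ge0_integralZl mu measurableT (mmemory_integrand (t - v))); last 2 first.
  + by move=> s _; exact: memory_integrand0.
  + by rewrite lee_fin.
  apply: eq_integral => s _; rewrite /F addrAC !EFinM.
  rewrite -!muleA [RHS]muleCA; congr (_ * _)%E.
  by rewrite [RHS]muleA [RHS]muleC.
- apply: emeasurable_funM.
    apply: emeasurable_funM.
      by apply/measurable_EFinP; exact: (measurableT_comp mhv measurable_fst).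
    exact: (measurableT_comp mm measurable_fst).
  apply/measurable_EFinP; apply: measurable_funM; last exact: mpv3.
  exact: (measurableT_comp mkv measurable_snd).
- by move=> s v; rewrite !mule_ge0// lee_fin// mulr_ge0.
Qed.

(** The convolution sees [psi] at small arguments too, so the expansion at infinity is extended to
    all [s > 0] at the cost of a larger constant. *)
Lemma psi_global_bound : exists2 C : R, 0 <= C & forall s, 0 < s ->
  `|psi s - Psi * s `^ (- alpha)| <= C * s `^ (- alpha - delta).
Proof.
have [C [A [_ CA]]] := psi_asymp.
pose A1 := Num.max A 1; pose C0 := Num.max C 0.
have A1_gt0 : 0 < A1 by rewrite lt_max ltr01 orbT.
have C00 : 0 <= C0 by rewrite le_max lexx orbT.
(* For [s <= A1] the error is at most [1 + Psi s^(-alpha)]. The two terms of [D] come from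
   [1 <= (A1 / s)^(alpha + delta)] and [1 <= (A1 / s)^delta]. *)
pose D := A1 `^ (alpha + delta) + Psi * A1 `^ delta.
have D0 : 0 <= D by rewrite addr_ge0 ?mulr_ge0 ?powR_ge0// ltW.
exists (C0 + D) => [|s s0]; first by rewrite addr_ge0.
have w0 := powR_ge0 s (- alpha - delta).
have [sA|sA] := ltP A1 s.
  have As : A < s by rewrite (le_lt_trans _ sA)// le_max lexx.
  apply: (le_trans (CA s As)); apply: ler_wpM2r => //.
  by rewrite (@le_trans _ _ C0) ?lerDl// le_max lexx.
have powD r q : s `^ (r + q) = s `^ r * s `^ q by rewrite powRD// (lt0r_neq0 s0) implybT.
have le_pow r : 0 <= r -> s `^ r <= A1 `^ r.
  by move=> r0; apply: ge0_ler_powR; rewrite ?nnegrE ?(ltW s0) ?(ltW A1_gt0).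
have ad0 : 0 <= alpha + delta by rewrite addr_ge0// ltW.
have h1 : 1 <= A1 `^ (alpha + delta) * s `^ (- alpha - delta).
  have <- : s `^ (alpha + delta) * s `^ (- alpha - delta) = 1.
    by rewrite -powD -[RHS](powRr0 s); congr (_ `^ _); ring.
  by rewrite ler_wpM2r// le_pow.
have h2 : s `^ (- alpha) <= A1 `^ delta * s `^ (- alpha - delta).
  have -> : s `^ (- alpha) = s `^ delta * s `^ (- alpha - delta).
    by rewrite -powD; congr (_ `^ _); ring.
  by rewrite ler_wpM2r// le_pow// ltW.
have p0 := powR_ge0 s (- alpha).
apply: (@le_trans _ _ (1 + Psi * s `^ (- alpha))).
  rewrite ler_norml; have := psi_le1 s; have := psi_gt0 s.
  have : 0 <= Psi * s `^ (- alpha) by rewrite mulr_ge0// ltW.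
  by lra.
have h3 : Psi * s `^ (- alpha) <= Psi * (A1 `^ delta * s `^ (- alpha - delta)).
  by rewrite ler_wpM2l// ltW.
have h4 : 0 <= C0 * s `^ (- alpha - delta) by rewrite mulr_ge0.
by rewrite /D; lra.
Qed.

Let B1 := pi / sin (pi * alpha).
Let c := Psi * B1.

Let B1_gt0 : 0 < B1.
Proof.
rewrite divr_gt0 ?pi_gt0//; apply: sin_gt0_pi; have := pi_gt0 R => p0.
by rewrite mulr_gt0//= gtr_pMr.
Qed.

Let c_gt0 : 0 < c. Proof. by rewrite mulr_gt0. Qed.

Let integral_beta1 t : 0 < t ->
  (\int[mu]_v (beta_integrand alpha (1 - alpha) t v)%:E = B1%:E)%E.
Proof.
move=> t0; rewrite euler_beta_scale// euler_beta_cosec ?alpha_gt0//.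
by rewrite addrCA subrr addr0 subrr powRr0 mul1e.
Qed.

(** Replacing [psi s] by [Psi s^(-alpha)] gives exactly [c], by scaling. The error term scales like
    [t^(-delta)], and its Beta integral is finite because [alpha + delta < 1]. *)
Lemma kernel_conv_cvg : exists2 D : R, 0 <= D & forall t, 0 < t ->
  (kernel_conv t <= (c + D * t `^ (- delta))%:E /\
   c%:E <= kernel_conv t + (D * t `^ (- delta))%:E)%E.
Proof.
have [C C0 psiC] := psi_global_bound.
pose B2 := euler_beta alpha (1 - alpha - delta).
have B2_ge0 : (0 <= B2)%E.
  by apply: integral_ge0 => v _; rewrite lee_fin beta_integrand_ge0.
have B2_fin : B2 \is a fin_num.
  rewrite ge0_fin_numE// euler_beta_lty//.
  + by rewrite alpha_gt0 alpha_lt1.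
  + by have := delta_gt0; have := delta_lt; have := alpha_gt0; lra.
exists (C * fine B2) => [|t t0]; first by rewrite mulr_ge0// fine_ge0.
pose f1 v := beta_integrand alpha (1 - alpha) t v.
pose f2 v := beta_integrand alpha (1 - alpha - delta) t v.
have mf1 : measurable_fun setT f1 by exact: measurable_beta_integrand.
have mf2 : measurable_fun setT f2 by exact: measurable_beta_integrand.
have f10 v : 0 <= f1 v by exact: beta_integrand_ge0.
have f20 v : 0 <= f2 v by exact: beta_integrand_ge0.
have I1 : (\int[mu]_v (Psi * f1 v)%:E = c%:E)%E.
  under eq_integral do rewrite EFinM.
  rewrite ge0_integralZl//.
  - by rewrite integral_beta1.
  - exact/measurable_EFinP.
  - by move=> v _; rewrite lee_fin.
  - by rewrite lee_fin ltW.
have I2 : (\int[mu]_v (C * f2 v)%:E = (C * fine B2 * t `^ (- delta))%:E)%E.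
  under eq_integral do rewrite EFinM.
  rewrite ge0_integralZl//.
  - rewrite euler_beta_scale// -/B2 -(fineK B2_fin) -!EFinM; congr EFin.
    by rewrite mulrCA mulrC; congr (_ * _ `^ _); ring.
  - exact/measurable_EFinP.
  - by move=> v _; rewrite lee_fin.
have kE v : 0 < v < t -> kv v * pv (t - v) = v `^ (alpha - 1) * psi (t - v).
  by move=> /andP[v0 vt]; rewrite /kv /pv v0 subr_gt0 vt.
have k_out v : (0 < v < t) = false -> kv v * pv (t - v) = 0.
  by rewrite /kv /pv subr_gt0; case: ltP => _; case: ltP => _//= _; rewrite ?mul0r ?mulr0.
have psi_le v : 0 < v < t -> `|psi (t - v) - Psi * (t - v) `^ (- alpha)| <=
    C * (t - v) `^ (- alpha - delta).
  by move=> /andP[_ vt]; apply: psiC; rewrite subr_gt0.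
have f1E v : 0 < v < t -> f1 v = v `^ (alpha - 1) * (t - v) `^ (- alpha).
  by move=> vt; rewrite /f1 /beta_integrand vt; congr (_ * _ `^ _); ring.
have f2E v : 0 < v < t -> f2 v = v `^ (alpha - 1) * (t - v) `^ (- alpha - delta).
  by move=> vt; rewrite /f2 /beta_integrand vt; congr (_ * _ `^ _); ring.
have mPf1 : measurable_fun setT (fun v => (Psi * f1 v)%:E).
  by apply/measurable_EFinP; exact: measurable_funM.
have mCf2 : measurable_fun setT (fun v => (C * f2 v)%:E).
  by apply/measurable_EFinP; exact: measurable_funM.
have Pf10 v : (0 <= (Psi * f1 v)%:E)%E by rewrite lee_fin mulr_ge0// ltW.
have Cf20 v : (0 <= (C * f2 v)%:E)%E by rewrite lee_fin mulr_ge0.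
split.
- rewrite EFinD -I1 -I2 -ge0_integralD//.
  apply: ge0_le_integral => //; [exact: mkernel_integrand|exact: emeasurable_funD|].
  move=> v _; rewrite -EFinD lee_fin.
  have [vt|vt] := boolP (0 < v < t); last first.
    by rewrite k_out ?(negbTE vt)// addr_ge0// mulr_ge0// ltW.
  rewrite kE// f1E// f2E//; have := psi_le v vt; rewrite ler_norml => /andP[_].
  have := powR_ge0 v (alpha - 1); nra.
- rewrite -I1 -I2 /kernel_conv -ge0_integralD//; last exact: mkernel_integrand.
  apply: ge0_le_integral => //; first by apply: emeasurable_funD => //; exact: mkernel_integrand.
  move=> v _; rewrite -EFinD lee_fin.
  have [vt|vt] := boolP (0 < v < t); last first.
    by rewrite k_out ?(negbTE vt)// /f1 /beta_integrand (negbTE vt) mulr0 addr_ge0// mulr_ge0.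
  rewrite kE// f1E// f2E//; have := psi_le v vt; rewrite ler_norml => /andP[+ _].
  have := powR_ge0 v (alpha - 1); nra.
Qed.

Let pv_le1 s : pv s <= 1. Proof. by rewrite /pv; case: ifP. Qed.

Let integral_kv t : 0 < t ->
  (\int[mu]_v ((if v <= t then kv v else 0)%:E) = (t `^ alpha / alpha)%:E)%E.
Proof.
move=> t0; have := integral_powR alpha_gt0 t0.
rewrite integral_mkcond => <-; apply: eq_integral => v _.
rewrite patchE /kv mem_setE in_itv/=.
by case: (v <= t); case: (0 < v).
Qed.

Let mkv_itv t : measurable_fun setT (fun v : R => (if v <= t then kv v else 0)%:E).
Proof.
by apply/measurable_EFinP; apply: measurable_fun_ifT => //; exact: measurable_fun_ler.
Qed.

Let kernel_conv_le0 t : t <= 0 -> kernel_conv t = 0%E.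
Proof.
move=> t0; apply: integral0_eq => v _.
rewrite /kv /pv subr_gt0; case: ifP => v0; last by rewrite mul0r.
by rewrite ltNge (le_trans t0 (ltW v0)) mulr0.
Qed.

(** The previous estimate degenerates as [t] tends to 0. For [t <= 1] the bound [psi <= 1] leaves
    the integral of the power, at most [1 / alpha]. *)
Lemma kernel_conv_bounded : exists2 K : R, 0 <= K &
  forall t, (kernel_conv t <= K%:E)%E.
Proof.
have [D D0 HD] := kernel_conv_cvg.
have ia0 : 0 <= alpha^-1 by rewrite invr_ge0 ltW.
have cD0 : 0 <= c + D by rewrite addr_ge0// ltW.
exists (c + D + alpha^-1) => [|t].
  by rewrite addr_ge0.
have [t0|t0] := leP t 0.
  by rewrite (kernel_conv_le0 t0) lee_fin addr_ge0.
have [t1|t1] := leP t 1.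
  apply: (@le_trans _ _ (t `^ alpha / alpha)%:E); last first.
    rewrite lee_fin -[leLHS]add0r lerD//.
    rewrite -[leRHS]mul1r ler_wpM2r//.
    have <- : 1 `^ alpha = 1 :> R by rewrite powR1.
    by rewrite ge0_ler_powR ?nnegrE ?(ltW t0) ?(ltW alpha_gt0).
  rewrite -(integral_kv t0); apply: ge0_le_integral => //.
  - exact: mkernel_integrand.
  - exact: mkv_itv.
  move=> v _; rewrite lee_fin; case: (leP v t) => vt; first by rewrite ler_piMr.
  by rewrite /pv subr_gt0 ltNge (ltW vt) mulr0.
have [h _] := HD t t0; apply: (le_trans h); rewrite lee_fin.
rewrite -addrA lerD2l -[leLHS]addr0 lerD// ler_piMr// powRN invf_le1 ?powR_gt0//.
by rewrite -[leLHS](powRr0 t) ler_powR// ltW.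
Qed.

Definition kernel_memory (t : R) : \bar R :=
  (\int[mu]_v ((kv v)%:E * memory_mass (t - v)%R))%E.

Let mwin t : measurable_fun setT (window t : R -> R).
Proof. exact: measurable_window. Qed.

(** For time lags beyond some [A] the kernel is within [e] of [c]. For lags up to [A] it is merely
    bounded, but there [psi] is at least [psi A], so the discrepancy is at most a multiple of [psi],
    whose integral against [N'] is at most [M0]. *)
Lemma kernel_memory_near e : 0 < e -> e < c -> exists2 K : R, 0 <= K & forall t, 0 <= t ->
  (kernel_memory t <= (c + e)%:E * cumulated_mass t + K%:E /\
   (c - e)%:E * cumulated_mass t <= kernel_memory t + K%:E)%E.
Proof.
move=> e0 ec; have [D D0 HD] := kernel_conv_cvg; have [H H0 HH] := kernel_conv_bounded.
have [A A0 HA] : exists2 A, 0 < A & forall u, A < u -> D * u `^ (- delta) <= e.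
  pose A := ((D + 1) / e) `^ (delta^-1).
  have q0 : 0 < (D + 1) / e by rewrite divr_gt0// ltr_wpDl.
  have A0 : 0 < A by rewrite powR_gt0.
  exists A => // u Au; have u0 := lt_trans A0 Au.
  rewrite powRN ler_pdivrMr ?powR_gt0// mulrC -ler_pdivrMr//.
  apply: (@le_trans _ _ (A `^ delta)).
    by rewrite -powRrM mulVf ?gt_eqF// powRr1 ?(ltW q0)// ler_pM2r ?invr_gt0// lerDl.
  by rewrite ge0_ler_powR ?nnegrE ?(ltW A0) ?(ltW u0) ?(ltW Au) ?(ltW delta_gt0).
have M00 : 0 <= M0.
  by have := le_trans (memory_mass_ge0 0) (memory_le (lexx 0)); rewrite lee_fin.
have pA := psi_gt0 A.
(* Chosen so that [q * psi u] dominates both [H] and [c] for every lag [u <= A]. *)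
pose q := (H + c) / psi A.
have q0 : 0 <= q by rewrite divr_ge0 ?(ltW pA)// addr_ge0// ltW.
pose kc u := fine (kernel_conv u).
have kcE u : kernel_conv u = (kc u)%:E.
  rewrite fineK// ge0_fin_numE ?kernel_conv_ge0//.
  exact: le_lt_trans (HH u) (ltry _).
have kc0 u : 0 <= kc u by rewrite fine_ge0// kernel_conv_ge0.
have qle u : 0 < u -> u <= A -> H + c <= q * pv u.
  move=> u0 uA; rewrite /q /pv u0 mulrAC ler_pdivlMr// ler_wpM2l//.
    by rewrite addr_ge0// ltW.
  exact: psi_ni.
have kc_le u : kc u <= (c + e) * (if 0 < u then 1 else 0) + q * pv u.
  case: (ltP 0 u) => u0; last first.
    by rewrite /kc (kernel_conv_le0 u0) mulr0 add0r; apply: mulr_ge0.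
  rewrite mulr1; have [uA|Au] := leP u A.
    have := qle u u0 uA; have := HH u; rewrite kcE lee_fin; have := ltW c_gt0; lra.
  have [+ _] := HD u u0; rewrite kcE lee_fin; have := HA u Au.
  have : 0 <= q * pv u by rewrite mulr_ge0.
  lra.
have kc_ge u : (c - e) * (if 0 < u then 1 else 0) <= kc u + q * pv u.
  have qp : 0 <= q * pv u by rewrite mulr_ge0.
  case: (ltP 0 u) => u0; last by rewrite mulr0 addr_ge0.
  rewrite mulr1; have [uA|Au] := leP u A.
    by have := qle u u0 uA; have := kc0 u; lra.
  have [_ +] := HD u u0; rewrite kcE -EFinD lee_fin; have := HA u Au.
  by lra.
have mqm t : measurable_fun setT (fun s : R => (q * (hv s * pv (t - s)))%:E * m s)%E.
  apply: emeasurable_funM; last exact: mm.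
  apply/measurable_EFinP; apply: measurable_funM; first exact: measurable_cst.
  by apply: measurable_funM; [exact: mhv|exact: mpvB].
have qm0 t s : (0 <= (q * (hv s * pv (t - s)))%:E * m s)%E.
  by apply: mule_ge0 => //; rewrite lee_fin; apply: mulr_ge0 => //; exact: mulr_ge0.
have mmw k t : measurable_fun setT (fun s : R => (k * window t s)%:E * m s)%E.
  by apply: emeasurable_funM => //; apply/measurable_EFinP; exact: measurable_funM.
have kw0 k t s : 0 <= k -> (0 <= (k * window t s)%:E * m s)%E.
  by move=> k0; rewrite mule_ge0// lee_fin mulr_ge0// window_ge0.
have kw k t : 0 <= k -> (k%:E * cumulated_mass t = \int[mu]_s ((k * window t s)%:E * m s))%E.
  move=> k0; rewrite /cumulated_mass -ge0_integralZl//.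
  - by apply: eq_integral => s _; rewrite EFinM muleA.
  - by apply: emeasurable_funM => //; apply/measurable_EFinP; exact: mwin.
  - by move=> s _; rewrite mule_ge0// lee_fin window_ge0.
have mX t : measurable_fun setT (fun s : R => (hv s)%:E * m s * kernel_conv (t - s)%R)%E.
  apply: emeasurable_funM; last exact: mkernel_shift.
  apply: emeasurable_funM; last exact: mm.
  by apply/measurable_EFinP; exact: mhv.
have X0 t s : (0 <= (hv s)%:E * m s * kernel_conv (t - s)%R)%E.
  by rewrite !mule_ge0 ?lee_fin ?kernel_conv_ge0.
have XE t s : ((hv s)%:E * m s * kernel_conv (t - s)%R = (hv s * kc (t - s))%:E * m s)%E.
  by rewrite kcE muleAC EFinM.
have winE t s : window t s = hv s * (if 0 < t - s then 1 else 0) :> R.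
  by rewrite windowE subr_gt0 /hv; case: (0 <= s); rewrite /= ?mul1r ?mul0r; case: (s < t).
exists (q * M0) => [|t t0]; first exact: mulr_ge0.
have qmem : (\int[mu]_s ((q * (hv s * pv (t - s)))%:E * m s) <= (q * M0)%:E)%E.
  under eq_integral do rewrite EFinM -muleA.
  rewrite (ge0_integralZl mu measurableT (mmemory_integrand t)); last 2 first.
  - by move=> s _; exact: memory_integrand0.
  - by rewrite lee_fin.
  by rewrite [leRHS]EFinM lee_wpmul2l ?lee_fin//; exact: memory_le.
have ce0 : 0 <= c + e by rewrite addr_ge0// ltW.
have ce1 : 0 <= c - e by rewrite subr_ge0 ltW.
rewrite /kernel_memory -kernel_conv_memory; split.
- apply: (@le_trans _ _ ((c + e)%:E * cumulated_mass t +
      \int[mu]_s ((q * (hv s * pv (t - s)))%:E * m s))%E); last by rewrite leeD2l.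
  rewrite (kw _ t ce0) -(ge0_integralD mu measurableT (fun s _ => kw0 _ t s ce0) (mmw _ t)
    (fun s _ => qm0 t s) (mqm t)).
  apply: (ge0_le_integral mu measurableT (fun s _ => X0 t s) (mX t)).
    exact: emeasurable_funD (mmw _ t) (mqm t).
  move=> s _; rewrite XE -ge0_muleDl ?lee_fin; last 2 first.
  + by rewrite mulr_ge0// window_ge0.
  + by apply: mulr_ge0 => //; exact: mulr_ge0.
  by rewrite lee_wpmul2r// lee_fin winE (mulrCA (c + e)) (mulrCA q) -mulrDr ler_wpM2l.
- apply: (@le_trans _ _ (\int[mu]_s ((hv s)%:E * m s * kernel_conv (t - s)%R) +
      \int[mu]_s ((q * (hv s * pv (t - s)))%:E * m s))%E); last by rewrite leeD2l.
  rewrite (kw _ t ce1) -(ge0_integralD mu measurableT (fun s _ => X0 t s) (mX t)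
    (fun s _ => qm0 t s) (mqm t)).
  apply: (ge0_le_integral mu measurableT (fun s _ => kw0 _ t s ce1) (mmw _ t)).
    exact: emeasurable_funD (mX t) (mqm t).
  move=> s _; rewrite XE -ge0_muleDl ?lee_fin; last 2 first.
  + by rewrite mulr_ge0.
  + by apply: mulr_ge0 => //; exact: mulr_ge0.
  by rewrite lee_wpmul2r// lee_fin winE (mulrCA (c - e)) (mulrCA q) -mulrDr ler_wpM2l.
Qed.

Let M0_ge0 : 0 <= M0.
Proof. by have := le_trans (memory_mass_ge0 0) (memory_le (lexx 0)); rewrite lee_fin. Qed.

Let memory_mass_le0 t : t <= 0 -> memory_mass t = 0%E.
Proof.
move=> t0; apply: integral0_eq => s _.
rewrite /hv /pv subr_gt0; case: ifP => s0; last by rewrite mul0r mul0e.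
by rewrite ltNge (le_trans t0 s0) mulr0 mul0e.
Qed.

Let measurable_memory_mass : measurable_fun setT memory_mass.
Proof.
apply: (ge0_measurable_integral1 mu (f := fun t s : R => (hv s * pv (t - s))%:E * m s)%E);
  last by move=> t s; exact: memory_integrand0.
apply: emeasurable_funM; last exact: (measurableT_comp mm measurable_snd).
apply/measurable_EFinP; apply: measurable_funM.
  exact: (measurableT_comp mhv measurable_snd).
have mt : measurable_fun setT (fun p : R * R => p.1 - p.2) by exact: measurable_funB.
exact: (measurableT_comp mpv mt).
Qed.

Let mkernel_memory t : measurable_fun setT (fun v : R => (kv v)%:E * memory_mass (t - v)%R)%E.
Proof.
apply: emeasurable_funM; first by apply/measurable_EFinP.
have mt : measurable_fun setT (fun v : R => t - v) by exact: measurable_funB.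
exact: (measurableT_comp measurable_memory_mass mt).
Qed.

Let kernel_memory_integrand0 t v : (0 <= (kv v)%:E * memory_mass (t - v)%R)%E.
Proof. by rewrite mule_ge0 ?lee_fin ?memory_mass_ge0. Qed.

Lemma kernel_memory_ge0 t : (0 <= kernel_memory t)%E.
Proof. by apply: integral_ge0 => v _; exact: kernel_memory_integrand0. Qed.

Let integral_kvZ k t : 0 <= k -> 0 < t ->
  (\int[mu]_v (k%:E * (if v <= t then kv v else 0)%:E) = (k * (t `^ alpha / alpha))%:E)%E.
Proof.
move=> k0 t0; rewrite (ge0_integralZl mu measurableT (mkv_itv t)).
- by rewrite integral_kv.
- by move=> v _; rewrite lee_fin; case: ifP.
- by rewrite lee_fin.
Qed.

Lemma kernel_memory_le t : 0 < t -> (kernel_memory t <= (M0 * (t `^ alpha / alpha))%:E)%E.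
Proof.
move=> t0; rewrite -(integral_kvZ M0_ge0 t0).
apply: (ge0_le_integral mu measurableT (fun v _ => kernel_memory_integrand0 t v)
  (mkernel_memory t)).
  by apply: emeasurable_funM; [exact: measurable_cst|exact: mkv_itv].
move=> v _; case: (leP v t) => vt.
  by rewrite muleC lee_wpmul2r ?lee_fin//; apply: memory_le; rewrite subr_ge0.
by rewrite memory_mass_le0 ?mule0 ?mule0// subr_le0 ltW.
Qed.

Lemma kernel_memory_ge e : 0 < e -> exists A, forall t, A < t ->
  (((M0 - e) * ((t - A) `^ alpha / alpha))%:E <= kernel_memory t)%E.
Proof.
move=> e0; have [A HA] := memory_cvg e0.
exists A => t At; have tA0 : 0 < t - A by rewrite subr_gt0.
(* With a negative factor the bound is trivial; otherwise only the lags [v <= t - A] are kept, for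
   which [t - v >= A]. *)
have [Me|Me] := ltP (M0 - e) 0.
  apply: le_trans (kernel_memory_ge0 t); rewrite lee_fin nmulr_rle0//.
  by rewrite divr_ge0 ?powR_ge0// ltW.
rewrite -(integral_kvZ Me tA0); apply: ge0_le_integral => //.
- by move=> v _; rewrite -EFinM lee_fin mulr_ge0//; case: ifP.
- by apply: emeasurable_funM; [exact: measurable_cst|exact: mkv_itv].
- exact: mkernel_memory.
move=> v _; case: (leP v (t - A)) => vt; last by rewrite mule0.
by rewrite muleC lee_wpmul2l ?lee_fin//; apply: HA; lra.
Qed.

Let c_neq0 : c != 0. Proof. exact: lt0r_neq0. Qed.
Let alpha_neq0 : alpha != 0. Proof. exact: lt0r_neq0. Qed.

(** With [V = N(t) / t^alpha], the estimates enclose [(c - e) V] from above and [(c + e) V] from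
    below by [M0 / alpha] up to multiples of [e], and [c L = M0 / alpha]. *)
Lemma cumulated_mass_cvg :
  fine (cumulated_mass t) / t `^ alpha @[t --> +oo] --> M0 / (alpha * c).
Proof.
pose L := M0 / (alpha * c).
have L0 : 0 <= L by rewrite divr_ge0// mulr_ge0// ltW.
have cL : c * L = M0 / alpha by rewrite /L invfM (mulrC alpha^-1) mulrCA mulVKf.
apply/cvgrPdist_le => /= eta eta0; rewrite -/L.
(* The sum of the coefficients of all errors proportional to [e], so that [e * E <= c * eta]
   suffices at the end. *)
pose E := 1 + L + eta + (M0 + 1) / alpha.
have E0 : 0 < E.
  by rewrite /E -!addrA ltr_pwDl// !addr_ge0// ?(ltW eta0)// divr_ge0 ?addr_ge0// ltW.
pose e := Num.min (1 / 2) (Num.min (c / 2) (c * eta / E)).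
have e0 : 0 < e by rewrite !lt_min !divr_gt0//= mulr_gt0.
have e1 : e <= 1 / 2 by rewrite ge_min lexx.
have ec : e <= c / 2 by rewrite !ge_min lexx/= orbT.
have eE : e * E <= c * eta by rewrite -ler_pdivlMr// !ge_min lexx !orbT.
have ec' : e < c by have := c_gt0; lra.
have [K K0 HK] := kernel_memory_near e0 ec'.
have [A HA] := kernel_memory_ge e0.
(* Beyond [T] one has [1 < t], [A <= e t] and [K <= e t^alpha]. *)
pose T := 1 + `|A| / e + (K / e) `^ alpha^-1.
exists T; split; first exact: num_real.
move=> t Tt.
have Ae0 : 0 <= `|A| / e by rewrite divr_ge0// ltW.
have Ke0 : 0 <= (K / e) `^ alpha^-1 by exact: powR_ge0.
have t1 : 1 < t by rewrite (le_lt_trans _ Tt)// /T -addrA lerDl addr_ge0.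
have t0 : 0 < t by rewrite (lt_trans _ t1).
have Aet : A <= e * t.
  rewrite mulrC -ler_pdivrMr//; apply: (@le_trans _ _ (`|A| / e)).
    by rewrite ler_pM2r ?invr_gt0// ler_norm.
  by apply: ltW; apply: le_lt_trans Tt; rewrite /T; lra.
have At : A < t by have : e * t < t; [rewrite gtr_pMl//; lra|lra].
have p0 : 0 < t `^ alpha by rewrite powR_gt0.
have KP : K <= e * t `^ alpha.
  rewrite mulrC -ler_pdivrMr//.
  have -> : K / e = (K / e) `^ alpha^-1 `^ alpha.
    by rewrite -powRrM mulVf// powRr1// divr_ge0// ltW.
  rewrite ge0_ler_powR ?nnegrE ?(ltW t0) ?(ltW alpha_gt0)//.
  by apply: ltW; apply: le_lt_trans Tt; rewrite /T; lra.
have e1' : 0 < 1 - e by lra.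
(* Uses [A <= e t] and [1 - e <= (1 - e)^alpha]. *)
have tA : (1 - e) * t `^ alpha <= (t - A) `^ alpha.
  apply: (@le_trans _ _ (((1 - e) * t) `^ alpha)).
    rewrite powRM ?(ltW e1') ?(ltW t0)// ler_pM2r//.
    by apply: ger1_powR; [rewrite e1'/= gerBl ltW|exact: ltW].
  by rewrite ge0_ler_powR ?nnegrE ?(ltW alpha_gt0)//; [rewrite mulr_ge0// ltW|lra|lra].
have U_fin : cumulated_mass t \is a fin_num.
  rewrite ge0_fin_numE ?cumulated_lty ?(ltW t0)//.
  by apply: integral_ge0 => s _; rewrite mule_ge0// lee_fin window_ge0.
have X_fin : kernel_memory t \is a fin_num.
  rewrite ge0_fin_numE ?kernel_memory_ge0//.
  exact: le_lt_trans (kernel_memory_le t0) (ltry _).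
have := HA t At; have := kernel_memory_le t0; have [+ +] := HK t (ltW t0).
rewrite -(fineK U_fin) -(fineK X_fin) -!EFinM -!EFinD !lee_fin.
set U := fine (cumulated_mass t); set X := fine (kernel_memory t) => h3 h4 h2 h1.
have UE : U / t `^ alpha * t `^ alpha = U by rewrite divfK// gt_eqF.
rewrite [fine U%:E]/=; move: UE; set V := U / _ => UE; rewrite -UE in h3 h4.
have h5 : (c - e) * V <= M0 / alpha + e.
  rewrite -(ler_pM2r p0) [leRHS]mulrDl -[leLHS]mulrA; apply: (le_trans h4).
  by rewrite lerD// (le_trans h2)// mulrA mulrAC.
have h6 : (M0 - e) * (1 - e) / alpha - e <= (c + e) * V.
  rewrite -(ler_pM2r p0) [leLHS]mulrBl -[leRHS]mulrA.
  have h7 : (M0 - e) * (1 - e) / alpha * t `^ alpha <= X.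
    have [Me|Me] := ltP (M0 - e) 0.
      apply: (@le_trans _ _ 0); last by rewrite fine_ge0// kernel_memory_ge0.
      by rewrite -!mulrA nmulr_rle0// !mulr_ge0 ?invr_ge0 ?(ltW e1') ?(ltW p0) ?(ltW alpha_gt0).
    apply: le_trans h1; rewrite -!mulrA ler_wpM2l// [leRHS]mulrC mulrCA ler_wpM2l//.
    by rewrite invr_ge0 ltW.
  by lra.
have h8 : e * E = e + e * L + e * eta + e * ((M0 + 1) / alpha) by rewrite /E; ring.
have eL : 0 <= e * L by rewrite mulr_ge0// ltW.
have ee : 0 <= e * eta by rewrite mulr_ge0// ltW.
have eM : 0 <= e * ((M0 + 1) / alpha) by rewrite !mulr_ge0 ?invr_ge0 ?addr_ge0 ?(ltW e0) ?(ltW alpha_gt0).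
have h9 : M0 / alpha - e * ((M0 + 1) / alpha) <= (M0 - e) * (1 - e) / alpha.
  rewrite mulrA -mulrBl ler_pM2r ?invr_gt0//.
  have : 0 <= e * e by rewrite mulr_ge0// ltW.
  by lra.
have ce1 : 0 < c - e by rewrite subr_gt0.
have ce2 : 0 < c + e by rewrite addr_gt0.
rewrite ler_distl; apply/andP; split.
  by rewrite lerBlDr -(ler_pM2l ce1); lra.
by rewrite -lerBlDr -(ler_pM2l ce2); lra.
Qed.

End convolution_tauberian.

(** * Averages of coordinates and of the squared norm *)

Section smeared_weights.
Context {R : realType} (d : nat) (w : probability (d.-tuple R) R).
Local Notation E := (d.-tuple R).

Section additive_functional.
Variable l : E -> R.
Hypotheses (ml : measurable_fun setT l) (lD : forall y z, l (tadd y z) = l y + l z).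
Hypothesis l_int : w.-integrable setT (EFin \o l).
Hypothesis l_mean : (\int[w]_z (l z)%:E = 0)%E.
Let pos (y : E) : R := Num.max (l y) 0.
Let neg (y : E) : R := Num.max (- l y) 0.

Let mpos : measurable_fun setT pos.
Proof. exact: measurable_maxr. Qed.

Let mneg : measurable_fun setT neg.
Proof. by apply: measurable_maxr => //; exact: measurableT_comp. Qed.

Let int_abs : w.-integrable setT (fun z => `|l z|%:E).
Proof. exact: (integrable_norm l_int). Qed.

Let int_cst (k : R) : w.-integrable setT (fun z => k%:E).
Proof. exact: finite_measure_integrable_cst. Qed.

Let int_abs_fin : (\int[w]_z `|l z|%:E)%E \is a fin_num.
Proof. exact: integrable_fin_num int_abs. Qed.

Definition mean_abs : R := fine (\int[w]_z `|l z|%:E).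

Lemma mean_abs_ge0 : 0 <= mean_abs.
Proof. by rewrite fine_ge0// integral_ge0// => z _; rewrite lee_fin. Qed.

Let integral_cst1 (k : R) : (\int[w]_z k%:E = k%:E)%E.
Proof. by rewrite integral_cst// [X in (_ * X)%E](probability_setT w) mule1. Qed.

Let mshift (f : E -> R) y : measurable_fun setT f ->
  measurable_fun setT (fun z => (f (tadd y z))%:E).
Proof.
move=> mf; apply/measurable_EFinP.
have mt : measurable_fun setT (fun z : E => tadd y z) by exact: measurable_tadd.
exact: (measurableT_comp mf mt).
Qed.

Lemma smear_pos_le y : (smear w (EFin \o pos) y <= (pos y + mean_abs)%:E)%E.
Proof.
rewrite /smear EFinD -(integral_cst1 (pos y)) /mean_abs fineK//.
have mabs : measurable_fun setT (fun z => `|l z|%:E).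
  by apply/measurable_EFinP; exact: measurableT_comp.
have pos0 z : (0 <= (pos z)%:E)%E by rewrite lee_fin le_max lexx orbT.
rewrite -(ge0_integralD w measurableT (fun _ _ => pos0 y) (measurable_cst _) _ mabs)//.
apply: (ge0_le_integral w measurableT (fun z _ => pos0 (tadd y z)) (mshift y mpos)).
  exact: emeasurable_funD (measurable_cst _) mabs.
move=> z _; rewrite -EFinD lee_fin /pos lD ge_max; apply/andP; split.
  by rewrite lerD ?ler_norm// le_max lexx.
by rewrite addr_ge0// le_max lexx orbT.
Qed.

Lemma integrable_pos_shift y : w.-integrable setT (fun z => (pos (tadd y z))%:E).
Proof.
apply/integrableP; split; first exact: (mshift y mpos).
rewrite (eq_integral (fun z => (pos (tadd y z))%:E)); last first.
  by move=> z _; rewrite gee0_abs// lee_fin le_max lexx orbT.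
exact: le_lt_trans (smear_pos_le y) (ltry _).
Qed.

(** Jensen's inequality for the positive part. *)
Lemma smear_pos_ge y : ((pos y)%:E <= smear w (EFin \o pos) y)%E.
Proof.
have [ly|ly] := leP (l y) 0.
  rewrite /pos max_r//; apply: integral_ge0 => z _.
  by rewrite lee_fin le_max lexx orbT.
rewrite {1}/pos max_l ?(ltW ly)//.
have -> : (l y)%:E = (\int[w]_z ((l y)%:E + (l z)%:E))%E.
  by rewrite integralD// integral_cst1 l_mean adde0.
apply: (le_integral measurableT _ (integrable_pos_shift y)).
  exact: integrableD.
by move=> z _; rewrite -EFinD lee_fin -lD le_max lexx.
Qed.

End additive_functional.

Section opposite.
Variable l : E -> R.
Hypotheses (ml : measurable_fun setT l) (lD : forall y z, l (tadd y z) = l y + l z).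
Hypothesis l_int : w.-integrable setT (EFin \o l).
Hypothesis l_mean : (\int[w]_z (l z)%:E = 0)%E.

(** The mean of [l (y + z)] is [l y], expressed through positive and negative parts and written
    without subtraction. *)
Lemma smear_pos_neg y :
  (smear w (fun x => (Num.max (l x) 0)%:E) y + (Num.max (- l y) 0)%:E =
   smear w (fun x => (Num.max (- l x) 0)%:E) y + (Num.max (l y) 0)%:E)%E.
Proof.
pose nl (x : E) := - l x.
have mnl : measurable_fun setT nl by exact: measurableT_comp.
have nlD y' z : nl (tadd y' z) = nl y' + nl z by rewrite /nl lD opprD.
have nl_int : w.-integrable setT (EFin \o nl).
  by rewrite (_ : EFin \o nl = (fun z => - (EFin \o l) z)%E)//; exact: integrableN.
have i1 := integrable_pos_shift ml lD l_int y.
have i2 := integrable_pos_shift mnl nlD nl_int y.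
have ic (k : R) : w.-integrable setT (fun z => k%:E) by exact: finite_measure_integrable_cst.
have cstE (k : R) : (\int[w]_z k%:E = k%:E)%E.
  by rewrite integral_cst// [X in (_ * X)%E](probability_setT w) mule1.
have iD := integrableD measurableT i2 (ic (Num.max (l y) 0)).
rewrite /smear -(cstE (Num.max (- l y) 0)) -(cstE (Num.max (l y) 0)).
(* The added zero, as the mean of [l], balances the term [l z] in the integrands. *)
rewrite -[RHS]adde0 -l_mean.
rewrite -(integralD measurableT i1 (ic _)) -(integralD measurableT i2 (ic _)).
rewrite -(integralD measurableT iD l_int).
apply: eq_integral => z _; rewrite /= -!EFinD /nl; congr EFin.
have maxN (x : R) : Num.max x 0 = x + Num.max (- x) 0.
  by case: (leP x 0) => x0; [rewrite max_l|rewrite max_r]; lra.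
by rewrite (maxN (l (tadd y z))) (maxN (l y)) lD; ring.
Qed.

End opposite.

Section square_norm.
Hypothesis w_mean : forall i : 'I_d, (\int[w]_x (tnth x i)%:E = 0)%E.
Variable sigma : R.
Hypothesis w_var : (\int[w]_x (sqnorm x)%:E = (sigma ^+ 2)%:E)%E.

Lemma measurable_sqnorm : measurable_fun setT (@sqnorm R d).
Proof.
apply: measurable_sum => i; apply: measurable_funX; exact: measurable_tnth.
Qed.

Lemma sqnorm_ge0 (x : E) : 0 <= sqnorm x.
Proof. by apply: sumr_ge0 => i _; exact: sqr_ge0. Qed.

Let sqnorm_int : w.-integrable setT (fun z => (sqnorm z)%:E).
Proof.
apply/integrableP; split.
  by apply/measurable_EFinP; exact: measurable_sqnorm.
rewrite (eq_integral (fun z => (sqnorm z)%:E)).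
  by rewrite w_var ltry.
by move=> z _; rewrite gee0_abs// lee_fin sqnorm_ge0.
Qed.

Lemma integrable_tnth i : w.-integrable setT (fun z : E => (tnth z i)%:E).
Proof.
have i1 : w.-integrable setT (fun z => 1%:E + (sqnorm z)%:E)%E.
  by apply: integrableD => //; exact: finite_measure_integrable_cst.
apply: (le_integrable measurableT _ _ i1).
  by apply/measurable_EFinP; exact: measurable_tnth.
move=> z _; rewrite -EFinD !abse_EFin lee_fin [leRHS]ger0_norm; last by rewrite addr_ge0 ?sqnorm_ge0.
have : tnth z i ^+ 2 <= sqnorm z.
  by rewrite /sqnorm (bigD1 i)//= lerDl sumr_ge0// => j _; exact: sqr_ge0.
have := sqr_ge0 (`|tnth z i| - 1); rewrite -[tnth z i ^+ 2]real_normK ?num_real//.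
nra.
Qed.

Lemma smear_sqnorm y : smear w (EFin \o @sqnorm R d) y = (sqnorm y + sigma ^+ 2)%:E.
Proof.
have e z : ((sqnorm (tadd y z))%:E = (sqnorm y)%:E +
    (\sum_(i < d) (2 * tnth y i)%:E * (tnth z i)%:E + (sqnorm z)%:E))%E.
  under eq_bigr do rewrite -EFinM.
  rewrite sumEFin -!EFinD /sqnorm -!big_split/=; congr EFin; apply: eq_bigr => i _.
  by rewrite tnth_tadd; ring.
rewrite /smear (eq_integral _ _ (fun z _ => e z)).
have isum : w.-integrable setT (fun z : E => \sum_(i < d) (2 * tnth y i)%:E * (tnth z i)%:E)%E.
  by apply: integrable_sum => // i _; apply: integrableZl => //; exact: integrable_tnth.
rewrite integralD//; last 2 first.
- exact: finite_measure_integrable_cst.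
- exact: integrableD.
rewrite integral_cst// [X in (_ * X)%E](probability_setT w) mule1.
rewrite integralD// w_var integral_sum//; last first.
  by move=> i; apply: integrableZl => //; exact: integrable_tnth.
rewrite big1 ?add0e// => i _.
by rewrite integralZl ?w_mean ?mule0//; exact: integrable_tnth.
Qed.

End square_norm.
End smeared_weights.

(** * Particles of the initial population that have not jumped *)

Section past_mass.
Context {R : realType}.
Local Notation mu := (@lebesgue_measure R).
Variables (psi : R -> R) (m : R -> \bar R).
Hypothesis psi_gt0 : forall t, 0 < psi t.
Hypothesis psi_ni : forall s t, s <= t -> psi t <= psi s.
Hypothesis psi_cvg0 : psi t @[t --> +oo] --> 0.
Hypotheses (mm : measurable_fun setT m) (m0 : forall s, (0 <= m s)%E).

Let past (t s : R) : R := if s < 0 then psi (t - s) else 0.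

Definition past_mass (t : R) : \bar R := (\int[mu]_s ((past t s)%:E * m s))%E.

Let measurable_psi : measurable_fun setT psi.
Proof.
apply: nonincreasing_measurable; first exact: measurableT.
by move=> x y; exact: psi_ni.
Qed.

Let mpast t : measurable_fun setT (past t).
Proof.
apply: measurable_fun_ifT => //; first exact: measurable_fun_ltr.
have mt : measurable_fun setT (fun s : R => t - s) by exact: measurable_funB.
exact: (measurableT_comp measurable_psi mt).
Qed.

Let past0 t s : 0 <= past t s.
Proof. by rewrite /past; case: ifP => // _; exact/ltW. Qed.

Let past_le t1 t2 s : t1 <= t2 -> past t2 s <= past t1 s.
Proof. by move=> t12; rewrite /past; case: ifP => // _; rewrite psi_ni// lerD2r. Qed.

Let mintegrand t : measurable_fun setT (fun s : R => (past t s)%:E * m s)%E.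
Proof.
by apply: emeasurable_funM; [apply/measurable_EFinP; exact: mpast|exact: mm].
Qed.

Let integrand0 t s : (0 <= (past t s)%:E * m s)%E.
Proof. by rewrite mule_ge0 ?lee_fin. Qed.

Lemma past_mass_ge0 t : (0 <= past_mass t)%E.
Proof. by apply: integral_ge0 => s _; exact: integrand0. Qed.

Lemma past_mass_le t1 t2 : t1 <= t2 -> (past_mass t2 <= past_mass t1)%E.
Proof.
move=> t12; apply: (ge0_le_integral mu measurableT (fun s _ => integrand0 t2 s)
  (mintegrand t2) (mintegrand t1)) => s _.
by rewrite lee_wpmul2r// lee_fin past_le.
Qed.

(** Dominated convergence along the integers, the value at time 0 being the dominating function;
    monotonicity in [t] covers the other times. *)
Lemma past_mass_cvg0 : (past_mass 0 < +oo)%E ->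
  forall e, 0 < e -> exists A, forall t, A <= t -> (past_mass t <= e%:E)%E.
Proof.
move=> fin0 e e0.
pose F (n : nat) s := ((past n%:R s)%:E * m s)%E.
have g_int : mu.-integrable setT (fun s : R => (past 0 s)%:E * m s)%E.
  apply/integrableP; split; first exact: mintegrand.
  by under eq_integral do rewrite gee0_abs//.
have F_cvg : {ae mu, forall s : R, setT s -> F n s @[n --> \oo] --> cst 0%E s}.
  have := integrable_ae measurableT g_int.
  apply: (@filterS _ _ (ae_filter_ringOfSetsType _)) => s /(_ Logic.I) + _.
  rewrite /F /past; case: (ltP s 0) => s0; last first.
    by move=> _; under eq_fun do rewrite mul0e; exact: cvg_cst.
  (* [m s = +oo] would make the dominating function infinite, as [psi] is positive; this happens on
     a null set only. *)
  rewrite sub0r; have := m0 s; case: (m s) => [x| |]// _; last by rewrite gt0_muley ?lte_fin.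
  move=> _; under eq_fun do rewrite -EFinM.
  apply: cvg_EFin; first by near=> n; rewrite fin_numE.
  rewrite -(mul0r x); apply: cvgMl.
  have ns : (n%:R - s) @[n --> \oo] --> +oo.
    apply/cvgryPge => A; near=> n; rewrite lerBrDr; near: n; exact: nbhs_infty_ger.
  exact: (cvg_comp _ _ ns psi_cvg0).
have F_le : {ae mu, forall (s : R) (n : nat), setT s -> (`|F n s| <= (past 0 s)%:E * m s)%E}.
  apply: aeW => s n _; rewrite gee0_abs; last exact: integrand0.
  by rewrite lee_wpmul2r// lee_fin past_le.
have [_ _] := dominated_convergence (mu := mu) (f_ := F) measurableT (fun n : nat => mintegrand n%:R)
  (measurable_cst 0%E) F_cvg g_int F_le.
rewrite integral0 => /fine_cvgP[] _ /cvgrPdist_le /(_ e e0) [] N _ /(_ N (leqnn N)) /=.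
rewrite sub0r normrN ger0_norm ?fine_ge0 ?past_mass_ge0// => FN.
exists N%:R => t Nt; apply: le_trans (past_mass_le Nt) _.
rewrite -lee_fin fineK// in FN.
rewrite ge0_fin_numE ?past_mass_ge0//.
by apply: le_lt_trans fin0; apply: past_mass_le.
Unshelve. all: by end_near.
Qed.
(** Separates the living particles by whether they have jumped since time 0. *)
Lemma memory_massD_past t : 0 <= t -> (memory_mass psi m t + past_mass t =
  \int[mu]_s ((if (s < t)%R then psi (t - s)%R else 0%R)%:E * m s))%E.
Proof.
move=> t0; rewrite /memory_mass /past_mass.
pose g s : R := (if 0 <= s then 1 else 0) * (if 0 < t - s then psi (t - s) else 0).
have g0 s : 0 <= g s.
  by rewrite /g; apply: mulr_ge0; case: ifP => // _; exact/ltW.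
have mt : measurable_fun setT (fun s : R => t - s) by exact: measurable_funB.
have mpv : measurable_fun setT (fun u : R => if 0 < u then psi u else 0).
  by apply: measurable_fun_ifT => //; exact: measurable_fun_ltr.
have mg : measurable_fun setT g.
  apply: measurable_funM; last exact: (measurableT_comp mpv mt).
  by apply: measurable_fun_ifT => //; exact: measurable_fun_ler.
have mgm : measurable_fun setT (fun s : R => (g s)%:E * m s)%E.
  by apply: emeasurable_funM; [apply/measurable_EFinP; exact: mg|exact: mm].
have g0m s : (0 <= (g s)%:E * m s)%E by rewrite mule_ge0 ?lee_fin.
rewrite -(ge0_integralD mu measurableT (fun s _ => g0m s) mgm
  (fun s _ => integrand0 t s) (mintegrand t)).
apply: eq_integral => s _; rewrite -ge0_muleDl ?lee_fin//; congr (_%:E * _)%E.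
rewrite /g /past subr_gt0; case: (ltP s 0) => s0.
  by rewrite mul0r add0r (lt_le_trans s0 t0).
by rewrite mul1r addr0.
Qed.

End past_mass.

(** * Moments of the solution *)

Lemma power_decay_cvg0 (R : realType) (f : R -> R) (k a b : R) : 0 < a -> 0 < b ->
  (exists C, \forall t \near +oo, `|f t - k * t `^ (- a)| <= C * t `^ (- a - b)) ->
  f t @[t --> +oo] --> 0.
Proof.
move=> a0 b0 [C fC]; apply/cvgrPdist_le => /= e e0.
(* For [1 <= t] one has [t^(- a - b) <= t^(- a)], so [|C| + |k|] bounds the coefficient; adding 1
   makes [D] positive. *)
pose D := `|C| + `|k| + 1.
have D0 : 0 < D by rewrite ltr_wpDl// addr_ge0.
near=> t.
have t1 : 1 <= t by near: t; exact: nbhs_pinfty_ge.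
have tA : (D / e) `^ a^-1 <= t by near: t; exact: nbhs_pinfty_ge.
have t0 : 0 < t := lt_le_trans ltr01 t1.
have p0 : 0 <= t `^ (- a) := powR_ge0 _ _.
have ft : `|f t - k * t `^ (- a)| <= C * t `^ (- a - b) by near: t.
have pb : t `^ (- a - b) <= t `^ (- a) by rewrite ler_powR// gerBl ltW.
have pe : D * t `^ (- a) <= e.
  have q0 : 0 < D / e by rewrite divr_gt0.
  rewrite powRN ler_pdivrMr ?powR_gt0// mulrC -ler_pdivrMr//.
  apply: (@le_trans _ _ (((D / e) `^ a^-1) `^ a)).
    by rewrite -powRrM mulVf ?gt_eqF// powRr1// ltW.
  by rewrite ge0_ler_powR ?nnegrE ?powR_ge0 ?(ltW t0) ?(ltW a0).
rewrite sub0r normrN; apply: le_trans pe.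
rewrite -(subrK (k * t `^ (- a)) (f t)); apply: (le_trans (ler_normD _ _)).
rewrite normrM (ger0_norm p0).
have : C * t `^ (- a - b) <= `|C| * t `^ (- a).
  apply: (@le_trans _ _ (`|C| * t `^ (- a - b))).
    by rewrite ler_wpM2r ?powR_ge0// ler_norm.
  by rewrite ler_wpM2l.
by rewrite /D !mulrDl; lra.
Unshelve. all: by end_near.
Qed.

(** Extends an identity between finite differences to infinite parts: each part stays finite or
    stays infinite, so both sides take the same conventional value. *)
Lemma sube_eq_of_lty (R : realDomainType) (p0 n0 p n : \bar R) :
  (0 <= p0 -> 0 <= n0 -> 0 <= p -> 0 <= n -> (p0 = +oo -> p = +oo) ->
  (n0 = +oo -> n = +oo) -> (p0 < +oo -> p < +oo) -> (n0 < +oo -> n < +oo) ->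
  (p0 < +oo -> n0 < +oo -> p - n = p0 - n0) -> p - n = p0 - n0)%E.
Proof.
move: p0 n0 => [p0| |] [n0| |]// _ _ pp nn p_oo n_oo p_fin n_fin H.
- by apply: H; exact: ltry.
- by rewrite n_oo//; move: (p_fin (ltry _)); case: p {p_oo p_fin H} pp.
- by rewrite p_oo//; move: (n_fin (ltry _)); case: n {n_oo n_fin H} nn.
- by rewrite p_oo// n_oo.
Qed.

Section solution_moments.
Context {R : realType} (d : nat) (w : probability (d.-tuple R) R).
Context (beta : R -> R).
Local Notation mu := (@lebesgue_measure R).
Local Notation leb := (lebesgue_tuple R d).
Local Notation psi := (survival beta).
Local Notation E := (d.-tuple R).
Hypothesis beta_ge0 : forall a, 0 <= a -> 0 <= beta a.
Hypothesis beta_bounded : exists M : R, forall a, 0 <= a -> beta a <= M.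
Hypothesis beta_cont : {within `[0, +oo[, continuous beta}.
Variables (r0 : R -> E -> R) (r : R -> R -> E -> R).
Hypothesis r0_L1 : (mu \x leb)%E.-integrable (`]0, +oo[ `*` [set: E])
  (fun p => (r0 p.1 p.2)%:E).
Hypothesis r0_ge0 : forall a x, 0 < a -> 0 <= r0 a x.
Hypothesis r_sol : mild_solution w beta r0 r.
Local Notation cp := (renewal_density beta r0 r).
Local Notation rho t := (age_total (r t)).
Local Notation rho0 := (age_total r0).
Local Open Scope ereal_scope.

Let mcp : measurable_fun setT cp.
Proof. exact: (measurable_renewal_density beta_ge0 beta_cont r0_L1 r_sol). Qed.

Let cp0 p : (0 <= cp p)%R.
Proof. exact: renewal_density_ge0. Qed.

Let cpE := renewal_density_boundary beta_ge0 beta_cont r0_L1 r0_ge0 r_sol.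
Let window_lty T := @renewal_density_window_lty _ _ _ _ beta_ge0 beta_cont _ _ r0_L1 r_sol T.
Let alive_lty := renewal_density_alive_lty beta_ge0 beta_cont r0_L1 r0_ge0 r_sol.

Let rho0E : rho0 = rho 0%R.
Proof. exact: (age_total_initial r_sol). Qed.

Lemma mass_moment t : (0 <= t)%R -> \int[leb]_x rho t x = moment cp (alive beta t) (cst 1).
Proof.
move=> t0.
have H := integral_ge0_age_total beta_ge0 beta_cont r0_L1 r0_ge0 r_sol t0
  (measurable_cst (1 : \bar R)) (fun _ => lee01).
by rewrite -[RHS]H; apply: eq_integral => x _; rewrite mul1e.
Qed.

Lemma mass_conservation t : (0 <= t)%R -> \int[leb]_x rho t x = \int[leb]_x rho0 x.
Proof.
move=> t0; rewrite rho0E.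
exact: (etrans (mass_moment t0) (etrans (moment_alive1 beta_ge0 beta_cont mcp cp0 cpE
  window_lty t0) (esym (mass_moment (lexx 0%R))))).
Qed.

Section first_moment.
Hypothesis w_mean : forall i : 'I_d, \int[w]_x (tnth x i)%:E = 0.
Variable i : 'I_d.
Hypothesis tnth_int : w.-integrable setT (fun z : E => (tnth z i)%:E).
Let l (x : E) : R := tnth x i.
Let pos (x : E) : R := Num.max (l x) 0%R.
Let neg (x : E) : R := Num.max (- l x)%R 0%R.
Let k := mean_abs w l.

Let ml : measurable_fun setT l. Proof. exact: measurable_tnth. Qed.
Let lD y z : (l (tadd y z) = l y + l z)%R. Proof. exact: tnth_tadd. Qed.
Let l_mean : \int[w]_z (l z)%:E = 0. Proof. exact: w_mean. Qed.

Let nl (x : E) : R := (- l x)%R.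
Let mnl : measurable_fun setT nl. Proof. exact: measurableT_comp. Qed.
Let nlD y z : (nl (tadd y z) = nl y + nl z)%R. Proof. by rewrite /nl lD opprD. Qed.
Let nl_int : w.-integrable setT (EFin \o nl).
Proof.
by rewrite (_ : EFin \o nl = (fun z => - (EFin \o l) z))//; exact: integrableN.
Qed.
Let nl_mean : \int[w]_z (nl z)%:E = 0.
Proof.
transitivity ((-1)%:E * \int[w]_z (l z)%:E); last by rewrite l_mean mule0.
rewrite -(integralZl measurableT tnth_int); apply: eq_integral => z _.
by rewrite -EFinM mulN1r.
Qed.
Let mean_abs_nl : mean_abs w nl = k.
Proof.
by congr (fine _); apply: eq_integral => z _; rewrite /nl normrN.
Qed.

Let mpos : measurable_fun setT pos. Proof. exact: measurable_maxr. Qed.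
Let mneg : measurable_fun setT neg. Proof. exact: measurable_maxr. Qed.
Let pos0 x : (0 <= pos x)%R. Proof. by rewrite le_max lexx orbT. Qed.
Let neg0 x : (0 <= neg x)%R. Proof. by rewrite le_max lexx orbT. Qed.
Let k0 : (0 <= k)%R. Proof. exact: mean_abs_ge0. Qed.

Let smear_pos y : (pos y)%:E <= smear w (EFin \o pos) y <= (pos y + k)%:E.
Proof.
apply/andP; split.
- exact: (smear_pos_ge ml lD tnth_int l_mean).
- exact: (smear_pos_le ml lD tnth_int).
Qed.

Let smear_neg y : (neg y)%:E <= smear w (EFin \o neg) y <= (neg y + k)%:E.
Proof.
apply/andP; split.
- exact: (smear_pos_ge mnl nlD nl_int nl_mean).
- by rewrite -mean_abs_nl; exact: (smear_pos_le mnl nlD nl_int).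
Qed.

Let smear_pm y : smear w (EFin \o pos) y + (neg y)%:E = smear w (EFin \o neg) y + (pos y)%:E.
Proof. exact: (smear_pos_neg ml lD tnth_int l_mean). Qed.

Local Notation Mp t := (moment cp (alive beta t) (EFin \o pos)).
Local Notation Mn t := (moment cp (alive beta t) (EFin \o neg)).

Let first_momentE t : (0 <= t)%R -> \int[leb]_x ((tnth x i)%:E * rho t x) = Mp t - Mn t.
Proof.
by move=> t0; exact: (integral_age_total beta_ge0 beta_cont r0_L1 r0_ge0 r_sol t0 ml).
Qed.

Let mEpos : measurable_fun setT (EFin \o pos). Proof. exact/measurable_EFinP. Qed.
Let mEneg : measurable_fun setT (EFin \o neg). Proof. exact/measurable_EFinP. Qed.

Let alive_fin (phi : E -> R) t : measurable_fun setT phi -> (forall x, 0 <= phi x)%R ->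
  (forall y, (phi y)%:E <= smear w (EFin \o phi) y <= (phi y + k)%:E) -> (0 <= t)%R ->
  moment cp (alive beta 0) (EFin \o phi) < +oo -> moment cp (alive beta t) (EFin \o phi) < +oo.
Proof.
move=> mphi phi0 sphi t0 fin0.
have ephi : measurable_fun setT (EFin \o phi) by exact/measurable_EFinP.
have ephi0 x : 0 <= (EFin \o phi) x by rewrite lee_fin.
apply: le_lt_trans (moment_alive_lty beta_ge0 beta_cont mcp cp0 cpE window_lty alive_lty mphi
  phi0 k0 t0 sphi fin0).
have sphi1 x : (EFin \o phi) x <= smear w (EFin \o phi) x by case/andP : (sphi x).
exact: (le_moment mcp cp0 (measurable_alive beta_ge0 beta_cont t) (alive_ge0 beta t)
  (measurable_alive beta_ge0 beta_cont t) ephi ephi0 (measurable_smear w ephi ephi0)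
  (fun s => lexx (alive beta t s)) sphi1).
Qed.

Let alive_oo (phi : E -> \bar R) t : measurable_fun setT phi -> (forall x, 0 <= phi x) -> (0 <= t)%R ->
  moment cp (alive beta 0) phi = +oo -> moment cp (alive beta t) phi = +oo.
Proof.
move=> mphi phi0 t0; have [M bM] := beta_bounded.
exact: (moment_alive_oo beta_ge0 beta_cont mcp cp0 mphi phi0 t0 bM).
Qed.

Let Mpn t : (0 <= t)%R -> Mp t - Mn t = Mp 0 - Mn 0.
Proof.
move=> t0.
have Mp0 s : 0 <= Mp s := moment_ge0 cp0 (alive_ge0 beta s) (fun x => pos0 x : 0 <= (EFin \o pos) x).
have Mn0 s : 0 <= Mn s := moment_ge0 cp0 (alive_ge0 beta s) (fun x => neg0 x : 0 <= (EFin \o neg) x).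
apply: (sube_eq_of_lty (Mp0 0%R) (Mn0 0%R) (Mp0 t) (Mn0 t)).
- exact: (alive_oo mEpos (fun x => pos0 x : 0 <= (EFin \o pos) x) t0).
- exact: (alive_oo mEneg (fun x => neg0 x : 0 <= (EFin \o neg) x) t0).
- exact: (alive_fin mpos pos0 smear_pos t0).
- exact: (alive_fin mneg neg0 smear_neg t0).
- exact: (moment_alive_diff beta_ge0 beta_cont mcp cp0 cpE window_lty alive_lty mpos pos0
    mneg neg0 k0 t0 smear_pos smear_neg smear_pm).
Qed.

Lemma first_moment_conservation t : (0 <= t)%R ->
  \int[leb]_x ((tnth x i)%:E * rho t x) = \int[leb]_x ((tnth x i)%:E * rho0 x).
Proof.
move=> t0; rewrite rho0E.
exact: (etrans (first_momentE t0) (etrans (Mpn t0) (esym (first_momentE (lexx 0%R))))).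
Qed.

Lemma first_moment_integrable t : (0 <= t)%R ->
  leb.-integrable setT (fun x => (tnth x i)%:E * rho0 x) ->
  leb.-integrable setT (fun x => (tnth x i)%:E * rho t x).
Proof.
move=> t0; rewrite rho0E => /integrableP[_ abs0]; apply/integrableP; split.
  apply: emeasurable_funM; first exact/measurable_EFinP.
  exact: (measurable_age_total beta_ge0 beta_cont r0_L1 r_sol t0).
have absE s : (0 <= s)%R -> \int[leb]_x `|(tnth x i)%:E * rho s x| =
    moment cp (alive beta s) (fun x => `|l x|%:E).
  move=> s0.
  exact: (integral_abs_age_total beta_ge0 beta_cont r0_L1 r0_ge0 r_sol s0 ml).
have abs_fin : moment cp (alive beta 0) (fun x => `|l x|%:E) < +oo.
  exact: (eq_ind _ (fun y => y < +oo) abs0 _ (absE _ (lexx 0%R))).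
have mabs : measurable_fun setT (fun x => `|l x|%:E).
  by apply/measurable_EFinP; exact: measurableT_comp.
have ma s := measurable_alive beta_ge0 beta_cont s.
have part_fin (phi : E -> R) : measurable_fun setT (EFin \o phi) -> (forall x, 0 <= phi x)%R ->
    (forall x, phi x <= `|l x|)%R -> moment cp (alive beta 0) (EFin \o phi) < +oo.
  move=> mphi phi0 phil; apply: le_lt_trans abs_fin.
  have phi0' x : 0 <= (EFin \o phi) x by rewrite lee_fin.
  have phil' x : (EFin \o phi) x <= `|l x|%:E by rewrite lee_fin.
  exact: (le_moment mcp cp0 (ma 0%R) (alive_ge0 beta 0%R) (ma 0%R) mphi phi0' mabs
    (fun s => lexx (alive beta 0%R s)) phil').
have pos_le x : (pos x <= `|l x|)%R by rewrite ge_max ler_norm normr_ge0.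
have neg_le x : (neg x <= `|l x|)%R by rewrite ge_max normr_ge0 andbT -normrN ler_norm.
have fp := alive_fin mpos pos0 smear_pos t0 (part_fin pos mEpos pos0 pos_le).
have fn := alive_fin mneg neg0 smear_neg t0 (part_fin neg mEneg neg0 neg_le).
have e : (fun x => `|l x|%:E) = (fun x => (EFin \o pos) x + (EFin \o neg) x).
  apply/funext => x; rewrite /= -EFinD /pos /neg; congr EFin.
  case/orP : (le_total 0%R (l x)) => lx.
    by rewrite (ger0_norm lx) (max_l lx) max_r ?addr0// oppr_le0.
  by rewrite (ler0_norm lx) (max_r lx) max_l ?add0r// oppr_ge0.
have D := momentDr mcp cp0 (ma t) (alive_ge0 beta t) mEpos (fun x => pos0 x : 0 <= (EFin \o pos) x)
  mEneg (fun x => neg0 x : 0 <= (EFin \o neg) x).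
have De := etrans (absE t t0) (etrans (congr1 (moment cp (alive beta t)) e) D).
exact: (eq_ind_r (fun y => y < +oo) (lte_add_pinfty fp fn) De).
Qed.

End first_moment.

Section second_moment.
Variables (sigma Psi alpha delta : R).
Hypothesis w_mean : forall i : 'I_d, \int[w]_x (tnth x i)%:E = 0.
Hypothesis w_var : \int[w]_x (sqnorm x)%:E = (sigma ^+ 2)%:E.
Hypothesis Psi_gt0 : (0 < Psi)%R.
Hypotheses (alpha_gt0 : (0 < alpha)%R) (alpha_lt1 : (alpha < 1)%R).
Hypotheses (delta_gt0 : (0 < delta)%R) (delta_lt : (delta < 1 - alpha)%R).
Hypothesis psi_asymp : (exists C : R, \forall t \near +oo,
  `|psi t - Psi * t `^ (- alpha)| <= C * t `^ (- alpha - delta))%R.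
Hypothesis rho0_lty : \int[leb]_x ((sqnorm x)%:E * rho0 x) < +oo.
(** The birth rate [N'] at nonnegative times; at negative times, the initial population recorded at
    the instants of its last jumps. *)
Let m : R -> \bar R := pairing cp (cst 1).
Let M0 : R := fine (\int[leb]_x rho0 x).

Let mass_alive t : (0 <= t)%R -> moment cp (alive beta t) (cst 1) = M0%:E.
Proof.
move=> t0.
have e : moment cp (alive beta t) (cst 1) = \int[leb]_x rho0 x.
  exact: (etrans (esym (mass_moment t0)) (mass_conservation t0)).
have e0 : moment cp (alive beta 0) (cst 1) = \int[leb]_x rho0 x.
  exact: (etrans (esym (mass_moment (lexx 0%R))) (mass_conservation (lexx 0%R))).
rewrite e fineK// -e0.
exact: (ge0_lty_fin_num (moment_ge0 cp0 (alive_ge0 beta 0%R) (fun _ => lee01)) alive_lty).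
Qed.

Let mm : measurable_fun setT m.
Proof. exact: (measurable_pairing mcp cp0 (measurable_cst _) (fun _ => lee01)). Qed.

Let m0 s : 0 <= m s.
Proof. exact: (pairing_ge0 cp0 (fun _ => lee01)). Qed.

Let psi_ni s t : (s <= t)%R -> (psi t <= psi s)%R.
Proof. by move=> st; exact: survival_nonincreasing. Qed.

Let psi_cvg0 : (psi t @[t --> +oo] --> 0)%R.
Proof. exact: (power_decay_cvg0 alpha_gt0 delta_gt0 psi_asymp). Qed.

Let memory_past t : (0 <= t)%R -> memory_mass psi m t + past_mass psi m t = M0%:E.
Proof.
move=> t0.
exact: (etrans (memory_massD_past (survival_gt0 beta) psi_ni mm m0 t0) (mass_alive t0)).
Qed.

Let past_lty : past_mass psi m 0 < +oo.
Proof.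
apply: (@le_lt_trans _ _ M0%:E); last exact: ltry.
rewrite -(memory_past (lexx 0%R)) leeDr//.
exact: (memory_mass_ge0 (survival_gt0 beta) m0).
Qed.

Let sqE : E -> R := @sqnorm R d.
Let msq : measurable_fun setT sqE. Proof. exact: measurable_sqnorm. Qed.
Let sq0 x : (0 <= sqE x)%R. Proof. exact: sqnorm_ge0. Qed.

Let second_momentE t : (0 <= t)%R ->
  \int[leb]_x ((sqnorm x)%:E * rho t x) = moment cp (alive beta t) (EFin \o sqE).
Proof.
move=> t0; have msqE : measurable_fun setT (EFin \o sqE) by exact/measurable_EFinP.
exact: (integral_ge0_age_total beta_ge0 beta_cont r0_L1 r0_ge0 r_sol t0 msqE
  (fun x => sq0 x : 0 <= (EFin \o sqE) x)).
Qed.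

Let M2 : R := fine (\int[leb]_x ((sqnorm x)%:E * rho0 x)).

Let cumulated_lty t : (0 <= t)%R -> cumulated_mass m t < +oo.
Proof. exact: window_lty. Qed.

Let cumulated_fin t : (0 <= t)%R -> cumulated_mass m t \is a fin_num.
Proof.
move=> t0; apply: ge0_lty_fin_num (cumulated_lty t0).
exact: (moment_ge0 cp0 (window_ge0 t) (fun _ => lee01)).
Qed.

Lemma second_moment_growth t : (0 <= t)%R ->
  \int[leb]_x ((sqnorm x)%:E * rho t x) =
  (M2 + sigma ^+ 2 * fine (cumulated_mass m t))%:E.
Proof.
move=> t0.
have e0 : moment cp (alive beta 0) (EFin \o sqE) = \int[leb]_x ((sqnorm x)%:E * rho0 x).
  by rewrite rho0E; exact: (esym (second_momentE (lexx 0%R))).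
have fin0 : moment cp (alive beta 0) (EFin \o sqE) < +oo.
  exact: (eq_ind_r (fun y => y < +oo) rho0_lty e0).
have fin0' := ge0_lty_fin_num (moment_ge0 cp0 (alive_ge0 beta 0%R)
  (fun x => sq0 x : 0 <= (EFin \o sqE) x)) fin0.
have M2E : moment cp (alive beta 0) (EFin \o sqE) = M2%:E.
  by rewrite /M2 -e0 fineK.
have H := moment_alive_shift beta_ge0 beta_cont mcp cp0 cpE window_lty alive_lty msq sq0
  (sqr_ge0 sigma) t0 (smear_sqnorm w_mean w_var) fin0.
have UE : moment cp (window t) (cst 1) = (fine (cumulated_mass m t))%:E.
  exact: (esym (fineK (cumulated_fin t0))).
apply: (etrans (second_momentE t0)); apply: (etrans H).
exact: (congr2 (fun a b => a + (sigma ^+ 2)%:E * b) M2E UE).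
Qed.

Lemma second_moment_cvg :
  ((\int[leb]_x ((sqnorm x)%:E * rho t x)) * ((t `^ alpha)^-1)%:E)
    @[t --> +oo%R] -->
  (sin (pi * alpha) / (pi * alpha) * (sigma ^+ 2 / Psi))%:E * \int[leb]_x rho0 x.
Proof.
(* By conservation of mass, what separates the memory mass from [M0] is the initial population still
   in place. *)
have M0_cvg : (forall e, 0 < e -> exists A, forall t, A <= t ->
    ((M0 - e)%:E <= memory_mass psi m t)%E)%R.
  move=> e e0.
  have [A HA] := past_mass_cvg0 (survival_gt0 beta) psi_ni psi_cvg0 mm m0 past_lty e0.
  exists (Num.max A 0%R) => t; rewrite ge_max => /andP[At t0].
  by rewrite EFinB leeBlDr// -(memory_past t0) leeD2l// HA.
have M0_le t : (0 <= t)%R -> memory_mass psi m t <= M0%:E.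
  by move=> t0; rewrite -(memory_past t0) leeDl//; exact: (past_mass_ge0 (survival_gt0 beta) m0).
have U_cvg := cumulated_mass_cvg (survival_gt0 beta) (survival_le1 beta_ge0 beta_cont) psi_ni alpha_gt0
  alpha_lt1 delta_gt0 delta_lt Psi_gt0 psi_asymp mm m0 cumulated_lty M0_le M0_cvg.
pose g (t : R) : R := (M2 * t `^ (- alpha) + sigma ^+ 2 * (fine (cumulated_mass m t) / t `^ alpha))%R.
have M2_cvg : (M2 * t `^ (- alpha) @[t --> +oo] --> 0)%R.
  (* The initial second moment is negligible: a pure power satisfies the expansion with zero
     error. *)
  apply: (@power_decay_cvg0 R _ M2 alpha delta) => //.
  by exists 0%R; near=> t; rewrite subrr normr0 mul0r.
pose L : R := (sigma ^+ 2 * (M0 / (alpha * (Psi * (pi / sin (pi * alpha))))))%R.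
have g_cvg : (g t @[t --> +oo] --> L)%R.
  rewrite -[L]add0r; apply: (cvgD M2_cvg); exact: (cvgM (cvg_cst _) U_cvg).
have M0E : \int[leb]_x rho0 x = M0%:E.
  by rewrite -(mass_conservation (lexx 0%R)) (mass_moment (lexx 0%R)) mass_alive.
have -> : (sin (pi * alpha) / (pi * alpha) * (sigma ^+ 2 / Psi))%:E * \int[leb]_x rho0 x = L%:E.
  rewrite M0E -EFinM /L; congr EFin.
  have s0 : (0 < sin (pi * alpha))%R.
    by apply: sin_gt0_pi; rewrite mulr_gt0 ?pi_gt0//= gtr_pMr ?pi_gt0.
  have alg (p q a P s2 M : R) : (p != 0 -> q != 0 -> a != 0 -> P != 0 ->
      q / (p * a) * (s2 / P) * M = s2 * (M / (a * (P * (p / q)))))%R.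
    by move=> p0 q0 a0 P0; field; rewrite p0 q0 a0 P0.
  by apply: alg; rewrite gt_eqF// pi_gt0.
have E : {near +oo%R, (fun t : R => (g t)%:E) =1 (fun t : R =>
    (\int[leb]_x ((sqnorm x)%:E * rho t x)) * ((t `^ alpha)^-1)%:E)}.
  near=> t.
  have t0 : (0 <= t)%R by near: t; exact: nbhs_pinfty_ge.
  rewrite (second_moment_growth t0) -EFinM /g powRN; congr EFin; ring.
have gL : (g t)%:E @[t --> +oo%R] --> L%:E by apply: cvg_EFin => //; near=> t.
exact: (cvg_trans (near_eq_cvg E) gL).
Unshelve. all: by end_near.
Qed.

End second_moment.
End solution_moments.

(** The moments are extended reals. In (ii) the equality therefore includes infinite parts under the
    conventions for differences, and the implication between integrabilities restores its classical
    meaning. *)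
Theorem proposition1 (R : realType) (d : nat) (hd : (1 <= d)%N)
  (w : probability (d.-tuple R) R)
  (w_mean : forall i : 'I_d, (\int[w]_x (tnth x i)%:E = 0)%E)
  (sigma : R)
  (w_var : (\int[w]_x (sqnorm x)%:E = (sigma ^+ 2)%:E)%E)
  (beta : R -> R)
  (beta_ge0 : forall a, 0 <= a -> 0 <= beta a)
  (beta_bounded : exists M : R, forall a, 0 <= a -> beta a <= M)
  (beta_cont : {within `[0, +oo[, continuous beta})
  (Psi alpha delta : R)
  (Psi_gt0 : 0 < Psi)
  (alpha_gt0 : 0 < alpha) (alpha_lt1 : alpha < 1)
  (delta_gt0 : 0 < delta) (delta_lt : delta < 1 - alpha)
  (psi_asymp : exists C : R, \forall t \near +oo,
     `|survival beta t - Psi * t `^ (- alpha)| <= C * t `^ (- alpha - delta))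
  (r0 : R -> d.-tuple R -> R)
  (r0_L1 : (@lebesgue_measure R \x lebesgue_tuple R d)%E.-integrable
     (`]0, +oo[ `*` [set: d.-tuple R]) (fun p => (r0 p.1 p.2)%:E))
  (r0_ge0 : forall a x, 0 < a -> 0 <= r0 a x)
  (r : R -> R -> d.-tuple R -> R)
  (r_sol : mild_solution w beta r0 r) :
  let leb := lebesgue_tuple R d in
  let rho := fun t : R => age_total (r t) in
  let rho0 := age_total r0 in
  [/\ (* (i) *)
      forall t : R, 0 <= t ->
        (\int[leb]_x rho t x = \int[leb]_x rho0 x)%E,
      (* (ii) *)
      forall t : R, 0 <= t -> forall i : 'I_d,
        (leb.-integrable setT (fun x => (tnth x i)%:E * rho0 x)%E ->
         leb.-integrable setT (fun x => (tnth x i)%:E * rho t x)%E) /\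
        (\int[leb]_x ((tnth x i)%:E * rho t x)
          = \int[leb]_x ((tnth x i)%:E * rho0 x))%E &
      (* (iii) *)
      (\int[leb]_x ((sqnorm x)%:E * rho0 x) < +oo)%E ->
      ((\int[leb]_x ((sqnorm x)%:E * rho t x)) * ((t `^ alpha)^-1)%:E)%E
        @[t --> +oo] -->
      ((sin (pi * alpha) / (pi * alpha) * (sigma ^+ 2 / Psi))%:E
        * \int[leb]_x rho0 x)%E ].
Proof.
split.
- by move=> t t0; exact: (mass_conservation beta_ge0 beta_cont r0_L1 r0_ge0 r_sol).
- move=> t t0 i; have ti := integrable_tnth w_var i; split.
    by apply: (first_moment_integrable beta_ge0 beta_cont r0_L1 r0_ge0 r_sol w_mean ti t0).
  exact: (first_moment_conservation beta_ge0 beta_bounded beta_cont r0_L1 r0_ge0 r_sol w_mean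
    ti t0).
- move=> M2_lty; exact: (second_moment_cvg beta_ge0 beta_cont r0_L1 r0_ge0 r_sol w_mean w_var
    Psi_gt0 alpha_gt0 alpha_lt1 delta_gt0 delta_lt psi_asymp M2_lty).
Qed.
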